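(* Let $(\omega,\mathcal H,f)$ be a triple on $\mathbb R^2$ belonging to the singularity class $S_1$. Then $(\omega,\mathcal H,f)$ is equivalent to a triple of the form $$(\omega,\mathcal H,f)_{g(y)}:\qquad \omega = dx\wedge dg(y),\quad \mathcal H=\{y+x^2=0\},\quad f=g(y),\qquad g'(0)\neq 0,$$ where $(x,y)$ are coordinates on $\mathbb R^2$ and $g$ is a function germ of one variable (with $g(0)=0$, since $f(0)=0$). Moreover, the triple $(\omega,\mathcal H,f)_{g(y)}$ is equivalent to the triple $(\omega,\mathcal H,f)_{\widetilde g(y)}$ if and only if $\widetilde g(y)=g(y)$.
   Context: All objects (forms, functions, hypersurfaces, diffeomorphisms) are germs at $0$, and are either all $C^\infty$ or all analytic. A triple $(\omega,\mathcal H,f)$ on $\mathbb R^{2}$ consists of a symplectic form $\omega$, a smooth hypersurface $\mathcal H=\{h=0\}$, where $h$ is a function germ with $h(0)=0$, $dh(0)\neq 0$, and a function germ $f$ with $f(0)=0$. Two triples are equivalent if there is a local diffeomorphism fixing $0$ that brings the symplectic form, the hypersurface and the function of one triple to those of the other. The Hamiltonian vector field $Z_f$ of $f$ is defined by $Z_f\,\rfloor\,\omega = df$, where $\rfloor$ is the interior product, and $\{f,h\}=Z_f(h)$ is the Poisson bracket with respect to $\omega$. On $\mathbb R^2$, the singularity class $S_1$ consists of the triples $(\omega,\mathcal H,f)$ such that $\{f,h\}(0)=0$ and $\{f,\{f,h\}\}(0)\neq 0$. (These conditions do not depend on the choice of the function $h$ defining $\mathcal H$.)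
   Formalization: For C^∞ germs, equivalence of the two normal forms is characterized by g̃(y)=g(y) for y≤0 near 0, not by equality of germs: the stated ''only if'' fails there, e.g. g=y and g̃=y+e^{-1/y} for y>0, g̃=y for y≤0. The analytic case is as stated. *)

(* Defs.v *)
From Stdlib Require Import Reals Lra.
From Coquelicot Require Import Coquelicot.
Open Scope R_scope.

(* Germs at the origin are represented by total functions; statements about
   them only involve their values on some neighbourhood of 0. *)

Inductive category : Set := Smooth | Analytic.

Definition near (P : R -> R -> Prop) : Prop := locally_2d P 0 0.

(** * Regularity of germs *)

Definition smooth_germ1 (g : R -> R) : Prop :=
  locally 0 (fun y => forall n : nat, ex_derive_n g n y).

Definition analytic_germ1 (g : R -> R) : Prop :=
  exists a : nat -> R,
    Rbar_lt (Finite 0) (CV_radius a) /\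
    locally 0 (fun y => g y = PSeries a y).

(* One neighbourhood for all orders of differentiation; [ex_diff_n f n x y]
   asks that all iterated partial derivatives of order <= n exist and are
   continuous at (x, y). *)
Definition smooth_germ2 (f : R -> R -> R) : Prop :=
  near (fun x y => forall n : nat, ex_diff_n f n x y).

(* The bound on the coefficients makes the double series absolutely convergent
   for |x|, |y| < r, so that summing it iteratively is harmless. *)
Definition analytic_germ2 (f : R -> R -> R) : Prop :=
  exists (a : nat -> nat -> R) (M r : R),
    0 < r /\
    (forall i j : nat, Rabs (a i j) * r ^ (i + j) <= M) /\
    near (fun x y => f x y = PSeries (fun i => PSeries (a i) y) x).

Definition germ1 (k : category) (g : R -> R) : Prop :=
  match k with
  | Smooth => smooth_germ1 g
  | Analytic => analytic_germ1 g
  end.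

Definition germ2 (k : category) (f : R -> R -> R) : Prop :=
  match k with
  | Smooth => smooth_germ2 f
  | Analytic => analytic_germ2 f
  end.

(** * Differential forms and vector fields on the plane *)

(* The 1-form P dx + Q dy. *)
Record form1 := Form1 { dx_coef : R -> R -> R; dy_coef : R -> R -> R }.

(* The 2-form W dx /\ dy. *)
Record form2 := Form2 { dxdy_coef : R -> R -> R }.

(* The vector field X d/dx + Y d/dy. *)
Record vfield := VField { vx : R -> R -> R; vy : R -> R -> R }.

Definition diff (f : R -> R -> R) : form1 :=
  Form1 (fun x y => Derive (fun t => f t y) x)
        (fun x y => Derive (fun t => f x t) y).

Definition wedge (a b : form1) : form2 :=
  Form2 (fun x y => dx_coef a x y * dy_coef b x y
                    - dy_coef a x y * dx_coef b x y).

(* Z _| omega = omega (Z, .) *)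
Definition interior (Z : vfield) (w : form2) : form1 :=
  Form1 (fun x y => - (dxdy_coef w x y * vy Z x y))
        (fun x y => dxdy_coef w x y * vx Z x y).

Definition lie (Z : vfield) (h : R -> R -> R) (x y : R) : R :=
  vx Z x y * dx_coef (diff h) x y + vy Z x y * dy_coef (diff h) x y.

(* On the plane every 2-form is closed, and W dx /\ dy is nondegenerate at 0
   exactly when W(0) <> 0. *)
Definition symplectic (k : category) (w : form2) : Prop :=
  germ2 k (dxdy_coef w) /\ dxdy_coef w 0 0 <> 0.

(* The solution Z of Z _| w = df; see [ham_field_spec], [ham_field_unique]. *)
Definition ham_field (w : form2) (f : R -> R -> R) : vfield :=
  VField (fun x y => dy_coef (diff f) x y / dxdy_coef w x y)
         (fun x y => - (dx_coef (diff f) x y / dxdy_coef w x y)).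

Lemma ham_field_spec (w : form2) (f : R -> R -> R) (x y : R) :
  dxdy_coef w x y <> 0 ->
  dx_coef (interior (ham_field w f) w) x y = dx_coef (diff f) x y /\
  dy_coef (interior (ham_field w f) w) x y = dy_coef (diff f) x y.
Proof. intros Hw; simpl; split; field; exact Hw. Qed.

Lemma ham_field_unique (w : form2) (f : R -> R -> R) (Z : vfield) (x y : R) :
  dxdy_coef w x y <> 0 ->
  dx_coef (interior Z w) x y = dx_coef (diff f) x y ->
  dy_coef (interior Z w) x y = dy_coef (diff f) x y ->
  vx Z x y = vx (ham_field w f) x y /\ vy Z x y = vy (ham_field w f) x y.
Proof.
intros Hw Hx Hy; simpl in *; rewrite <- Hx, <- Hy.
split; field; exact Hw.
Qed.

Definition poisson (w : form2) (f h : R -> R -> R) : R -> R -> R :=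
  lie (ham_field w f) h.

(** * Triples *)

Record triple := Triple {
  form : form2;
  hyp : R -> R -> Prop;
  fn : R -> R -> R
}.

Definition defines (k : category) (h : R -> R -> R) (H : R -> R -> Prop) :
  Prop :=
  germ2 k h /\ h 0 0 = 0 /\
  (dx_coef (diff h) 0 0 <> 0 \/ dy_coef (diff h) 0 0 <> 0) /\
  near (fun x y => H x y <-> h x y = 0).

Definition is_triple (k : category) (T : triple) : Prop :=
  symplectic k (form T) /\
  (exists h, defines k h (hyp T)) /\
  germ2 k (fn T) /\ fn T 0 0 = 0.

Definition S1 (k : category) (T : triple) : Prop :=
  exists h, defines k h (hyp T) /\
    poisson (form T) (fn T) h 0 0 = 0 /\
    poisson (form T) (fn T) (poisson (form T) (fn T) h) 0 0 <> 0.

(** * Equivalence *)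

Record pmap := PMap { fst_comp : R -> R -> R; snd_comp : R -> R -> R }.

Definition map_germ (k : category) (p : pmap) : Prop :=
  germ2 k (fst_comp p) /\ germ2 k (snd_comp p) /\
  fst_comp p 0 0 = 0 /\ snd_comp p 0 0 = 0.

Definition inverse_near (p q : pmap) : Prop :=
  near (fun x y =>
    fst_comp q (fst_comp p x y) (snd_comp p x y) = x /\
    snd_comp q (fst_comp p x y) (snd_comp p x y) = y).

Definition diffeo_germ (k : category) (p : pmap) : Prop :=
  map_germ k p /\
  exists q, map_germ k q /\ inverse_near p q /\ inverse_near q p.

Definition pullback (p : pmap) (w : form2) : form2 :=
  Form2 (fun x y =>
    dxdy_coef w (fst_comp p x y) (snd_comp p x y) *
    dxdy_coef (wedge (diff (fst_comp p)) (diff (snd_comp p))) x y).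

Definition equivalent (k : category) (T T' : triple) : Prop :=
  exists p, diffeo_germ k p /\
    near (fun x y => dxdy_coef (pullback p (form T')) x y
                     = dxdy_coef (form T) x y) /\
    near (fun x y => hyp T x y <-> hyp T' (fst_comp p x y) (snd_comp p x y)) /\
    near (fun x y => fn T' (fst_comp p x y) (snd_comp p x y) = fn T x y).

(** * The normal form *)

Definition admissible (k : category) (g : R -> R) : Prop :=
  germ1 k g /\ g 0 = 0 /\ Derive g 0 <> 0.

Definition normal_form (g : R -> R) : triple :=
  Triple (wedge (diff (fun x y => x)) (diff (fun x y => g y)))
         (fun x y => y + x ^ 2 = 0)
         (fun x y => g y).

(* The curve y + x^2 = 0 lies in y <= 0, so the triple of g only sees the
   values of g there.  If smooth g1, g2 agree for y <= 0 (but possibly differ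
   for y > 0), then (x, y) |-> (x, g2^-1 (g1 y)) fixes the curve pointwise and
   carries one triple to the other: in the smooth category the germ of g is an
   invariant on the half-line only. *)
Definition same_invariant (k : category) (g1 g2 : R -> R) : Prop :=
  match k with
  | Smooth => locally 0 (fun y => y <= 0 -> g1 y = g2 y)
  | Analytic => locally 0 (fun y => g1 y = g2 y)
  end.

(* Main.v *)
Require Import Defs.
From Stdlib Require Import Reals.
From Stdlib Require Import Ranalysis5 Lra Lia ClassicalEpsilon ssreflect.
From Coquelicot Require Import Coquelicot.

(* In coordinates (t, f) with dt /\ df = omega, the Hamiltonian field of f is d/dt,
   and the S1 condition says that the hypersurface is a graph f = phi(t) with a
   nondegenerate critical point of phi at 0. The coordinate changes still allowed
   are t -> t - a(f). Write phi = c u^2 and split the inverse function of u as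
   t = A(u^2) + u B(u^2); since u^2 = f/c on the hypersurface, P = t - A(f/c)
   satisfies P^2 = (f/c) B(f/c)^2 there, so y = - (f/c) B(f/c)^2 and g is the
   inverse of this function of f.

   Conversely an equivalence of normal forms is (x, y) -> (x + c(y), phi(y)) with
   g' (phi y) = g y, and the symmetry x -> - x of the parabola forces c = 0 and
   phi = id on y <= 0.

   The two categories differ only in four facts: composition, the inverse function
   theorem with a parameter, primitives, and the splitting into even and odd parts.
   In the smooth case the last one is Whitney's theorem, which rests on Borel's
   lemma; there the n-th term of the series is an n-fold primitive of a rapidly
   oscillating cosine, which makes bump functions unnecessary. In the analytic case
   everything happens in weighted l1 algebras of double power series. *)

(** * Smooth functions on open sets of the plane *)

(** Only the shears by a(f) remain because a second function t' with dt' /\ df = dt /\ df makes d(t'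
    - t) a multiple of df. The new ordinate y = kap(f) is then free: with g the inverse of kap, f =
    g(y) and omega = dx /\ dg(y) come out together, so the whole problem is to straighten one curve.
    The obstacle is the even part of t: it is smooth in u, but as a function of s = u^2 it is given
    on s >= 0 only, whereas a and kap must be germs on both sides of 0. Borel's lemma supplies the
    missing side. A smooth germ has one neighbourhood valid at all orders, so every smooth
    construction keeps a fixed box while the order grows. An analytic germ comes with a bound on
    each coefficient separately, which products do not preserve; weighted l1 sums are preserved, and
    the passage from the former to the latter costs a shrinking of the radius. Hence the traffic
    between [coef_bound] and [l1_bound]. *)

Definition open2 (U : R -> R -> Prop) : Prop :=
  forall x y, U x y -> locally_2d U x y.

Definition box (r : R) (x y : R) : Prop := Rabs x < r /\ Rabs y < r.

Lemma open2_box (r : R) : open2 (box r).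
Proof.
intros x y [Hx Hy].
assert (Hd : 0 < Rmin (r - Rabs x) (r - Rabs y)) by (apply Rmin_pos; lra).
exists (mkposreal _ Hd); intros u v Hu Hv; simpl in Hu, Hv.
pose proof (Rmin_l (r - Rabs x) (r - Rabs y)).
pose proof (Rmin_r (r - Rabs x) (r - Rabs y)).
split; revert Hu Hv; split_Rabs; lra.
Qed.

Lemma near_box (P : R -> R -> Prop) :
  near P <-> exists r, 0 < r /\ forall x y, box r x y -> P x y.
Proof.
split.
- intros [d Hd]; exists d; split; [apply cond_pos|].
  intros x y [Hx Hy]; apply Hd; rewrite Rminus_0_r; assumption.
- intros [r [Hr H]]; exists (mkposreal r Hr); intros u v Hu Hv.
  simpl in *; rewrite !Rminus_0_r in Hu Hv; apply H; split; assumption.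
Qed.

Lemma box_le (r r' x y : R) : r <= r' -> box r x y -> box r' x y.
Proof. intros H [H1 H2]; split; lra. Qed.

Lemma box_0 (r : R) : 0 < r -> box r 0 0.
Proof. intros H; split; rewrite Rabs_R0; exact H. Qed.

(** The partial derivatives are witnesses, not [Derive] terms, so that closure proofs can supply
    them as formulas. The set [U] is the same at every order, as [smooth_germ2] demands of its
    neighbourhood. *)
Fixpoint Cn (n : nat) (U : R -> R -> Prop) (f : R -> R -> R) : Prop :=
  (forall x y, U x y -> continuity_2d_pt f x y) /\
  match n with
  | O => True
  | S m => exists fx fy : R -> R -> R,
      (forall x y, U x y -> is_derive (fun t => f t y) x (fx x y)) /\
      (forall x y, U x y -> is_derive (fun t => f x t) y (fy x y)) /\
      Cn m U fx /\ Cn m U fy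
  end.

Lemma Cn_continuity (n : nat) U f x y :
  Cn n U f -> U x y -> continuity_2d_pt f x y.
Proof. destruct n; intros [H _]; apply H. Qed.

Lemma open2_slice_x U x y : open2 U -> U x y -> locally x (fun t => U t y).
Proof. intros HU Hxy; apply locally_2d_1d_const_y, HU, Hxy. Qed.

Lemma open2_slice_y U x y : open2 U -> U x y -> locally y (fun t => U x t).
Proof. intros HU Hxy; apply locally_2d_1d_const_x, HU, Hxy. Qed.

Lemma Cn_ext (n : nat) U f g :
  open2 U -> (forall x y, U x y -> f x y = g x y) -> Cn n U f -> Cn n U g.
Proof.
intros HU E H.
assert (Hc : forall x y, U x y -> continuity_2d_pt g x y).
{ intros x y Hxy; apply continuity_2d_pt_ext_loc with f.
  - apply locally_2d_impl with (2 := HU x y Hxy), locally_2d_forall; exact E.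
  - apply (Cn_continuity _ _ _ _ _ H Hxy). }
destruct n as [|n]; split; auto.
destruct H as [_ [fx [fy [Hx [Hy [Cx Cy]]]]]].
exists fx, fy; split; [|split]; [| |auto].
- intros x y Hxy; apply is_derive_ext_loc with (fun t => f t y); auto.
  apply filter_imp with (2 := open2_slice_x _ _ _ HU Hxy); intros t; apply E.
- intros x y Hxy; apply is_derive_ext_loc with (fun t => f x t); auto.
  apply filter_imp with (2 := open2_slice_y _ _ _ HU Hxy); intros t; apply E.
Qed.

Lemma Cn_subset (n : nat) (U V : R -> R -> Prop) f :
  (forall x y, U x y -> V x y) -> Cn n V f -> Cn n U f.
Proof.
intros HUV; revert f; induction n as [|n IH]; intros f [Hc H]; split; auto.
destruct H as [fx [fy [Hx [Hy [Cx Cy]]]]]; exists fx, fy; auto.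
Qed.

Lemma Cn_pred (n : nat) U f : Cn (S n) U f -> Cn n U f.
Proof.
revert f; induction n as [|n IH]; intros f [Hc H]; split; auto.
destruct H as [fx [fy [Hx [Hy [Cx Cy]]]]]; exists fx, fy; auto.
Qed.

(** On an open set the witnesses are forced to agree with [Derive] near each point, so they can be
    exchanged for it. *)
Lemma Cn_ex_diff_n (n : nat) U f :
  open2 U -> (Cn n U f <-> forall x y, U x y -> ex_diff_n f n x y).
Proof.
intros HU; revert f; induction n as [|n IH]; intros f; split.
- intros [H _] x y Hxy; split; auto.
- intros H; split; auto; intros x y Hxy; apply (H x y Hxy).
- intros [Hc [fx [fy [Hx [Hy [Cx Cy]]]]]] x y Hxy.
  split; [auto|]; split; [|split]; [| |split].
  + exists (fx x y); auto.
  + exists (fy x y); auto.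
  + apply ex_diff_n_ext_loc with fx; [|now apply IH].
    apply locally_2d_impl with (2 := HU x y Hxy), locally_2d_forall.
    intros u v Huv; symmetry; apply is_derive_unique; auto.
  + apply ex_diff_n_ext_loc with fy; [|now apply IH].
    apply locally_2d_impl with (2 := HU x y Hxy), locally_2d_forall.
    intros u v Huv; symmetry; apply is_derive_unique; auto.
- intros H; split; [intros x y Hxy; apply (H x y Hxy)|].
  exists (fun x y => Derive (fun t => f t y) x),
         (fun x y => Derive (fun t => f x t) y).
  split; [|split]; [| |split].
  + intros x y Hxy; apply Derive_correct; apply (H x y Hxy).
  + intros x y Hxy; apply Derive_correct; apply (H x y Hxy).
  + apply IH; intros x y Hxy; apply (H x y Hxy).
  + apply IH; intros x y Hxy; apply (H x y Hxy).
Qed.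

Lemma smooth_germ2_Cn (f : R -> R -> R) :
  smooth_germ2 f <-> exists r, 0 < r /\ forall n, Cn n (box r) f.
Proof.
unfold smooth_germ2; rewrite near_box; split; intros [r [Hr H]]; exists r;
  split; auto.
- intros n; apply Cn_ex_diff_n; [apply open2_box|auto].
- intros x y Hxy n; apply (Cn_ex_diff_n n (box r)); auto; apply open2_box.
Qed.

Lemma Cn_const (n : nat) U (c : R) : Cn n U (fun _ _ => c).
Proof.
revert c; induction n as [|n IH]; intros c; split; auto;
  try (intros; apply continuity_2d_pt_const).
exists (fun _ _ => 0), (fun _ _ => 0).
split; [|split]; auto; intros; apply: is_derive_const.
Qed.

Lemma Cn_fst (n : nat) U : Cn n U (fun x _ => x).
Proof.
destruct n as [|n]; split; auto; try (intros; apply continuity_2d_pt_id1).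
exists (fun _ _ => 1), (fun _ _ => 0).
split; [|split]; [| |split; apply Cn_const]; intros;
  [apply: is_derive_id|apply: is_derive_const].
Qed.

Lemma Cn_snd (n : nat) U : Cn n U (fun _ y => y).
Proof.
destruct n as [|n]; split; auto; try (intros; apply continuity_2d_pt_id2).
exists (fun _ _ => 0), (fun _ _ => 1).
split; [|split]; [| |split; apply Cn_const]; intros;
  [apply: is_derive_const|apply: is_derive_id].
Qed.

Lemma Cn_plus (n : nat) U f g :
  Cn n U f -> Cn n U g -> Cn n U (fun x y => f x y + g x y).
Proof.
revert f g; induction n as [|n IH]; intros f g [cf Hf] [cg Hg]; split; auto;
  try (intros; apply continuity_2d_pt_plus; auto).
destruct Hf as [fx [fy [Hx [Hy [Cx Cy]]]]].
destruct Hg as [gx [gy [Kx [Ky [Dx Dy]]]]].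
exists (fun x y => fx x y + gx x y), (fun x y => fy x y + gy x y).
split; [|split]; auto; intros; apply: is_derive_plus; auto.
Qed.

Lemma Cn_mult (n : nat) U f g :
  Cn n U f -> Cn n U g -> Cn n U (fun x y => f x y * g x y).
Proof.
revert f g; induction n as [|n IH]; intros f g Hf Hg;
  pose proof Hf as [cf Hf']; pose proof Hg as [cg Hg']; split; auto;
  try (intros; apply continuity_2d_pt_mult; auto).
destruct Hf' as [fx [fy [Hx [Hy [Cx Cy]]]]].
destruct Hg' as [gx [gy [Kx [Ky [Dx Dy]]]]].
exists (fun x y => fx x y * g x y + f x y * gx x y),
       (fun x y => fy x y * g x y + f x y * gy x y).
apply Cn_pred in Hf; apply Cn_pred in Hg.
split; [|split]; [| |split].
- intros x y Hxy; apply: is_derive_mult; auto; intros; apply Rmult_comm.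
- intros x y Hxy; apply: is_derive_mult; auto; intros; apply Rmult_comm.
- apply Cn_plus; apply IH; auto.
- apply Cn_plus; apply IH; auto.
Qed.

Lemma Cn_opp (n : nat) U f : open2 U -> Cn n U f -> Cn n U (fun x y => - f x y).
Proof.
intros HU H; apply Cn_ext with (fun x y => -1 * f x y); auto.
- intros; ring.
- apply Cn_mult; [apply Cn_const|assumption].
Qed.

Lemma Cn_inv (n : nat) U f :
  open2 U -> (forall x y, U x y -> f x y <> 0) -> Cn n U f ->
  Cn n U (fun x y => / f x y).
Proof.
intros HU; revert f; induction n as [|n IH]; intros f H0 Hf;
  pose proof Hf as [cf Hf']; split; auto;
  try (intros; apply continuity_2d_pt_inv; auto).
destruct Hf' as [fx [fy [Hx [Hy [Cx Cy]]]]].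
apply Cn_pred in Hf.
assert (Hi : Cn n U (fun x y => - (/ f x y * / f x y))).
{ apply Cn_opp, Cn_mult; auto. }
exists (fun x y => fx x y * - (/ f x y * / f x y)),
       (fun x y => fy x y * - (/ f x y * / f x y)).
split; [|split]; [| |split].
- intros x y Hxy.
  replace (fx x y * _) with (- fx x y / (f x y) ^ 2) by (field; auto).
  apply is_derive_inv with (f := fun t => f t y); auto.
- intros x y Hxy.
  replace (fy x y * _) with (- fy x y / (f x y) ^ 2) by (field; auto).
  apply is_derive_inv with (f := fun t => f x t); auto.
- apply Cn_mult; auto.
- apply Cn_mult; auto.
Qed.

(** The increment in x is controlled by the mean value theorem and the continuity of [fx], the
    increment in y by the derivative at the point itself. *)
Lemma C1_differentiable U f fx fy x y :
  open2 U ->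
  (forall x y, U x y -> is_derive (fun t => f t y) x (fx x y)) ->
  (forall x y, U x y -> is_derive (fun t => f x t) y (fy x y)) ->
  U x y -> continuity_2d_pt fx x y ->
  differentiable_pt_lim f x y (fx x y) (fy x y).
Proof.
intros HU Hx Hy Hxy Hc; apply filterdiff_differentiable_pt_lim.
apply: is_derive_filterdiff.
- apply (locally_2d_locally (fun u v => is_derive (fun z => f z v) u (fx u v))).
  apply locally_2d_impl with (2 := HU x y Hxy), locally_2d_forall; auto.
- auto.
- apply continuity_2d_pt_filterlim, Hc.
Qed.

Lemma is_derive_comp_2d f u v x lx ly du dv :
  differentiable_pt_lim f (u x) (v x) lx ly ->
  is_derive u x du -> is_derive v x dv ->
  is_derive (fun t => f (u t) (v t)) x (lx * du + ly * dv).
Proof.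
intros Hf Hu Hv; apply is_derive_Reals, derivable_pt_lim_comp_2d; auto;
  now apply is_derive_Reals.
Qed.

Lemma continuity_2d_pt_comp f u v x y :
  continuity_2d_pt f (u x y) (v x y) ->
  continuity_2d_pt u x y -> continuity_2d_pt v x y ->
  continuity_2d_pt (fun x y => f (u x y) (v x y)) x y.
Proof.
intros Hf Hu Hv; apply continuity_2d_pt_filterlim.
apply continuity_2d_pt_filterlim in Hf, Hu, Hv.
apply (filterlim_comp_2 _ _ f Hu Hv).
apply filterlim_filter_le_1 with (2 := Hf).
intros P [e He]; exists (ball (u x y) e) (ball (v x y) e);
  try apply locally_ball.
intros a b Ha Hb; apply He; split; assumption.
Qed.

Lemma Cn_comp (n : nat) U V f u v :
  open2 U -> open2 V -> (forall x y, U x y -> V (u x y) (v x y)) ->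
  Cn n V f -> Cn n U u -> Cn n U v -> Cn n U (fun x y => f (u x y) (v x y)).
Proof.
intros HU HV HUV; revert f u v HUV.
induction n as [|n IH]; intros f u v HUV Hf Hu Hv;
  pose proof Hf as [cf Hf']; pose proof Hu as [cu Hu'];
  pose proof Hv as [cv Hv']; split; auto;
  try (intros; apply continuity_2d_pt_comp; auto).
destruct Hf' as [fx [fy [Hx [Hy [Cx Cy]]]]].
destruct Hu' as [ux [uy [Kx [Ky [Dx Dy]]]]].
destruct Hv' as [vx [vy [Lx [Ly [Ex Ey]]]]].
apply Cn_pred in Hf; apply Cn_pred in Hu; apply Cn_pred in Hv.
assert (Hd : forall x y, V x y ->
  differentiable_pt_lim f x y (fx x y) (fy x y)).
{ intros x y Hxy; apply C1_differentiable with V; auto.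
  apply (Cn_continuity _ _ _ _ _ Cx Hxy). }
exists (fun x y => fx (u x y) (v x y) * ux x y + fy (u x y) (v x y) * vx x y),
       (fun x y => fx (u x y) (v x y) * uy x y + fy (u x y) (v x y) * vy x y).
split; [|split]; [| |split].
- intros x y Hxy.
  apply (is_derive_comp_2d f (fun t => u t y) (fun t => v t y)); auto.
- intros x y Hxy.
  apply (is_derive_comp_2d f (fun t => u x t) (fun t => v x t)); auto.
- apply Cn_plus; apply Cn_mult; auto; apply IH; auto.
- apply Cn_plus; apply Cn_mult; auto; apply IH; auto.
Qed.

(** * Smooth inverse functions with a parameter *)

Lemma Rlt_Rmin x a b : x < Rmin a b -> x < a /\ x < b.
Proof. pose proof (Rmin_l a b); pose proof (Rmin_r a b); lra. Qed.

Lemma locally_Rabs (P : R -> Prop) r x :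
  (forall t, Rabs t < r -> P t) -> Rabs x < r -> locally x P.
Proof.
intros H Hx; assert (Hp : 0 < r - Rabs x) by lra.
exists (mkposreal _ Hp); intros t Ht; apply H.
revert Ht Hx; unfold ball; simpl; unfold AbsRing_ball, abs, minus, plus, opp;
  simpl; split_Rabs; lra.
Qed.

Lemma near_and P Q : near P -> near Q -> near (fun x y => P x y /\ Q x y).
Proof. apply locally_2d_and. Qed.

Lemma near_mono (P Q : R -> R -> Prop) :
  near P -> (forall x y, P x y -> Q x y) -> near Q.
Proof. intros HP H; apply locally_2d_impl with (2 := HP), locally_2d_forall; auto. Qed.

Lemma near_comp (P : R -> R -> Prop) u v :
  near P -> continuity_2d_pt u 0 0 -> continuity_2d_pt v 0 0 ->
  u 0 0 = 0 -> v 0 0 = 0 -> near (fun x y => P (u x y) (v x y)).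
Proof.
intros [d Hd] Cu Cv Hu Hv.
apply near_mono with (fun x y => Rabs (u x y - u 0 0) < d /\ Rabs (v x y - v 0 0) < d).
- apply near_and; [apply Cu|apply Cv].
- intros x y [H1 H2]; rewrite Hu in H1; rewrite Hv in H2; apply Hd; auto.
Qed.

Lemma near_0 P : near P -> P 0 0.
Proof. intros H; apply near_box in H; destruct H as [r [Hr H]]; apply H, box_0, Hr. Qed.

Lemma near_near P : near P -> near (fun x y => locally_2d P x y).
Proof.
rewrite !near_box; intros [r [Hr H]]; exists r; split; auto; intros x y Hxy.
apply locally_2d_impl with (2 := open2_box r x y Hxy), locally_2d_forall; auto.
Qed.

Lemma near_swap (P : R -> R -> Prop) : near P -> near (fun x y => P y x).
Proof. intros [d Hd]; exists d; auto. Qed.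

Lemma smooth_germ2_common_box f g :
  smooth_germ2 f -> smooth_germ2 g -> exists r, 0 < r /\
    (forall n, Cn n (box r) f) /\ (forall n, Cn n (box r) g).
Proof.
rewrite !smooth_germ2_Cn; intros [r [Hr Cf]] [p [Hp Cg]].
exists (Rmin r p); split; [apply Rmin_pos; auto|split]; intros n.
- apply Cn_subset with (2 := Cf n); intros x y; apply box_le, Rmin_l.
- apply Cn_subset with (2 := Cg n); intros x y; apply box_le, Rmin_r.
Qed.

Lemma smooth_germ2_comp f u v :
  smooth_germ2 f -> smooth_germ2 u -> smooth_germ2 v ->
  u 0 0 = 0 -> v 0 0 = 0 -> smooth_germ2 (fun x y => f (u x y) (v x y)).
Proof.
intros Hf Hu Hv Hu0 Hv0; apply smooth_germ2_Cn in Hf; destruct Hf as [r [Hr Cf]].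
destruct (smooth_germ2_common_box u v Hu Hv) as [p [Hp [Cu Cv]]].
assert (N : near (fun x y => box r (u x y) (v x y))).
{ apply near_comp; auto; [apply near_box; exists r; auto| |].
  - apply (Cn_continuity 0 _ _ _ _ (Cu 0%nat)), box_0, Hp.
  - apply (Cn_continuity 0 _ _ _ _ (Cv 0%nat)), box_0, Hp. }
apply near_box in N; destruct N as [e [He N]].
apply smooth_germ2_Cn; exists (Rmin e p); split; [apply Rmin_pos; auto|]; intros n.
apply Cn_comp with (box r); try apply open2_box; auto.
- intros x y Hxy; apply N, box_le with (2 := Hxy), Rmin_l.
- apply Cn_subset with (2 := Cu n); intros x y; apply box_le, Rmin_r.
- apply Cn_subset with (2 := Cv n); intros x y; apply box_le, Rmin_r.
Qed.

Lemma is_derive_continuity_pt (f : R -> R) x l : is_derive f x l -> continuity_pt f x.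
Proof.
intros H; apply continuity_pt_filterlim, (ex_derive_continuous f); now exists l.
Qed.

Lemma Rabs_between a b c r :
  Rabs a < r -> Rabs b < r -> Rmin a b <= c <= Rmax a b -> Rabs c < r.
Proof.
unfold Rmin, Rmax; destruct Rle_dec; split_Rabs; lra.
Qed.

Lemma MVT_ball (f df : R -> R) r a b :
  (forall x, Rabs x < r -> is_derive f x (df x)) -> Rabs a < r -> Rabs b < r ->
  exists c, Rmin a b <= c <= Rmax a b /\ Rabs c < r /\
    f b - f a = df c * (b - a).
Proof.
intros H Ha Hb; destruct (MVT_gen f a b df) as [c [Hc E]].
- intros x Hx; apply H, (Rabs_between a b); auto; lra.
- intros x Hx; apply is_derive_continuity_pt with (df x), H.
  apply (Rabs_between a b); auto.
- exists c; repeat split; try tauto; apply (Rabs_between a b); auto.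
Qed.

(** The increment is taken along an L-shaped path: vertically at [x0], then horizontally at height
    [y]. *)
Lemma MVT_2d f fx fy x0 y0 x y r :
  (forall x y, box r x y -> is_derive (fun t => f t y) x (fx x y)) ->
  (forall x y, box r x y -> is_derive (fun t => f x t) y (fy x y)) ->
  box r x0 y0 -> box r x y ->
  exists c d, Rmin x0 x <= c <= Rmax x0 x /\ Rabs d < r /\
    f x y - f x0 y0 = fx c y * (x - x0) + fy x0 d * (y - y0).
Proof.
intros Hx Hy [H0 H0'] [H1 H1'].
destruct (MVT_ball (fun t => f t y) (fun t => fx t y) r x0 x) as [c [Hc [_ Ec]]];
  auto; [intros t Ht; apply Hx; split; auto|].
destruct (MVT_ball (fun t => f x0 t) (fun t => fy x0 t) r y0 y) as [d [_ [Hd Ed]]];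
  auto; [intros t Ht; apply Hy; split; auto|].
exists c, d; repeat split; try tauto; simpl in *; lra.
Qed.

Lemma IVT_solve f a t :
  0 < a -> (forall x, - a <= x <= a -> continuity_pt f x) ->
  f (- a) < t < f a -> exists x, - a < x < a /\ f x = t.
Proof.
intros Ha Hc [H1 H2].
destruct (IVT_interv (fun x => f x - t) (- a) a) as [z [Hz Ez]]; try lra.
- intros x Hx; apply continuity_pt_minus; [apply Hc; lra|].
  apply continuity_pt_const; intros u v; reflexivity.
- exists z; split; [|lra].
  destruct Hz as [[Hz|Hz] [Hz'|Hz']]; subst; lra.
Qed.

(** Normalised case, with the x-derivative bounded below by m > 0. The intermediate value theorem
    solves F(x, s) = t; the mean value theorem makes the solution Lipschitz, hence differentiable;
    its partials are rational in [Fx] and [Fy] taken at (G, s), which raises the regularity one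
    order at a time. *)
Lemma inverse_param_smooth_pos F Fx Fy m M r :
  0 < r -> 0 < m -> F 0 0 = 0 ->
  (forall n, Cn n (box r) F) -> (forall n, Cn n (box r) Fx) ->
  (forall n, Cn n (box r) Fy) ->
  (forall x y, box r x y -> is_derive (fun t => F t y) x (Fx x y)) ->
  (forall x y, box r x y -> is_derive (fun t => F x t) y (Fy x y)) ->
  (forall x y, box r x y -> m <= Fx x y) ->
  (forall x y, box r x y -> Rabs (Fy x y) <= M) ->
  exists G, smooth_germ2 G /\ G 0 0 = 0 /\ near (fun t s => F (G t s) s = t).
Proof.
intros Hr Hm HF0 CF CFx CFy HFx HFy Hmx HM.
(* Half the radius keeps the closed interval [-a, a] inside the box where [F] is controlled. *)
set (a := r / 2).
assert (Ha : 0 < a < r) by (unfold a; lra).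
assert (Bab : forall x, - a <= x <= a -> Rabs x < r)
  by (intros x Hx; split_Rabs; lra).
assert (Br0 : Rabs 0 < r) by (rewrite Rabs_R0; lra).
assert (Mx : forall x x0 y, Rabs x < r -> Rabs x0 < r -> Rabs y < r ->
  exists c, Rabs c < r /\ F x y - F x0 y = Fx c y * (x - x0)).
{ intros x x0 y Hx H0 Hy.
  destruct (MVT_ball (fun t => F t y) (fun t => Fx t y) r x0 x)
    as [c [_ [Hc E]]]; auto; [|exists c; auto].
  intros t Ht; apply HFx; split; auto. }
assert (Hpa : m * a <= F a 0).
{ destruct (Mx a 0 0) as [c [Hc E]]; auto; [apply Bab; lra|].
  assert (Hc' := Hmx c 0 (conj Hc Br0)).
  rewrite HF0 in E; nra. }
assert (Hna : F (- a) 0 <= - (m * a)).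
{ destruct (Mx (- a) 0 0) as [c [Hc E]]; auto; [apply Bab; lra|].
  assert (Hc' := Hmx c 0 (conj Hc Br0)).
  rewrite HF0 in E; nra. }
assert (Hma : 0 < m * a / 2) by nra.
assert (Hs : forall x, - a <= x <= a -> exists d, 0 < d /\
  forall s, Rabs s < d -> Rabs (F x s - F x 0) < m * a / 2).
{ intros x Hx.
  assert (Hb : box r x 0) by (split; auto).
  destruct (Cn_continuity 0 _ _ _ _ (CF 0%nat) Hb (mkposreal _ Hma)) as [d Hd].
  exists d; split; [apply cond_pos|]; intros s Hsd; apply Hd.
  - rewrite Rminus_diag Rabs_R0; apply cond_pos.
  - rewrite Rminus_0_r; assumption. }
destruct (Hs a) as [d1 [Hd1 K1]]; [lra|].
destruct (Hs (- a)) as [d2 [Hd2 K2]]; [lra|].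
(* For |s| < e the end values F(a, s) and F(-a, s) stay beyond m a / 2 and - m a / 2, while |t| < e
   keeps t between them. *)
set (e := Rmin (m * a / 2) (Rmin r (Rmin d1 d2))).
assert (He : 0 < e) by (repeat apply Rmin_pos; lra).
assert (Hle : e <= m * a / 2 /\ e <= r /\ e <= d1 /\ e <= d2)
  by (unfold e, Rmin; repeat destruct Rle_dec; lra).
(* The condition on (t, s) stands under the existential, so that a total function [G] can be
   chosen. *)
assert (Hex : forall t s, exists x, box e t s -> - a < x < a /\ F x s = t).
{ intros t s; destruct (Rlt_dec (Rabs t) e) as [Ht|Ht];
    [destruct (Rlt_dec (Rabs s) e) as [Hs'|Hs']|].
  - destruct (IVT_solve (fun x => F x s) a t) as [x Hx]; try lra.
    + intros x Hx; apply continuity_pt_filterlim.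
      apply (ex_derive_continuous (fun t => F t s)); exists (Fx x s).
      apply HFx; split; [apply Bab; lra|lra].
    + assert (X1 := K1 s ltac:(lra)); assert (X2 := K2 s ltac:(lra)).
      revert X1 X2 Ht; split_Rabs; lra.
    + exists x; auto.
  - exists 0; intros [_ Hb]; lra.
  - exists 0; intros [Hb _]; lra. }
set (G := fun t s => proj1_sig (constructive_indefinite_description _ (Hex t s))).
assert (HG : forall t s, box e t s -> - a < G t s < a /\ F (G t s) s = t).
{ intros t s; unfold G; destruct constructive_indefinite_description; auto. }
assert (HGb : forall t s, box e t s -> box r (G t s) s).
{ intros t s Hts; split; [apply Bab; apply HG in Hts; lra|].
  destruct Hts; lra. }
(* [G] is an arbitrary choice of solutions, so its continuity has to be earned: dividing the mean
   value identity t - t0 = Fx (x - x0) + Fy (s - s0) by Fx >= m bounds its increments. *)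
assert (Lip : forall t s t0 s0, box e t s -> box e t0 s0 ->
  Rabs (G t s - G t0 s0) <=
  (1 + M) / m * Rmax (Rabs (t - t0)) (Rabs (s - s0))).
{ intros t s t0 s0 H H0.
  destruct (MVT_2d F Fx Fy (G t0 s0) s0 (G t s) s r)
    as [c [d [Hc [Bd E]]]]; auto.
  rewrite (proj2 (HG _ _ H)) (proj2 (HG _ _ H0)) in E.
  assert (Bc : Rabs c < r).
  { apply Bab; apply HG in H; apply HG in H0; revert Hc; unfold Rmin, Rmax.
    destruct Rle_dec; lra. }
  assert (X1 := Hmx c s (conj Bc (proj2 (HGb _ _ H)))).
  assert (X2 := HM (G t0 s0) d (conj (proj1 (HGb _ _ H0)) Bd)).
  set (z := Rmax (Rabs (t - t0)) (Rabs (s - s0))).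
  assert (Z1 : Rabs (t - t0) <= z) by apply Rmax_l.
  assert (Z2 : Rabs (s - s0) <= z) by apply Rmax_r.
  assert (Hq : m * Rabs (G t s - G t0 s0) <= (1 + M) * z).
  { apply Rle_trans with (Rabs (Fx c s * (G t s - G t0 s0))).
    - rewrite Rabs_mult (Rabs_pos_eq (Fx c s)); [|lra].
      apply Rmult_le_compat_r; [apply Rabs_pos|exact X1].
    - replace (Fx c s * (G t s - G t0 s0))
        with ((t - t0) + - (Fy (G t0 s0) d * (s - s0))) by lra.
      eapply Rle_trans; [apply Rabs_triang|].
      rewrite Rabs_Ropp Rabs_mult.
      assert (Rabs (Fy (G t0 s0) d) * Rabs (s - s0) <= M * z).
      { apply Rmult_le_compat; auto; apply Rabs_pos. }
      lra. }
  apply Rmult_le_reg_l with m; auto.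
  replace (m * ((1 + M) / m * z)) with ((1 + M) * z) by (field; lra); exact Hq. }
assert (HM0 : 0 <= M).
{ eapply Rle_trans; [apply Rabs_pos|apply (HM 0 0)]; apply box_0; auto. }
set (L := (1 + M) / m).
assert (HL : 0 < L) by (apply Rdiv_lt_0_compat; lra).
assert (Dif : forall t s, box e t s -> differentiable_pt_lim G t s
  (/ Fx (G t s) s) (- (Fy (G t s) s) * / Fx (G t s) s)).
{ intros t0 s0 H0 eps.
  set (x0 := G t0 s0).
  assert (Hb0 : box r x0 s0) by (apply HGb; auto).
  assert (Hp := Hmx _ _ Hb0).
  assert (DF : differentiable_pt_lim F x0 s0 (Fx x0 s0) (Fy x0 s0)).
  { apply C1_differentiable with (box r); auto; [apply open2_box|].
    apply (Cn_continuity 0 (box r)); auto. }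
  (* The tolerance is scaled because (x, s) moves by at most (L + 1) z and the remainder is finally
     divided by Fx >= m. *)
  assert (He' : 0 < eps * m / (L + 1)).
  { apply Rdiv_lt_0_compat; [|lra].
    apply Rmult_lt_0_compat; auto; apply cond_pos. }
  destruct (DF (mkposreal _ He')) as [d Hd]; simpl in Hd.
  assert (Hd' : 0 < d / (L + 1))
    by (apply Rdiv_lt_0_compat; [apply cond_pos|lra]).
  destruct (open2_box e t0 s0 H0) as [d3 Hd3].
  assert (Hd4 : 0 < Rmin d3 (d / (L + 1)))
    by (apply Rmin_pos; auto; apply cond_pos).
  exists (mkposreal _ Hd4); simpl; intros t s Ht Hs'.
  destruct (Rlt_Rmin _ _ _ Ht) as [Ht1 Ht2].
  destruct (Rlt_Rmin _ _ _ Hs') as [Hs1 Hs2].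
  assert (H : box e t s) by (apply Hd3; auto).
  assert (HLip := Lip t s t0 s0 H H0); fold L x0 in HLip; fold x0.
  set (z := Rmax (Rabs (t - t0)) (Rabs (s - s0))) in *.
  set (x := G t s) in *.
  assert (Hz : z < d / (L + 1)) by (apply Rmax_lub_lt; auto).
  assert (Hz0 : 0 <= z) by (eapply Rle_trans; [apply Rabs_pos|apply Rmax_l]).
  assert (Zs : Rabs (s - s0) <= z) by apply Rmax_r.
  assert (EL : (L + 1) * (d / (L + 1)) = d) by (field; lra).
  assert (Hzd : (L + 1) * z < d).
  { rewrite <- EL; apply Rmult_lt_compat_l; lra. }
  assert (HX := Hd x s ltac:(nra) ltac:(nra)).
  unfold x in HX at 1; rewrite (proj2 (HG _ _ H)) in HX.
  unfold x0 in HX at 1; rewrite (proj2 (HG _ _ H0)) in HX.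
  assert (Hmax : Rmax (Rabs (x - x0)) (Rabs (s - s0)) <= (L + 1) * z).
  { apply Rmax_lub; nra. }
  replace (x - x0 - (/ Fx x0 s0 * (t - t0) + - Fy x0 s0 * / Fx x0 s0 * (s - s0)))
    with (- (t - t0 - (Fx x0 s0 * (x - x0) + Fy x0 s0 * (s - s0))) * / Fx x0 s0)
    by (field; lra).
  rewrite Rabs_mult Rabs_Ropp (Rabs_pos_eq (/ Fx x0 s0));
    [|left; apply Rinv_0_lt_compat; lra].
  apply Rmult_le_reg_r with (Fx x0 s0); [lra|].
  rewrite Rmult_assoc Rinv_l; [|lra]; rewrite Rmult_1_r.
  eapply Rle_trans; [exact HX|].
  apply Rle_trans with (eps * m / (L + 1) * ((L + 1) * z)).
  - apply Rmult_le_compat_l; lra.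
  - replace (eps * m / (L + 1) * ((L + 1) * z)) with (eps * z * m)
      by (field; lra).
    apply Rmult_le_compat_l; auto.
    apply Rmult_le_pos; auto; left; apply cond_pos. }
(* Bootstrapping: the partials of [G] are built from [G] itself, so class [n] of [G] gives class [n]
   of its partials. *)
assert (CG : forall n, Cn n (box e) G).
{ assert (Cont : forall t s, box e t s -> continuity_2d_pt G t s).
  { intros t s Hts; apply differentiable_continuity_pt.
    do 2 eexists; apply Dif, Hts. }
  induction n as [|n IH]; split; auto.
  assert (Ci : Cn n (box e) (fun t s => / Fx (G t s) s)).
  { apply (Cn_inv n (box e) (fun t s => Fx (G t s) s)); [apply open2_box| |].
    - intros t s Hts; assert (X := Hmx _ _ (HGb _ _ Hts)); lra.
    - apply Cn_comp with (V := box r) (u := G) (v := fun t s => s); auto;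
        try apply open2_box; apply Cn_snd. }
  exists (fun t s => / Fx (G t s) s), (fun t s => - (Fy (G t s) s) * / Fx (G t s) s).
  split; [|split]; [| |split; auto].
  - intros t s Hts.
    replace (/ Fx (G t s) s) with
      (/ Fx (G t s) s * 1 + - (Fy (G t s) s) * / Fx (G t s) s * 0) by ring.
    apply (is_derive_comp_2d G (fun t => t) (fun _ => s)); auto;
      [apply: is_derive_id|apply: is_derive_const].
  - intros t s Hts.
    replace (- (Fy (G t s) s) * / Fx (G t s) s) with
      (/ Fx (G t s) s * 0 + - (Fy (G t s) s) * / Fx (G t s) s * 1) by ring.
    apply (is_derive_comp_2d G (fun _ => t) (fun s => s)); auto;
      [apply: is_derive_const|apply: is_derive_id].
  - apply Cn_mult; auto; apply Cn_opp; [apply open2_box|].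
    apply Cn_comp with (V := box r) (u := G) (v := fun t s => s); auto;
        try apply open2_box; apply Cn_snd. }
exists G; split; [|split].
- apply smooth_germ2_Cn; exists e; auto.
- destruct (HG 0 0 (box_0 e He)) as [H1 H2].
  destruct (Mx (G 0 0) 0 0) as [c [Hc E]]; auto; [apply Bab; lra|].
  assert (Hc' := Hmx c 0 (conj Hc Br0)).
  rewrite H2 HF0 in E.
  assert (E' : Fx c 0 * G 0 0 = 0) by lra.
  apply Rmult_integral in E'; lra.
- apply near_box; exists e; split; auto; intros t s Hts; apply HG, Hts.
Qed.

Lemma smooth_germ2_partials F :
  smooth_germ2 F -> exists r Fx Fy, 0 < r /\
    (forall n, Cn n (box r) F) /\ (forall n, Cn n (box r) Fx) /\
    (forall n, Cn n (box r) Fy) /\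
    (forall x y, box r x y -> is_derive (fun t => F t y) x (Fx x y)) /\
    (forall x y, box r x y -> is_derive (fun t => F x t) y (Fy x y)).
Proof.
intros HF; apply near_box in HF; destruct HF as [r [Hr H]].
exists r, (fun x y => Derive (fun t => F t y) x),
  (fun x y => Derive (fun t => F x t) y).
split; [exact Hr|split; [|split; [|split; [|split]]]]; intros.
- apply Cn_ex_diff_n; auto; apply open2_box.
- apply Cn_ex_diff_n; [apply open2_box|]; intros x y Hxy; apply (H x y Hxy (S n)).
- apply Cn_ex_diff_n; [apply open2_box|]; intros x y Hxy; apply (H x y Hxy (S n)).
- apply Derive_correct, (H x y H0 1%nat).
- apply Derive_correct, (H x y H0 1%nat).
Qed.

Lemma inverse_param_smooth F :
  smooth_germ2 F -> F 0 0 = 0 -> Derive (fun x => F x 0) 0 <> 0 ->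
  exists G, smooth_germ2 G /\ G 0 0 = 0 /\ near (fun t s => F (G t s) s = t).
Proof.
intros HF HF0 Hd0.
destruct (smooth_germ2_partials F HF) as [r [Fx [Fy [Hr [C [Cx [Cy [Hx Hy]]]]]]]].
assert (Ed : Derive (fun x => F x 0) 0 = Fx 0 0)
  by (apply is_derive_unique, Hx, box_0; auto).
rewrite Ed in Hd0; clear Ed; set (d := Fx 0 0) in *.
assert (Hdd : 0 < d * d / 2) by nra.
destruct (Cn_continuity 0 _ _ _ _ (Cx 0%nat) (box_0 r Hr)
  (mkposreal (Rabs d / 2) ltac:(assert (0 < Rabs d) by (apply Rabs_pos_lt; auto);
     lra))) as [e1 He1]; simpl in He1.
destruct (Cn_continuity 0 _ _ _ _ (Cy 0%nat) (box_0 r Hr) (mkposreal 1 Rlt_0_1))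
  as [e2 He2]; simpl in He2.
set (e := Rmin r (Rmin e1 e2)).
assert (He : 0 < e) by (repeat apply Rmin_pos; auto; apply cond_pos).
assert (Hle : e <= r /\ e <= e1 /\ e <= e2)
  by (unfold e, Rmin; repeat destruct Rle_dec; lra).
assert (Hsub : forall x y, box e x y -> box r x y)
  by (intros x y; apply box_le; lra).
(* Multiplying by d = Fx(0, 0) makes the x-derivative at least d^2 / 2 whatever the sign of d; the
   solution is then taken at the parameter d t. *)
destruct (inverse_param_smooth_pos (fun x y => d * F x y)
  (fun x y => d * Fx x y) (fun x y => d * Fy x y) (d * d / 2)
  (Rabs d * (Rabs (Fy 0 0) + 1)) e) as [G [HG [G0 EG]]]; auto.
- rewrite HF0; ring.
- intros n; apply Cn_subset with (V := box r); auto.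
  apply Cn_mult; auto; apply Cn_const.
- intros n; apply Cn_subset with (V := box r); auto.
  apply Cn_mult; auto; apply Cn_const.
- intros n; apply Cn_subset with (V := box r); auto.
  apply Cn_mult; auto; apply Cn_const.
- intros x y Hxy; apply (is_derive_scal (fun t => F t y)); auto.
- intros x y Hxy; apply (is_derive_scal (fun t => F x t)); auto.
- intros x y [X Y]; assert (Z := He1 x y); rewrite !Rminus_0_r in Z.
  specialize (Z ltac:(lra) ltac:(lra)); fold d in Z.
  revert Z; split_Rabs; nra.
- intros x y [X Y]; assert (Z := He2 x y); rewrite !Rminus_0_r in Z.
  specialize (Z ltac:(lra) ltac:(lra)).
  rewrite Rabs_mult; apply Rmult_le_compat_l; [apply Rabs_pos|].
  revert Z; split_Rabs; lra.
- assert (Hdt : smooth_germ2 (fun t _ => d * t)).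
  { apply smooth_germ2_Cn; exists 1; split; [lra|]; intros n.
    apply (Cn_mult n _ (fun _ _ => d) (fun t _ => t)); [apply Cn_const|apply Cn_fst]. }
  exists (fun t s => G (d * t) s); split; [|split].
  + apply (smooth_germ2_comp G (fun t _ => d * t) (fun _ s => s)); auto; [|ring].
    apply smooth_germ2_Cn; exists 1; split; [lra|]; intros n; apply Cn_snd.
  + rewrite Rmult_0_r; exact G0.
  + apply near_mono with (fun t s => d * F (G (d * t) s) s = d * t).
    * apply (near_comp (fun t s => d * F (G t s) s = t) (fun t _ => d * t)
        (fun _ s => s)); auto; try ring.
      -- apply continuity_2d_pt_mult;
           [apply continuity_2d_pt_const|apply continuity_2d_pt_id1].
      -- apply continuity_2d_pt_id2.
    * intros t s E; apply Rmult_eq_reg_l with d; auto.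
Qed.

(** * Smooth primitives *)

(** For m = 0, x times this integral is the primitive of [w] in x that vanishes at x = 0. The
    weights t^m are there because differentiating in x turns the moment m of [w] into the moment m +
    1 of its x-derivative, so the family is closed under differentiation. *)
Definition moment (m : nat) (w : R -> R -> R) (x y : R) : R :=
  RInt (fun t => t ^ m * w (t * x) y) 0 1.

Lemma Rabs_mult_le_unit t x : 0 <= t <= 1 -> Rabs (t * x) <= Rabs x.
Proof.
intros Ht; rewrite Rabs_mult (Rabs_pos_eq t); [|lra].
pose proof (Rabs_pos x); nra.
Qed.

Lemma Rmin_Rmax_unit t : Rmin 0 1 <= t <= Rmax 0 1 -> 0 <= t <= 1.
Proof. rewrite Rmin_left ?Rmax_right; lra. Qed.

Lemma continuity_2d_pt_pow f n x y :
  continuity_2d_pt f x y -> continuity_2d_pt (fun u v => f u v ^ n) x y.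
Proof.
intros Hf; apply (continuity_1d_2d_pt_comp (fun z => z ^ n) f); auto.
apply derivable_continuous_pt, derivable_pt_pow.
Qed.

Lemma continuity_pow_scale m w y x t :
  continuity_2d_pt w (t * x) y ->
  continuity_2d_pt (fun u v => v ^ m * w (v * u) y) x t.
Proof.
intros Hw; apply continuity_2d_pt_mult.
- apply continuity_2d_pt_pow, continuity_2d_pt_id2.
- apply (continuity_2d_pt_comp w (fun u v => v * u) (fun _ _ => y)); auto.
  + apply continuity_2d_pt_mult;
      [apply continuity_2d_pt_id2|apply continuity_2d_pt_id1].
  + apply continuity_2d_pt_const.
Qed.

Lemma continuity_2d_slice_x f x y :
  continuity_2d_pt f x y -> continuous (fun t => f t y) x.
Proof.
intros H; apply continuity_pt_filterlim, continuity_pt_locally; intros eps.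
destruct (H eps) as [d Hd]; exists d; intros t Ht; apply Hd; auto.
rewrite Rminus_diag Rabs_R0; apply cond_pos.
Qed.

Lemma continuity_2d_slice_y f x y :
  continuity_2d_pt f x y -> continuous (fun t => f x t) y.
Proof.
intros H; apply (continuity_2d_slice_x (fun y x => f x y)); intros eps.
destruct (H eps) as [d Hd]; exists d; auto.
Qed.

Lemma ex_RInt_moment m w r x y :
  (forall x y, box r x y -> continuity_2d_pt w x y) -> box r x y ->
  ex_RInt (fun t => t ^ m * w (t * x) y) 0 1.
Proof.
intros Hw Hxy; apply: ex_RInt_continuous.
intros t Ht; apply Rmin_Rmax_unit in Ht.
apply (continuity_2d_slice_y (fun u v => v ^ m * w (v * u) y)).
apply continuity_pow_scale, Hw; destruct Hxy; split; auto.
eapply Rle_lt_trans; [apply Rabs_mult_le_unit; lra|auto].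
Qed.

Lemma moment_continuity m w r x y :
  (forall x y, box r x y -> continuity_2d_pt w x y) -> box r x y ->
  continuity_2d_pt (moment m w) x y.
Proof.
intros Hw Hxy eps.
(* Uniform continuity needs a closed square inside the domain of [w], hence a size strictly between
   the point and [r]. *)
set (p := (Rmax (Rabs x) (Rabs y) + r) / 2).
assert (Hp : Rabs x < p /\ Rabs y < p /\ p < r).
{ destruct Hxy; pose proof (Rmax_l (Rabs x) (Rabs y)).
  pose proof (Rmax_r (Rabs x) (Rabs y)).
  assert (Rmax (Rabs x) (Rabs y) < r) by (apply Rmax_lub_lt; auto).
  unfold p; lra. }
destruct (uniform_continuity_2d w (- p) p (- p) p) with (eps := pos_div_2 eps)
  as [d Hd].
{ intros u v Hu Hv; apply Hw; split; split_Rabs; lra. }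
destruct (open2_box p x y) as [d' Hd']; [split; tauto|].
assert (Hdd : 0 < Rmin d d') by (apply Rmin_pos; apply cond_pos).
exists (mkposreal _ Hdd); simpl; intros u v Hu Hv.
assert (Hb : box p u v).
{ apply Hd'; eapply Rlt_le_trans; eauto; apply Rmin_r. }
assert (Eu : ex_RInt (fun t => t ^ m * w (t * u) v) 0 1).
{ apply ex_RInt_moment with r; auto; apply box_le with p; auto; lra. }
assert (Ex : ex_RInt (fun t => t ^ m * w (t * x) y) 0 1)
  by (apply ex_RInt_moment with r; auto).
unfold moment.
replace (RInt _ 0 1 - RInt _ 0 1)
  with (RInt (fun t => minus (t ^ m * w (t * u) v) (t ^ m * w (t * x) y)) 0 1)
  by (rewrite -> (RInt_minus (V := R_CompleteNormedModule)); auto).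
apply Rle_lt_trans with ((1 - 0) * (eps / 2)).
- apply abs_RInt_le_const; [lra| |].
  + apply (ex_RInt_minus (V := R_NormedModule)); auto.
  + intros t Ht; unfold minus, plus, opp; simpl.
    replace (t ^ m * w (t * u) v + - (t ^ m * w (t * x) y))
      with (t ^ m * (w (t * u) v - w (t * x) y)) by ring.
    rewrite Rabs_mult (Rabs_pos_eq (t ^ m)); [|apply pow_le; lra].
    assert (H1 : t ^ m <= 1).
    { rewrite <- (pow1 m); apply pow_incr; lra. }
    assert (0 <= t ^ m) by (apply pow_le; lra).
    assert (K : forall z, Rabs z < p -> - p <= t * z <= p).
    { intros z Hz; assert (Z := Rabs_mult_le_unit t z Ht).
      revert Z Hz; split_Rabs; lra. }
    assert (K' : forall z, Rabs z < p -> - p <= z <= p)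
      by (intros z Hz; revert Hz; split_Rabs; lra).
    assert (H2 : Rabs (w (t * u) v - w (t * x) y) < eps / 2).
    { destruct Hb as [B1 B2]; apply Hd; try (apply K; tauto); try (apply K'; tauto).
      - replace (t * u - t * x) with (t * (u - x)) by ring.
        eapply Rle_lt_trans; [apply Rabs_mult_le_unit; auto|].
        eapply Rlt_le_trans; [exact Hu|apply Rmin_l].
      - eapply Rlt_le_trans; [exact Hv|apply Rmin_l]. }
    pose proof (Rabs_pos (w (t * u) v - w (t * x) y)); nra.
- pose proof (cond_pos eps); lra.
Qed.

Lemma open2_preimage_box r a b :
  (forall x y, continuity_2d_pt a x y) -> (forall x y, continuity_2d_pt b x y) ->
  open2 (fun x y => box r (a x y) (b x y)).
Proof.
intros Ca Cb x y Hxy; destruct (open2_box r _ _ Hxy) as [d Hd].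
apply locally_2d_impl with (2 := locally_2d_and _ _ _ _ (Ca x y d) (Cb x y d)).
apply locally_2d_forall; intros u v [H1 H2]; auto.
Qed.

(** [U] is an open set of pairs (parameter, integration variable) that contains the whole segment 0
    <= t <= 1 for parameters near [u]. In this form differentiation under the integral serves both
    partials of a moment. *)
Lemma is_derive_RInt_unit (K K' : R -> R -> R) (U : R -> R -> Prop) (u : R) :
  open2 U -> (forall z t, U z t -> is_derive (fun z => K z t) z (K' z t)) ->
  (forall z t, U z t -> continuity_2d_pt K' z t) ->
  locally u (fun z => ex_RInt (K z) 0 1) ->
  locally u (fun z => forall t, 0 <= t <= 1 -> U z t) ->
  is_derive (fun z => RInt (K z) 0 1) u (RInt (K' u) 0 1).
Proof.
intros HU HK CK HI HV.
assert (HVu := locally_singleton _ _ HV); cbv beta in HVu.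
replace (RInt (K' u) 0 1) with (RInt (fun t => Derive (fun z => K z t) u) 0 1).
- apply is_derive_RInt_param; auto.
  + generalize HV; apply filter_imp; intros z Hz t.
    rewrite Rmin_left; [|lra]; rewrite Rmax_right; [|lra]; intros Ht.
    eexists; apply HK; auto.
  + intros t Ht; apply Rmin_Rmax_unit in Ht.
    apply continuity_2d_pt_ext_loc with K'; [|auto].
    apply locally_2d_impl with (2 := HU u t (HVu t Ht)), locally_2d_forall.
    intros z s Hzs; symmetry; apply is_derive_unique, HK, Hzs.
- apply RInt_ext; intros t; rewrite Rmin_left; [|lra]; rewrite Rmax_right; [|lra].
  intros Ht; apply is_derive_unique, HK, HVu; lra.
Qed.

Lemma box_scale r x y t : 0 <= t <= 1 -> box r x y -> box r (t * x) y.
Proof.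
intros Ht [Hx Hy]; split; auto.
eapply Rle_lt_trans; [apply Rabs_mult_le_unit; auto|auto].
Qed.

Lemma is_derive_moment_x m w wx r x y :
  (forall x y, box r x y -> continuity_2d_pt w x y) ->
  (forall x y, box r x y -> continuity_2d_pt wx x y) ->
  (forall x y, box r x y -> is_derive (fun t => w t y) x (wx x y)) ->
  box r x y ->
  is_derive (fun z => moment m w z y) x (moment (S m) wx x y).
Proof.
intros Cw Cx Hx Hxy; assert (Hl := open2_slice_x _ _ _ (open2_box r) Hxy).
apply (is_derive_RInt_unit (fun z t => t ^ m * w (t * z) y)
  (fun z t => t ^ S m * wx (t * z) y) (fun z t => box r (t * z) y)).
- apply open2_preimage_box; intros.
  + apply continuity_2d_pt_mult;
      [apply continuity_2d_pt_id2|apply continuity_2d_pt_id1].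
  + apply continuity_2d_pt_const.
- intros z t Htz.
  replace (t ^ S m * wx (t * z) y) with (t ^ m * (t * wx (t * z) y))
    by (simpl; ring).
  apply (is_derive_scal (fun z => w (t * z) y)).
  apply (is_derive_comp (fun z => w z y) (fun z => t * z)); [apply Hx; auto|].
  auto_derive; auto; ring.
- intros z t Htz; apply (continuity_pow_scale (S m)), Cx, Htz.
- generalize Hl; apply filter_imp; intros z Hz; apply ex_RInt_moment with r; auto.
- generalize Hl; apply filter_imp; intros z Hz t Ht; apply box_scale; auto.
Qed.

Lemma is_derive_moment_y m w wy r x y :
  (forall x y, box r x y -> continuity_2d_pt w x y) ->
  (forall x y, box r x y -> continuity_2d_pt wy x y) ->
  (forall x y, box r x y -> is_derive (fun t => w x t) y (wy x y)) ->
  box r x y ->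
  is_derive (fun z => moment m w x z) y (moment m wy x y).
Proof.
intros Cw Cy Hy Hxy; assert (Hl := open2_slice_y _ _ _ (open2_box r) Hxy).
assert (Ctx : forall z t, continuity_2d_pt (fun _ t => t * x) z t).
{ intros; apply continuity_2d_pt_mult;
    [apply continuity_2d_pt_id2|apply continuity_2d_pt_const]. }
apply (is_derive_RInt_unit (fun z t => t ^ m * w (t * x) z)
  (fun z t => t ^ m * wy (t * x) z) (fun z t => box r (t * x) z)).
- apply (open2_preimage_box r (fun _ t => t * x) (fun z _ => z)); auto.
  intros; apply continuity_2d_pt_id1.
- intros z t Htz; apply (is_derive_scal (fun z => w (t * x) z)), Hy, Htz.
- intros z t Htz; apply continuity_2d_pt_mult.
  + apply continuity_2d_pt_pow, continuity_2d_pt_id2.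
  + apply (continuity_2d_pt_comp wy (fun _ t => t * x) (fun z _ => z)); auto.
    apply continuity_2d_pt_id1.
- generalize Hl; apply filter_imp; intros z Hz.
  apply (ex_RInt_moment m w r x z); auto.
- generalize Hl; apply filter_imp; intros z Hz t Ht; apply box_scale; auto.
Qed.

Lemma Cn_moment n m w r :
  Cn n (box r) w -> Cn n (box r) (moment m w).
Proof.
revert m w; induction n as [|n IH]; intros m w [Cw H]; split;
  try (intros x y Hxy; apply moment_continuity with r; auto); auto.
destruct H as [wx [wy [Hx [Hy [Cx Cy]]]]].
exists (moment (S m) wx), (moment m wy); split; [|split]; [| |split; apply IH; auto].
- intros x y Hxy; apply is_derive_moment_x with r; auto.
  intros u v Huv; apply (Cn_continuity _ _ _ _ _ Cx Huv).
- intros x y Hxy; apply is_derive_moment_y with r; auto.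
  intros u v Huv; apply (Cn_continuity _ _ _ _ _ Cy Huv).
Qed.

(** The substitution t -> t z turns the product into the integral of [w] from 0 to z. *)
Lemma is_derive_mult_moment w r x y :
  (forall x y, box r x y -> continuity_2d_pt w x y) -> box r x y ->
  is_derive (fun z => z * moment 0 w z y) x (w x y).
Proof.
intros Cw Hxy.
assert (CI : forall z, Rabs z < r -> continuous (fun t => w t y) z).
{ intros z Hz; apply continuity_2d_slice_x, Cw; split; auto; apply Hxy. }
assert (EI : forall z, Rabs z < r -> ex_RInt (fun t => w t y) 0 z).
{ intros z Hz; apply: ex_RInt_continuous; intros t Ht; apply CI.
  revert Ht Hz; unfold Rmin, Rmax; destruct Rle_dec; split_Rabs; lra. }
apply is_derive_ext_loc with (fun z => RInt (fun t => w t y) 0 z).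
- apply filter_imp with (2 := open2_slice_x _ _ _ (open2_box r) Hxy).
  cut (forall z : R, box r z y ->
    RInt (fun t => w t y) 0 z = z * moment 0 w z y); [auto|].
  intros z Hz; unfold moment.
  rewrite <- (RInt_scal (V := R_CompleteNormedModule));
    [|apply (ex_RInt_moment 0 w r z y); auto].
  assert (L := RInt_comp_lin (fun t => w t y) z 0 0 1).
  replace (z * 0 + 0) with 0 in L by ring.
  replace (z * 1 + 0) with z in L by ring.
  rewrite <- L; [|apply EI; apply Hz].
  apply RInt_ext; intros t _; unfold scal; simpl; unfold mult; simpl.
  rewrite Rplus_0_r Rmult_1_l (Rmult_comm z t); reflexivity.
- apply (is_derive_RInt (fun t => w t y) _ 0 x).
  + apply filter_imp with (2 := open2_slice_x _ _ _ (open2_box r) Hxy).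
    intros z Hz; apply (RInt_correct (V := R_CompleteNormedModule)), EI, Hz.
  + apply CI, Hxy.
Qed.

Lemma primitive_smooth w :
  smooth_germ2 w -> exists q, smooth_germ2 q /\
    near (fun x y => is_derive (fun z => z * q z y) x (w x y)).
Proof.
intros Hw; apply smooth_germ2_Cn in Hw; destruct Hw as [r [Hr C]].
exists (moment 0 w); split.
- apply smooth_germ2_Cn; exists r; split; auto; intros n; apply Cn_moment; auto.
- apply near_box; exists r; split; auto; intros x y Hxy.
  apply is_derive_mult_moment with r; auto.
  intros u v Huv; apply (Cn_continuity 0 _ _ _ _ (C 0%nat) Huv).
Qed.

(** Needed for the coefficients in Borel's lemma, each of which corrects the contributions of all
    earlier ones. *)
Lemma course_of_values (Phi : nat -> (nat -> R) -> R) :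
  (forall n a b, (forall m, (m < n)%nat -> a m = b m) -> Phi n a = Phi n b) ->
  exists a, forall n, a n = Phi n a.
Proof.
intros HPhi.
(* [p n] is a table whose entries below [n] are final. *)
set (p := fix p (n : nat) : nat -> R := match n with
  | O => fun _ => 0
  | S n' => fun m => if Nat.eqb m n' then Phi n' (p n') else p n' m end).
assert (Hp : forall n m, (m < n)%nat -> p n m = p (S m) m).
{ induction n as [|n IH]; intros m Hm; [lia|].
  destruct (Nat.eq_dec m n) as [->|Hn]; [reflexivity|].
  simpl p at 1; rewrite (proj2 (Nat.eqb_neq m n) Hn); apply IH; lia. }
exists (fun n => p (S n) n); intros n; simpl p at 1.
rewrite Nat.eqb_refl; apply HPhi; intros m Hm; apply Hp, Hm.
Qed.

Lemma eq_of_is_derive (f g h : R -> R) r x :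
  (forall x, Rabs x < r -> is_derive f x (h x)) ->
  (forall x, Rabs x < r -> is_derive g x (h x)) ->
  f 0 = g 0 -> Rabs x < r -> f x = g x.
Proof.
intros Hf Hg H0 Hx.
destruct (MVT_ball (fun x => f x - g x) (fun x => h x - h x) r 0 x)
  as [c [_ [_ E]]]; auto.
- intros u Hu; apply: is_derive_minus; auto.
- rewrite Rabs_R0; eapply Rle_lt_trans; [apply Rabs_pos|exact Hx].
- lra.
Qed.

(** * Borel's lemma *)

Fixpoint cos_prim (N : R) (m : nat) (s : R) : R :=
  match m with
  | O => cos (N * s)
  | S m => RInt (cos_prim N m) 0 s
  end.

Lemma is_derive_cos_prim N m s :
  is_derive (cos_prim N (S m)) s (cos_prim N m s).
Proof.
revert s; induction m as [|m IH]; intros s.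
- apply (is_derive_RInt (cos_prim N 0) _ 0 s).
  + apply filter_forall; intros z.
    apply (RInt_correct (V := R_CompleteNormedModule)), ex_RInt_continuous.
    intros t _; apply (ex_derive_continuous (cos_prim N 0)).
    unfold cos_prim; auto_derive; auto.
  + apply (ex_derive_continuous (cos_prim N 0)).
    unfold cos_prim; auto_derive; auto.
- apply (is_derive_RInt (cos_prim N (S m)) _ 0 s).
  + apply filter_forall; intros z.
    apply (RInt_correct (V := R_CompleteNormedModule)), ex_RInt_continuous.
    intros t _; apply (ex_derive_continuous (cos_prim N (S m))).
    eexists; apply IH.
  + apply (ex_derive_continuous (cos_prim N (S m))); eexists; apply IH.
Qed.

Lemma cos_prim_S_0 N m : cos_prim N (S m) 0 = 0.
Proof. apply (RInt_point (V := R_CompleteNormedModule)). Qed.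

(** The first primitive is sin(N s) / N, and integrating from 0 over a length below 1 does not
    increase a bound. *)
Lemma Rabs_cos_prim N m s :
  0 < N -> Rabs s < 1 -> Rabs (cos_prim N (S m) s) <= / N.
Proof.
intros HN; revert s; induction m as [|m IH]; intros s Hs.
- assert (E : cos_prim N 1 s = sin (N * s) * / N).
  { apply (eq_of_is_derive _ (fun s => sin (N * s) * / N) (cos_prim N 0) 1); auto.
    - intros x _; apply is_derive_cos_prim.
    - intros x _; unfold cos_prim; auto_derive; auto; field; lra.
    - rewrite cos_prim_S_0 Rmult_0_r sin_0; ring. }
  rewrite E Rabs_mult (Rabs_pos_eq (/ N)); [|left; apply Rinv_0_lt_compat; auto].
  assert (Rabs (sin (N * s)) <= 1)
    by (apply Rabs_le; destruct (SIN_bound (N * s)); lra).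
  assert (0 < / N) by (apply Rinv_0_lt_compat; auto); nra.
- destruct (MVT_ball (cos_prim N (S (S m))) (cos_prim N (S m)) 1 0 s)
    as [c [Hc [Hc' E]]]; auto.
  + intros x _; apply is_derive_cos_prim.
  + rewrite Rabs_R0; lra.
  + rewrite cos_prim_S_0 Rminus_0_r Rminus_0_r in E.
    rewrite E Rabs_mult; assert (X := IH c Hc').
    pose proof (Rabs_pos (cos_prim N (S m) c)).
    pose proof (Rabs_pos s); nra.
Qed.

(* The k-th derivative of the n-fold primitive (from 0) of cos (N s). *)
Definition borel_term (N : R) (n k : nat) (s : R) : R :=
  if Nat.leb k n then cos_prim N (n - k) s
  else N ^ (k - n) * cos (N * s + INR (k - n) * (PI / 2)).

(** Up to order n a derivative removes one primitive; beyond, it multiplies by N and advances the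
    phase by pi / 2. The two regimes meet at k = n, where both read cos(N s). *)
Lemma is_derive_borel_term N n k s :
  is_derive (borel_term N n k) s (borel_term N n (S k) s).
Proof.
assert (Hhigh : forall j s, is_derive
  (fun s => N ^ j * cos (N * s + INR j * (PI / 2))) s
  (N ^ S j * cos (N * s + INR (S j) * (PI / 2)))).
{ intros j z; rewrite S_INR.
  replace (N * z + (INR j + 1) * (PI / 2))
    with (PI / 2 + (N * z + INR j * (PI / 2))) by ring.
  rewrite cos_plus cos_PI2 sin_PI2; auto_derive; auto; simpl; ring. }
destruct (Nat.lt_trichotomy k n) as [H|[H|H]].
- apply is_derive_ext with (cos_prim N (S (n - S k))).
  + intros t; unfold borel_term; rewrite (proj2 (Nat.leb_le k n)); [|lia].
    replace (n - k)%nat with (S (n - S k)) by lia; reflexivity.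
  + unfold borel_term; rewrite (proj2 (Nat.leb_le (S k) n)); [|lia].
    apply is_derive_cos_prim.
- subst k; apply is_derive_ext
    with (fun s => N ^ 0 * cos (N * s + INR 0 * (PI / 2))).
  + intros t; unfold borel_term; rewrite Nat.leb_refl Nat.sub_diag; simpl.
    rewrite Rmult_0_l Rplus_0_r; ring.
  + unfold borel_term; rewrite (proj2 (Nat.leb_gt (S n) n)); [|lia].
    replace (S n - n)%nat with 1%nat by lia; apply Hhigh.
- apply is_derive_ext
    with (fun s => N ^ (k - n) * cos (N * s + INR (k - n) * (PI / 2))).
  + intros t; unfold borel_term; rewrite (proj2 (Nat.leb_gt k n)); [|lia].
    reflexivity.
  + unfold borel_term; rewrite (proj2 (Nat.leb_gt (S k) n)); [|lia].
    replace (S k - n)%nat with (S (k - n)) by lia; apply Hhigh.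
Qed.

Lemma Rabs_borel_term_lt N n k s :
  0 < N -> (k < n)%nat -> Rabs s < 1 -> Rabs (borel_term N n k s) <= / N.
Proof.
intros HN Hk Hs; unfold borel_term; rewrite (proj2 (Nat.leb_le k n)); [|lia].
replace (n - k)%nat with (S (n - S k)) by lia; apply Rabs_cos_prim; auto.
Qed.

Lemma Rabs_borel_term N n k s :
  1 <= N -> Rabs s < 1 -> Rabs (borel_term N n k s) <= N ^ k.
Proof.
intros HN Hs.
assert (HNk : 1 <= N ^ k) by (apply pow_R1_Rle; auto).
destruct (Nat.lt_ge_cases k n) as [Hk|Hk].
- eapply Rle_trans; [apply Rabs_borel_term_lt; auto; lra|].
  apply Rle_trans with (/ 1); [apply Rinv_le_contravar; lra|lra].
- unfold borel_term; destruct (Nat.leb_spec k n).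
  + replace (n - k)%nat with 0%nat by lia; simpl.
    apply Rle_trans with 1; auto; apply Rabs_le.
    destruct (COS_bound (N * s)); lra.
  + rewrite Rabs_mult (Rabs_pos_eq (N ^ (k - n))); [|apply pow_le; lra].
    apply Rle_trans with (N ^ (k - n) * 1).
    * apply Rmult_le_compat_l; [apply pow_le; lra|].
      apply Rabs_le; split; apply COS_bound.
    * rewrite Rmult_1_r; apply Rle_pow; [auto|lia].
Qed.

(** The remainder is linear in the bound [B] on the second derivative, so such estimates can be
    added over the terms of a series. *)
Lemma Rabs_second_order (g g1 g2 : R -> R) B s h :
  (forall x, Rabs x < 1 -> is_derive g x (g1 x)) ->
  (forall x, Rabs x < 1 -> is_derive g1 x (g2 x)) ->
  (forall x, Rabs x < 1 -> Rabs (g2 x) <= B) ->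
  Rabs s < 1 -> Rabs (s + h) < 1 ->
  Rabs (g (s + h) - g s - h * g1 s) <= h ^ 2 * B.
Proof.
intros H1 H2 HB Hs Hh.
destruct (MVT_ball g g1 1 s (s + h)) as [c [Hc [Hc' E]]]; auto.
destruct (MVT_ball g1 g2 1 s c) as [d [Hd [Hd' E']]]; auto.
replace (g (s + h) - g s - h * g1 s) with (h * (g2 d * (c - s)))
  by (rewrite <- E', E; ring).
assert (Hcs : Rabs (c - s) <= Rabs h).
{ revert Hc; unfold Rmin, Rmax; destruct Rle_dec; split_Rabs; lra. }
rewrite !Rabs_mult -(pow2_abs h).
assert (X := HB d Hd'); pose proof (Rabs_pos (g2 d)).
pose proof (Rabs_pos (c - s)); pose proof (Rabs_pos h).
replace (Rabs h ^ 2 * B) with (Rabs h * (B * Rabs h)) by ring.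
apply Rmult_le_compat_l; auto; apply Rmult_le_compat; auto.
Qed.

Lemma is_derive_quadratic (f : R -> R) x l C r :
  0 < r -> (forall h, Rabs h < r -> Rabs (f (x + h) - f x - h * l) <= h ^ 2 * C) ->
  is_derive f x l.
Proof.
intros Hr H; apply is_derive_Reals; intros eps He.
assert (Hd : 0 < Rmin r (eps / (1 + Rabs C))).
{ apply Rmin_pos; auto; apply Rdiv_lt_0_compat; auto.
  pose proof (Rabs_pos C); lra. }
exists (mkposreal _ Hd); simpl; intros h Hh0 Hh.
destruct (Rlt_Rmin _ _ _ Hh) as [Hh1 Hh2].
replace ((f (x + h) - f x) / h - l) with ((f (x + h) - f x - h * l) * / h)
  by (field; auto).
rewrite Rabs_mult Rabs_inv.
assert (Hp : 0 < Rabs h) by (apply Rabs_pos_lt; auto).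
apply Rmult_lt_reg_r with (Rabs h); auto.
rewrite Rmult_assoc Rinv_l; [|lra]; rewrite Rmult_1_r.
eapply Rle_lt_trans; [apply H; auto|].
rewrite -(pow2_abs h).
replace (Rabs h ^ 2 * C) with (Rabs h * C * Rabs h) by ring.
apply Rmult_lt_compat_r; auto.
pose proof (Rle_abs C); pose proof (Rabs_pos C).
assert (E : eps / (1 + Rabs C) * (1 + Rabs C) = eps) by (field; lra).
nra.
Qed.

Lemma ex_series_geom_half : ex_series (fun n => (/ 2) ^ n).
Proof. apply ex_series_geom; rewrite Rabs_pos_eq; lra. Qed.

(** At 0 the n-th term has vanishing derivatives of order below n and n-th derivative a_n, so the
    prescribed values form a triangular system for the a_n. High frequencies make the term and its
    derivatives of order below n small on all of |s| < 1, so every differentiated series converges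
    there. *)
Lemma borel (c : nat -> R) : exists b : R -> R,
  (forall s, Rabs s < 1 -> forall n, ex_derive_n b n s) /\
  forall n, Derive_n b n 0 = c n.
Proof.
(* The frequency is large enough for |a| / N <= 2^-n, and it depends on the n-th coefficient
   alone. *)
set (N := fun (n : nat) (a : R) => 2 ^ n * (1 + Rabs a)).
destruct (course_of_values (fun k a => c k - match k with
  | O => 0
  | S p => sum_f_R0 (fun m => a m * borel_term (N m (a m)) m k 0) p end))
  as [a Ha].
{ intros [|n] u v Huv; auto; f_equal; apply sum_eq; intros i Hi.
  rewrite Huv; auto; lia. }
set (M := fun n => N n (a n)).
assert (HM1 : forall n, 1 <= M n).
{ intros n; unfold M, N; assert (1 <= 2 ^ n) by (apply pow_R1_Rle; lra).
  pose proof (Rabs_pos (a n)); nra. }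
set (T := fun k n s => a n * borel_term (M n) n k s).
assert (HT : forall k n s, is_derive (T k n) s (T (S k) n s)).
{ intros k n s; apply (is_derive_scal (borel_term (M n) n k)).
  apply is_derive_borel_term. }
(* Majorant of the k-th derivatives: finitely many terms n <= k get a crude bound, the others decay
   like 2^-n. *)
set (B := fun k n : nat => if Nat.leb n k then Rabs (a n) * M n ^ k
                           else (/ 2) ^ n).
assert (HB : forall k n s, Rabs s < 1 -> Rabs (T k n s) <= B k n).
{ intros k n s Hs; unfold T, B; rewrite Rabs_mult.
  destruct (Nat.leb_spec n k).
  - apply Rmult_le_compat_l; [apply Rabs_pos|]; apply Rabs_borel_term; auto.
  - apply Rle_trans with (Rabs (a n) * / M n).
    + apply Rmult_le_compat_l; [apply Rabs_pos|]; apply Rabs_borel_term_lt; auto.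
      specialize (HM1 n); lra.
    + unfold M, N; assert (0 < 2 ^ n) by (apply pow_lt; lra).
      pose proof (Rabs_pos (a n)); rewrite pow_inv.
      apply Rmult_le_reg_r with (2 ^ n * (1 + Rabs (a n))); [nra|].
      rewrite Rmult_assoc Rinv_l; [|nra].
      replace (/ 2 ^ n * (2 ^ n * (1 + Rabs (a n)))) with (1 + Rabs (a n))
        by (field; lra).
      lra. }
assert (SB : forall k, ex_series (B k)).
{ intros k; apply (ex_series_incr_n (B k) (S k)).
  apply ex_series_ext with (fun n => (/ 2) ^ (S k + n)).
  - intros n; unfold B; rewrite (proj2 (Nat.leb_gt (S k + n) k)); auto; lia.
  - apply (ex_series_incr_n (fun n => (/ 2) ^ n) (S k)), ex_series_geom_half. }
assert (ST : forall k s, Rabs s < 1 -> ex_series (fun n => Rabs (T k n s))).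
{ intros k s Hs; apply: (ex_series_le _ (B k)); auto.
  intros n; unfold norm; simpl; unfold abs; simpl; rewrite Rabs_Rabsolu; auto. }
assert (ST' : forall k s, Rabs s < 1 -> ex_series (fun n => T k n s)).
{ intros; apply ex_series_Rabs; auto. }
set (f := fun k s => Series (fun n => T k n s)).
(* Summing the second order bounds of the terms gives a quadratic remainder for the sum, which is
   differentiation under the sum. *)
assert (Hf : forall k s, Rabs s < 1 -> is_derive (f k) s (f (S k) s)).
{ intros k s Hs; apply is_derive_quadratic
    with (C := Series (B (S (S k)))) (r := 1 - Rabs s); [lra|].
  intros h Hh.
  assert (Hsh : Rabs (s + h) < 1) by (revert Hh Hs; split_Rabs; lra).
  unfold f; rewrite <- Series_scal_l.
  rewrite <- Series_minus; auto.
  rewrite <- Series_minus; auto.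
  - assert (Hle : forall n, 0 <= Rabs (T k n (s + h) - T k n s - h * T (S k) n s)
      <= h ^ 2 * B (S (S k)) n).
    { intros n; split; [apply Rabs_pos|].
      apply (Rabs_second_order (T k n) (T (S k) n) (T (S (S k)) n)); auto. }
    assert (SBh : ex_series (fun n => h ^ 2 * B (S (S k)) n))
      by (apply (ex_series_scal_l (h ^ 2) (B (S (S k)))); auto).
    eapply Rle_trans; [apply Series_Rabs|].
    + apply: (ex_series_le _ (fun n => h ^ 2 * B (S (S k)) n)); auto.
      intros n; unfold norm; simpl; unfold abs; simpl; rewrite Rabs_Rabsolu.
      apply Hle.
    + rewrite <- Series_scal_l; apply Series_le; auto.
  - apply: ex_series_minus; auto.
  - apply: (ex_series_scal_l h); auto. }
assert (Hn : forall n s, Rabs s < 1 -> Derive_n (f 0%nat) n s = f n s).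
{ induction n as [|n IH]; intros s Hs; [reflexivity|]; simpl.
  apply is_derive_unique; apply is_derive_ext_loc with (f n); auto.
  apply locally_Rabs with 1; auto; intros t Ht; symmetry; auto. }
exists (f 0%nat); split.
- intros s Hs [|n]; simpl; auto.
  apply ex_derive_ext_loc with (f n); [|eexists; apply Hf; auto].
  apply locally_Rabs with 1; auto; intros t Ht; symmetry; auto.
- intros n; assert (H0 : Rabs 0 < 1) by (rewrite Rabs_R0; lra).
  rewrite Hn; auto; unfold f.
  (* After n derivatives the terms of index above n are still primitives from 0 and vanish there;
     the n-th gives a_n, and the recursion has subtracted the earlier ones. *)
  rewrite (Series_incr_n (fun m => T n m 0) (S n)); [|lia|auto].
  rewrite (Series_ext _ (fun m => 0 * T n m 0)).
  + rewrite Series_scal_l Rmult_0_l Rplus_0_r; simpl pred.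
    assert (En : T n n 0 = a n).
    { unfold T, borel_term; rewrite Nat.leb_refl Nat.sub_diag; simpl.
      rewrite Rmult_0_r cos_0; ring. }
    destruct n as [|n]; simpl sum_f_R0; rewrite En Ha; [ring|].
    unfold T, M; ring.
  + intros m; unfold T, borel_term; rewrite (proj2 (Nat.leb_le n (S n + m))); [|lia].
    replace (S n + m - n)%nat with (S m) by lia; rewrite cos_prim_S_0; ring.
Qed.

(** * Even smooth functions *)

Lemma Derive_n_Derive (g : R -> R) n x :
  Derive_n (Derive g) n x = Derive_n g (S n) x.
Proof.
change (Derive g) with (Derive_n g 1); rewrite Derive_n_comp.
now replace (n + 1)%nat with (S n) by lia.
Qed.

Lemma ex_derive_n_S (g : R -> R) n x :
  ex_derive g x -> ex_derive_n (Derive g) n x -> ex_derive_n g (S n) x.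
Proof.
intros H0 H; destruct n as [|n]; simpl; auto.
apply ex_derive_ext with (Derive_n (Derive g) n); auto.
intros t; apply Derive_n_Derive.
Qed.

Lemma ex_derive_n_Derive (g : R -> R) n x :
  ex_derive_n g (S n) x -> ex_derive_n (Derive g) n x.
Proof.
destruct n as [|n]; simpl; auto.
apply ex_derive_ext; intros t; symmetry; apply Derive_n_Derive.
Qed.

Definition smooth1 (r : R) (g : R -> R) : Prop :=
  forall y, Rabs y < r -> forall n, ex_derive_n g n y.

Lemma smooth1_Derive r g : smooth1 r g -> smooth1 r (Derive g).
Proof. intros H y Hy n; apply ex_derive_n_Derive, H, Hy. Qed.

Lemma smooth1_is_derive r g y :
  smooth1 r g -> Rabs y < r -> is_derive g y (Derive g y).
Proof. intros H Hy; apply Derive_correct, (H y Hy 1%nat). Qed.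

(** Lets the two-variable calculus, moments in particular, serve functions of one variable. *)
Lemma smooth1_Cn r g :
  smooth1 r g <-> forall n, Cn n (box r) (fun x _ => g x).
Proof.
split.
- intros H.
  cut (forall n k, Cn n (box r) (fun x _ => Derive_n g k x)).
  { intros K n; apply (K n 0%nat). }
  assert (Hd : forall k x, Rabs x < r ->
    is_derive (Derive_n g k) x (Derive_n g (S k) x)).
  { intros k x Hx; apply Derive_correct, (H x Hx (S k)). }
  assert (Hc : forall k x y, box r x y ->
    continuity_2d_pt (fun x _ => Derive_n g k x) x y).
  { intros k x y [Hx _].
    apply (continuity_1d_2d_pt_comp (Derive_n g k) (fun x _ => x)).
    - eapply is_derive_continuity_pt, Hd, Hx.
    - apply continuity_2d_pt_id1. }
  induction n as [|n IH]; intros k; split; auto.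
  exists (fun x _ => Derive_n g (S k) x), (fun _ _ => 0).
  split; [|split]; [| |split; auto; apply Cn_const].
  + intros x y [Hx _]; apply Hd, Hx.
  + intros; apply: is_derive_const.
- intros H y Hy n; specialize (H n).
  revert g H y Hy; induction n as [|n IH]; intros g H y Hy; simpl; auto.
  destruct H as [_ [fx [fy [Hx [_ [Cx _]]]]]].
  assert (H0 : Rabs 0 < r)
    by (rewrite Rabs_R0; eapply Rle_lt_trans; [apply Rabs_pos|exact Hy]).
  apply ex_derive_n_S.
  + exists (fx y 0); apply (Hx y 0); split; auto.
  + apply IH; auto; apply Cn_ext with fx; auto; [apply open2_box|].
    intros u v Huv; symmetry; apply is_derive_unique, (Hx u v), Huv.
Qed.

(* De(u) = e'(u) / (2 u), extended smoothly through u = 0; it corresponds to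
   d/ds under s = u^2. *)
Definition half_quot (e : R -> R) (u : R) : R :=
  / 2 * moment 0 (fun x _ => Derive (Derive e) x) u 0.

Definition even_on (r : R) (e : R -> R) : Prop :=
  forall u, Rabs u < r -> e (- u) = e u.

(** The sign c = 1 covers even functions and c = -1 odd ones. *)
Lemma Derive_parity (r : R) (e : R -> R) (c u : R) :
  (forall u, Rabs u < r -> ex_derive e u) ->
  (forall u, Rabs u < r -> e (- u) = c * e u) -> Rabs u < r ->
  Derive e (- u) = - (c * Derive e u).
Proof.
intros He Hc Hu.
assert (H1 : is_derive (fun u => e (- u)) u (- Derive e (- u))).
{ replace (- Derive e (- u)) with (scal (-1) (Derive e (- u)))
    by (unfold scal; simpl; unfold mult; simpl; ring).
  apply (is_derive_comp e (fun u => - u)).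
  - apply Derive_correct, He; rewrite Rabs_Ropp; auto.
  - auto_derive; auto. }
assert (H2 : is_derive (fun u => e (- u)) u (c * Derive e u)).
{ apply is_derive_ext_loc with (fun u => c * e u).
  - apply locally_Rabs with r; auto; intros t Ht; symmetry; auto.
  - apply (is_derive_scal e), Derive_correct, He, Hu. }
apply is_derive_unique in H1; apply is_derive_unique in H2; lra.
Qed.

(** Parity gives e'(0) = 0, so e'(u) is u times the mean of e'' between 0 and u. *)
Lemma is_derive_half_quot r e u :
  0 < r -> smooth1 r e -> even_on r e -> Rabs u < r ->
  Derive e u = 2 * u * half_quot e u.
Proof.
intros Hr He Hev Hu.
assert (H0 : Rabs 0 < r) by (rewrite Rabs_R0; auto).
assert (He1 := smooth1_Derive _ _ He); assert (He2 := smooth1_Derive _ _ He1).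
transitivity (u * moment 0 (fun x _ => Derive (Derive e) x) u 0);
  [|unfold half_quot; field].
apply (eq_of_is_derive _
  (fun u => u * moment 0 (fun x _ => Derive (Derive e) x) u 0)
  (Derive (Derive e)) r); auto.
- intros x Hx; apply smooth1_is_derive with r; auto.
- intros x Hx; apply (is_derive_mult_moment (fun x _ => Derive (Derive e) x) r).
  + intros a b Hab; apply (Cn_continuity 0 (box r)); auto.
    apply (proj1 (smooth1_Cn r _)); auto.
  + split; auto.
- rewrite Rmult_0_l.
  assert (X := Derive_parity r e 1 0 (fun u Hu => He u Hu 1%nat)).
  rewrite Ropp_0 in X; specialize (X ltac:(intros v Hv; rewrite Rmult_1_l; auto) H0).
  lra.
Qed.

Lemma smooth1_scal r c g : smooth1 r g -> smooth1 r (fun x => c * g x).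
Proof. intros H y Hy n; apply ex_derive_n_scal_l, H, Hy. Qed.

Lemma smooth1_moment r g :
  smooth1 r g -> smooth1 r (fun u => moment 0 (fun x _ => g x) u 0).
Proof.
intros H; apply smooth1_Cn; intros n.
apply (Cn_moment n 0 (fun x _ => g x) r), smooth1_Cn, H.
Qed.

Lemma smooth1_half_quot r e : smooth1 r e -> smooth1 r (half_quot e).
Proof.
intros H; apply smooth1_scal, smooth1_moment; do 2 apply smooth1_Derive; auto.
Qed.

Lemma even_moment r g :
  even_on r g -> even_on r (fun u => moment 0 (fun x _ => g x) u 0).
Proof.
intros H u Hu; unfold moment; apply RInt_ext; intros t.
rewrite Rmin_left; [|lra]; rewrite Rmax_right; [|lra]; intros Ht.
rewrite Ropp_mult_distr_r_reverse H; auto.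
eapply Rle_lt_trans; [apply Rabs_mult_le_unit; lra|exact Hu].
Qed.

Lemma even_half_quot r e :
  smooth1 r e -> even_on r e -> even_on r (half_quot e).
Proof.
intros He Hev u Hu; unfold half_quot; f_equal.
apply (even_moment r (Derive (Derive e))); auto.
intros v Hv.
rewrite (Derive_parity r (Derive e) (-1) v); auto; [ring| |].
- intros w Hw; apply (smooth1_Derive _ _ He w Hw 1%nat).
- intros w Hw; rewrite (Derive_parity r e 1 w); auto; [ring| |].
  + intros z Hz; apply (He z Hz 1%nat).
  + intros z Hz; rewrite Hev; auto; ring.
Qed.

(** For s >= 0 the value is forced by e(u) = A(u^2); for s < 0 the function [b] is free, apart from
    the derivatives at 0 that it must match. *)
Definition glue_sqrt (e b : R -> R) (s : R) : R :=
  match Rle_dec 0 s with left _ => e (sqrt s) | right _ => b s end.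

(** For s > 0 the derivative of e(sqrt s) is e'(sqrt s) / (2 sqrt s), that is [half_quot e] at sqrt
    s; hence the derivative is again a glued function. *)
Lemma is_derive_glue_sqrt_neq r p e b s :
  0 < r -> p <= r ^ 2 -> smooth1 r e -> even_on r e -> smooth1 p b ->
  Rabs s < p -> s <> 0 ->
  is_derive (glue_sqrt e b) s (glue_sqrt (half_quot e) (Derive b) s).
Proof.
intros Hr Hp He Hev Hb Hs H0.
assert (Hs0 : 0 < Rabs s) by (apply Rabs_pos_lt; auto).
destruct (Rtotal_order s 0) as [Hn|[Hn|Hn]]; [|lra|].
- unfold glue_sqrt at 2; destruct (Rle_dec 0 s); [lra|].
  apply is_derive_ext_loc with b; [|apply smooth1_is_derive with p; auto].
  exists (mkposreal _ Hs0); intros t Ht; change (Rabs (t - s) < Rabs s) in Ht.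
  unfold glue_sqrt; destruct (Rle_dec 0 t); auto.
  exfalso; revert Ht; split_Rabs; lra.
- unfold glue_sqrt at 2; destruct (Rle_dec 0 s); [|lra].
  apply is_derive_ext_loc with (fun t => e (sqrt t)).
  { exists (mkposreal _ Hs0); intros t Ht; change (Rabs (t - s) < Rabs s) in Ht.
    unfold glue_sqrt; destruct (Rle_dec 0 t); auto.
    exfalso; revert Ht; split_Rabs; lra. }
  assert (Hq : 0 < sqrt s) by (apply sqrt_lt_R0; auto).
  assert (Hqr : Rabs (sqrt s) < r).
  { rewrite Rabs_pos_eq; [|lra].
    rewrite <- (sqrt_pow2 r); [|lra]; apply sqrt_lt_1; try nra.
    revert Hs; split_Rabs; nra. }
  replace (half_quot e (sqrt s)) with (scal (/ (2 * sqrt s)) (Derive e (sqrt s))).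
  + apply (is_derive_comp e sqrt).
    * apply smooth1_is_derive with r; auto.
    * auto_derive; auto; field; lra.
  + rewrite (is_derive_half_quot r e); auto.
    unfold scal; simpl; unfold mult; simpl; field; lra.
Qed.

Lemma glue_sqrt_continuity_0 r p e b :
  0 < r -> 0 < p -> smooth1 r e -> smooth1 p b -> e 0 = b 0 ->
  continuity_pt (glue_sqrt e b) 0.
Proof.
intros Hr Hp He Hb E.
assert (Cb : continuity_pt b 0).
{ eapply is_derive_continuity_pt, smooth1_is_derive; eauto.
  rewrite Rabs_R0; auto. }
assert (Ce : continuity_pt (fun s => e (sqrt s)) 0).
{ apply (continuity_pt_comp sqrt e).
  - apply continuity_pt_sqrt; lra.
  - eapply is_derive_continuity_pt, smooth1_is_derive; eauto.
    rewrite sqrt_0 Rabs_R0; auto. }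
apply continuity_pt_locally; intros eps.
rewrite -> continuity_pt_locally in Cb, Ce.
specialize (Cb eps); specialize (Ce eps).
generalize (filter_and _ _ Cb Ce); apply filter_imp; intros t [H1 H2].
unfold glue_sqrt; destruct (Rle_dec 0 0); [|lra].
destruct (Rle_dec 0 t); auto.
rewrite sqrt_0 E; auto.
Qed.

(** The mean value theorem turns the difference quotient at 0 into a value of [g] at an intermediate
    point, which tends to g(0). *)
Lemma is_derive_removable (f g : R -> R) r :
  0 < r -> (forall s, Rabs s < r -> s <> 0 -> is_derive f s (g s)) ->
  continuity_pt f 0 -> continuity_pt g 0 -> is_derive f 0 (g 0).
Proof.
intros Hr Hd Cf Cg; apply is_derive_Reals; intros eps Heps.
rewrite -> continuity_pt_locally in Cg.
destruct (Cg (mkposreal _ Heps)) as [d Hdd].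
assert (Hm : 0 < Rmin d r) by (apply Rmin_pos; auto; apply cond_pos).
exists (mkposreal _ Hm); simpl; intros h Hh0 Hh.
destruct (Rlt_Rmin _ _ _ Hh) as [Hh1 Hh2].
assert (Hb : forall x, Rmin 0 h <= x <= Rmax 0 h -> Rabs x <= Rabs h).
{ intros x; unfold Rmin, Rmax; destruct Rle_dec; split_Rabs; lra. }
destruct (MVT_gen f 0 h g) as [c [Hc E]].
- intros x Hx; apply Hd.
  + eapply Rle_lt_trans; [apply Hb; lra|auto].
  + revert Hx; unfold Rmin, Rmax; destruct Rle_dec; lra.
- intros x Hx; destruct (Req_dec x 0) as [->|Hx0]; auto.
  eapply is_derive_continuity_pt, Hd; auto.
  eapply Rle_lt_trans; [apply Hb; lra|auto].
- rewrite Rplus_0_l E Rminus_0_r.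
  replace (g c * h / h - g 0) with (g c - g 0) by (field; auto).
  apply Hdd; change (Rabs (c - 0) < d); rewrite Rminus_0_r.
  eapply Rle_lt_trans; [apply Hb; auto|auto].
Qed.

Lemma is_derive_glue_sqrt r p e b s :
  0 < r -> p <= r ^ 2 -> smooth1 r e -> even_on r e -> smooth1 p b ->
  e 0 = b 0 -> half_quot e 0 = Derive b 0 -> Rabs s < p ->
  is_derive (glue_sqrt e b) s (glue_sqrt (half_quot e) (Derive b) s).
Proof.
intros Hr Hp He Hev Hb E0 E1 Hs.
assert (Hp0 : 0 < p) by (eapply Rle_lt_trans; [apply Rabs_pos|exact Hs]).
destruct (Req_dec s 0) as [->|H0].
- apply (is_derive_removable _ _ p); auto.
  + intros t Ht Ht0; apply is_derive_glue_sqrt_neq with r p; auto.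
  + apply glue_sqrt_continuity_0 with r p; auto.
  + apply glue_sqrt_continuity_0 with r p; auto.
    * apply smooth1_half_quot; auto.
    * apply smooth1_Derive; auto.
- apply is_derive_glue_sqrt_neq with r p; auto.
Qed.

(** The derivative glues [half_quot e] to [Derive b], and the matching condition of this pair is the
    old one shifted by one index; hence an induction on the order over all pairs. *)
Lemma smooth1_glue_sqrt r p e b :
  0 < r -> p <= r ^ 2 -> smooth1 r e -> even_on r e -> smooth1 p b ->
  (forall k, Nat.iter k half_quot e 0 = Derive_n b k 0) ->
  smooth1 p (glue_sqrt e b).
Proof.
intros Hr Hp He Hev Hb E s Hs n.
revert e b He Hev Hb E s Hs; induction n as [|n IH]; intros e b He Hev Hb E s Hs;
  [exact I|].
assert (Hd : forall t, Rabs t < p ->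
  is_derive (glue_sqrt e b) t (glue_sqrt (half_quot e) (Derive b) t)).
{ intros t Ht; apply is_derive_glue_sqrt with r p; auto.
  - apply (E 0%nat).
  - apply (E 1%nat). }
apply ex_derive_n_S; [eexists; apply Hd; auto|].
apply ex_derive_n_ext_loc with (glue_sqrt (half_quot e) (Derive b)).
- apply locally_Rabs with p; auto; intros t Ht; symmetry.
  apply is_derive_unique; auto.
- apply IH; auto.
  + apply smooth1_half_quot; auto.
  + apply even_half_quot; auto.
  + apply smooth1_Derive; auto.
  + intros k; rewrite Derive_n_Derive -E Nat.iter_succ_r; reflexivity.
Qed.

(** Whitney's theorem on even functions. The iterates of [half_quot] at 0 are the one-sided
    derivatives of e(sqrt s) at s = 0; Borel's lemma continues the function to s < 0 with these
    derivatives. *)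
Lemma even_function_of_square r e :
  0 < r -> smooth1 r e -> even_on r e ->
  exists A, smooth_germ1 A /\ forall u, Rabs u < r -> e u = A (u ^ 2).
Proof.
intros Hr He Hev.
destruct (borel (fun k => Nat.iter k half_quot e 0)) as [b [Hb Eb]].
exists (glue_sqrt e b); split.
(* The Borel function is smooth for |s| < 1, and below r^2 the square root stays in the domain of
   [e]. *)
- set (p := Rmin 1 (r ^ 2)).
  assert (Hp : 0 < p) by (apply Rmin_pos; nra).
  apply locally_Rabs with p; [|rewrite Rabs_R0; auto].
  apply (smooth1_glue_sqrt r p e b); auto.
  + apply Rmin_r.
  + intros s Hs; apply Hb; eapply Rlt_le_trans; [exact Hs|apply Rmin_l].
- intros u Hu; unfold glue_sqrt; destruct (Rle_dec 0 (u ^ 2)); [|nra].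
  replace (u ^ 2) with (Rsqr u) by (unfold Rsqr; ring).
  rewrite sqrt_Rsqr_abs; destruct (Rle_dec 0 u).
  + rewrite Rabs_pos_eq; auto.
  + rewrite Rabs_left; [|lra]; symmetry; apply Hev; auto.
Qed.

Lemma smooth_germ1_smooth1 g :
  smooth_germ1 g <-> exists r, 0 < r /\ smooth1 r g.
Proof.
split.
- intros [d Hd]; exists d; split; [apply cond_pos|].
  intros y Hy; apply Hd; change (Rabs (y - 0) < d); rewrite Rminus_0_r; auto.
- intros [r [Hr H]]; apply locally_Rabs with r; auto; rewrite Rabs_R0; auto.
Qed.

Lemma smooth1_comp_opp r g : smooth1 r g -> smooth1 r (fun x => g (- x)).
Proof.
intros H y Hy n; apply ex_derive_n_comp_opp.
apply locally_Rabs with r; [|rewrite Rabs_Ropp; auto].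
intros t Ht k _; apply H; auto.
Qed.

Lemma smooth1_plus r f g :
  smooth1 r f -> smooth1 r g -> smooth1 r (fun x => f x + g x).
Proof.
rewrite !smooth1_Cn; intros Hf Hg n; apply (Cn_plus n _ _ _ (Hf n) (Hg n)).
Qed.

Lemma even_odd_smooth T :
  smooth_germ1 T -> exists A B, smooth_germ1 A /\ smooth_germ1 B /\
    locally 0 (fun u => T u = A (u ^ 2) + u * B (u ^ 2)).
Proof.
intros HT; apply smooth_germ1_smooth1 in HT; destruct HT as [r [Hr HT]].
set (e := fun u => / 2 * (T u + T (- u))).
set (o := fun u => / 2 * (T u + -1 * T (- u))).
assert (HT' := smooth1_comp_opp _ _ HT).
assert (He : smooth1 r e) by (apply smooth1_scal, smooth1_plus; auto).
assert (Ho : smooth1 r o)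
  by (apply smooth1_scal, smooth1_plus; auto; apply smooth1_scal; auto).
assert (Hev : even_on r e)
  by (intros u _; unfold e; rewrite Ropp_involutive; ring).
assert (Hod : forall u, Rabs u < r -> o (- u) = -1 * o u)
  by (intros u _; unfold o; rewrite Ropp_involutive; field).
assert (Ho1 := smooth1_Derive _ _ Ho).
(* This is o(u) / u, written as a mean of o' so that smoothness at 0 is automatic; it is even
   because o' is. *)
set (q := fun u => moment 0 (fun x _ => Derive o x) u 0).
assert (Hq : smooth1 r q) by exact (smooth1_moment r (Derive o) Ho1).
assert (Hqe : even_on r q).
{ apply (even_moment r (Derive o)); intros u Hu.
  rewrite (Derive_parity r o (-1) u); auto; [ring|].
  intros v Hv; apply (Ho v Hv 1%nat). }
assert (Hoq : forall u, Rabs u < r -> o u = u * q u).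
{ intros u Hu; apply (eq_of_is_derive o (fun u => u * q u) (Derive o) r); auto.
  - intros x Hx; apply smooth1_is_derive with r; auto.
  - intros x Hx; apply (is_derive_mult_moment (fun x _ => Derive o x) r).
    + intros a b Hab; apply (Cn_continuity 0 (box r)); auto.
      apply (proj1 (smooth1_Cn r _)); auto.
    + split; auto; rewrite Rabs_R0; auto.
  - unfold o; rewrite Ropp_0; ring. }
destruct (even_function_of_square r e) as [A [HA EA]]; auto.
destruct (even_function_of_square r q) as [B [HB EB]]; auto.
exists A, B; split; [|split]; auto.
apply locally_Rabs with r; [|rewrite Rabs_R0; auto]; intros u Hu.
rewrite -EA; auto; rewrite -EB; auto; rewrite -Hoq; auto.
unfold e, o; field.
Qed.

(** * Double power series *)

Definition eval2 (a : nat -> nat -> R) (x y : R) : R :=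
  PSeries (fun i => PSeries (a i) y) x.

(** Square truncations are symmetric in the two indices and factor on products; the two iterated
    sums are compared through them. *)
Definition sum2 (a : nat -> nat -> R) (n : nat) : R :=
  sum_f_R0 (fun i => sum_f_R0 (a i) n) n.

Definition coef_bound (a : nat -> nat -> R) (r M : R) : Prop :=
  forall i j, Rabs (a i j) * r ^ (i + j) <= M.

(** A bound on the weighted l1 norm. Unlike [coef_bound] it is submultiplicative for the Cauchy
    product, so powers and compositions can be estimated. *)
Definition l1_bound (a : nat -> nat -> R) (r M : R) : Prop :=
  forall n, sum2 (fun i j => Rabs (a i j) * r ^ (i + j)) n <= M.

Lemma coef_term_ge_0 z r n : 0 <= r -> 0 <= Rabs z * r ^ n.
Proof. intros Hr; apply Rmult_le_pos; [apply Rabs_pos|apply pow_le, Hr]. Qed.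

Lemma geom_sum_le t n : 0 <= t < 1 -> sum_f_R0 (fun i => t ^ i) n <= / (1 - t).
Proof.
intros Ht; rewrite tech3; [|lra].
assert (0 <= t ^ S n) by (apply pow_le; lra).
assert (0 < / (1 - t)) by (apply Rinv_0_lt_compat; lra).
unfold Rdiv; nra.
Qed.

Lemma Series_geom_le (a : nat -> R) M t :
  0 <= t < 1 -> (forall n, Rabs (a n) <= M * t ^ n) ->
  ex_series a /\ Rabs (Series a) <= M / (1 - t).
Proof.
intros Ht H.
assert (Hg : is_series (fun n => M * t ^ n) (M / (1 - t))).
{ apply: (is_series_scal_l M (fun n => t ^ n) (/ (1 - t))).
  apply is_series_geom; rewrite Rabs_pos_eq; lra. }
assert (Ha : ex_series (fun n => Rabs (a n))).
{ apply: (ex_series_le _ (fun n => M * t ^ n)); [|eexists; exact Hg].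
  intros n; unfold norm; simpl; unfold abs; simpl; rewrite Rabs_Rabsolu; auto. }
split; [apply ex_series_Rabs; auto|].
eapply Rle_trans; [apply Series_Rabs; auto|].
rewrite <- (is_series_unique _ _ Hg); apply Series_le; [|eexists; exact Hg].
intros n; split; [apply Rabs_pos|auto].
Qed.

Lemma Rabs_pow_le_scaled x t r n :
  0 < r -> Rabs x <= t * r -> Rabs (x ^ n) <= t ^ n * r ^ n.
Proof.
intros Hr Hx; rewrite -RPow_abs -Rpow_mult_distr.
apply pow_incr; split; [apply Rabs_pos|auto].
Qed.

(** For |y| <= t r the terms are dominated by M t^j, which controls convergence, value and tail at
    once. *)
Lemma PSeries_truncation (a : nat -> R) r M t y n :
  0 < r -> 0 <= t < 1 -> (forall j, Rabs (a j) * r ^ j <= M) ->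
  Rabs y <= t * r ->
  ex_pseries a y /\ Rabs (PSeries a y) <= M / (1 - t) /\
  Rabs (PSeries a y - sum_f_R0 (fun j => a j * y ^ j) n)
    <= M / (1 - t) * t ^ S n.
Proof.
intros Hr Ht Ha Hy.
assert (H : forall j, Rabs (a j * y ^ j) <= M * t ^ j).
{ intros j; rewrite Rabs_mult.
  assert (X := Rabs_pow_le_scaled y t r j Hr Hy); assert (Y := Ha j).
  pose proof (Rabs_pos (a j)); assert (0 <= t ^ j) by (apply pow_le; lra).
  apply Rle_trans with (Rabs (a j) * (t ^ j * r ^ j)).
  - apply Rmult_le_compat_l; auto.
  - replace (Rabs (a j) * (t ^ j * r ^ j)) with (Rabs (a j) * r ^ j * t ^ j)
      by ring; apply Rmult_le_compat_r; auto. }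
destruct (Series_geom_le (fun j => a j * y ^ j) M t Ht H) as [He Hb].
split; [apply ex_pseries_R; auto|split; [exact Hb|]].
unfold PSeries at 1.
rewrite (Series_incr_n (fun j => a j * y ^ j) (S n)); [|lia|auto]; simpl pred.
match goal with |- Rabs (?u + ?v - ?w) <= _ =>
  replace (u + v - w) with v by ring end.
replace (M / (1 - t) * t ^ S n) with (M * t ^ S n / (1 - t)) by (field; lra).
apply (Series_geom_le _ (M * t ^ S n) t); auto.
intros k; rewrite Rmult_assoc -pow_add; apply H.
Qed.

Lemma box_ratio r x y : 0 < r -> box r x y ->
  exists t, 0 <= t < 1 /\ Rabs x <= t * r /\ Rabs y <= t * r.
Proof.
intros Hr [Hx Hy]; exists (Rmax (Rabs x) (Rabs y) / r).
assert (H : Rmax (Rabs x) (Rabs y) / r * r = Rmax (Rabs x) (Rabs y))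
  by (field; lra).
rewrite H; split; [split|split; [apply Rmax_l|apply Rmax_r]].
- apply Rmult_le_pos; [|left; apply Rinv_0_lt_compat; auto].
  eapply Rle_trans; [apply Rabs_pos|apply Rmax_l].
- apply Rmult_lt_reg_r with r; auto; rewrite H Rmult_1_l.
  apply Rmax_lub_lt; auto.
Qed.

Lemma coef_bound_row a r M i j :
  0 < r -> coef_bound a r M -> Rabs (a i j) * r ^ j <= M * / r ^ i.
Proof.
intros Hr H; assert (X := H i j); rewrite pow_add in X.
assert (0 < r ^ i) by (apply pow_lt; auto).
apply Rmult_le_reg_r with (r ^ i); auto.
rewrite (Rmult_assoc M) Rinv_l; lra.
Qed.

Lemma eval2_row_bound a r M t y i :
  0 < r -> 0 <= t < 1 -> coef_bound a r M -> Rabs y <= t * r ->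
  ex_pseries (a i) y /\ Rabs (PSeries (a i) y) * r ^ i <= M / (1 - t).
Proof.
intros Hr Ht Ha Hy.
destruct (PSeries_truncation (a i) r (M * / r ^ i) t y 0 Hr Ht) as [He [Hb _]];
  auto.
{ intros j; apply coef_bound_row; auto. }
split; auto; assert (0 < r ^ i) by (apply pow_lt; auto).
apply Rle_trans with (M * / r ^ i / (1 - t) * r ^ i).
- apply Rmult_le_compat_r; auto; lra.
- right; field; lra.
Qed.

Lemma coef_bound_ge_0 a r M : 0 < r -> coef_bound a r M -> 0 <= M.
Proof.
intros Hr H; eapply Rle_trans; [|apply (H 0%nat 0%nat)].
apply coef_term_ge_0; lra.
Qed.

Lemma eval2_bound a r M t x y :
  0 < r -> 0 <= t < 1 -> coef_bound a r M -> Rabs x <= t * r ->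
  Rabs y <= t * r ->
  ex_pseries (fun i => PSeries (a i) y) x /\
  Rabs (eval2 a x y) <= M / (1 - t) / (1 - t).
Proof.
intros Hr Ht Ha Hx Hy.
destruct (PSeries_truncation (fun i => PSeries (a i) y) r (M / (1 - t)) t x 0
  Hr Ht) as [He [Hb _]]; auto.
intros j; apply (eval2_row_bound a r M t y j); auto.
Qed.

(** One tail comes from the outer sum and one from the inner rows, whence the factor 2. The error
    depends on the array through [M] alone, so it is uniform over families with a common bound. *)
Lemma eval2_truncation a r M t x y n :
  0 < r -> 0 <= t < 1 -> coef_bound a r M -> Rabs x <= t * r ->
  Rabs y <= t * r ->
  Rabs (eval2 a x y - sum2 (fun i j => a i j * (x ^ i * y ^ j)) n)
    <= 2 * M / (1 - t) / (1 - t) * t ^ S n.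
Proof.
intros Hr Ht Ha Hx Hy.
assert (HM := coef_bound_ge_0 _ _ _ Hr Ha).
set (p := fun i => PSeries (a i) y).
destruct (PSeries_truncation p r (M / (1 - t)) t x n Hr Ht) as [_ [_ H1]]; auto.
{ intros j; apply (eval2_row_bound a r M t y j); auto. }
assert (H2 : Rabs (sum_f_R0 (fun i => p i * x ^ i) n
  - sum2 (fun i j => a i j * (x ^ i * y ^ j)) n)
  <= M / (1 - t) / (1 - t) * t ^ S n).
{ unfold sum2; rewrite <- minus_sum.
  eapply Rle_trans; [apply Rsum_abs|].
  apply Rle_trans with (sum_f_R0 (fun i => t ^ i * (M / (1 - t) * t ^ S n)) n).
  - apply sum_Rle; intros i _.
    destruct (PSeries_truncation (a i) r (M * / r ^ i) t y n Hr Ht)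
      as [_ [_ H]]; auto.
    { intros j; apply coef_bound_row; auto. }
    rewrite (sum_eq _ (fun j => a i j * y ^ j * x ^ i)); [|intros; ring].
    rewrite <- scal_sum.
    replace (p i * x ^ i - x ^ i * sum_f_R0 (fun j => a i j * y ^ j) n)
      with ((p i - sum_f_R0 (fun j => a i j * y ^ j) n) * x ^ i) by ring.
    rewrite Rabs_mult.
    apply Rle_trans with
      (M * / r ^ i / (1 - t) * t ^ S n * (t ^ i * r ^ i)).
    + apply Rmult_le_compat; try apply Rabs_pos; auto.
      apply Rabs_pow_le_scaled; auto.
    + right; assert (0 < r ^ i) by (apply pow_lt; auto); field; lra.
  - rewrite <- scal_sum.
    replace (M / (1 - t) / (1 - t) * t ^ S n)
      with (M / (1 - t) * t ^ S n * / (1 - t)) by (field; lra).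
    apply Rmult_le_compat_l.
    + apply Rmult_le_pos; [|apply pow_le; lra].
      apply Rmult_le_pos; auto; left; apply Rinv_0_lt_compat; lra.
    + apply geom_sum_le; lra. }
unfold eval2; fold p.
replace (PSeries p x - sum2 (fun i j => a i j * (x ^ i * y ^ j)) n)
  with ((PSeries p x - sum_f_R0 (fun i => p i * x ^ i) n)
    + (sum_f_R0 (fun i => p i * x ^ i) n
       - sum2 (fun i j => a i j * (x ^ i * y ^ j)) n)) by ring.
eapply Rle_trans; [apply Rabs_triang|].
replace (2 * M / (1 - t) / (1 - t) * t ^ S n)
  with (M / (1 - t) / (1 - t) * t ^ S n + M / (1 - t) / (1 - t) * t ^ S n)
  by (field; lra).
apply Rplus_le_compat; auto.
Qed.

Lemma geom_tail_small C t (eps : R) :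
  0 <= t < 1 -> 0 < eps -> exists n, C * t ^ S n < eps.
Proof.
intros Ht He; destruct (Rle_lt_dec C 0) as [HC|HC].
- exists 0%nat; assert (0 <= t ^ 1) by (apply pow_le; lra); nra.
- destruct (pow_lt_1_zero t ltac:(rewrite Rabs_pos_eq; lra) (eps / C)) as [n Hn].
  { apply Rdiv_lt_0_compat; auto. }
  exists n; assert (X := Hn (S n) ltac:(lia)).
  assert (t ^ S n < eps / C) by (eapply Rle_lt_trans; [apply Rle_abs|exact X]).
  replace eps with (C * (eps / C)) by (field; lra).
  apply Rmult_lt_compat_l; auto.
Qed.

Lemma eval2_lim a r M x y :
  0 < r -> coef_bound a r M -> box r x y ->
  is_lim_seq (sum2 (fun i j => a i j * (x ^ i * y ^ j))) (eval2 a x y).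
Proof.
intros Hr Ha Hxy; destruct (box_ratio r x y Hr Hxy) as [t [Ht [Hx Hy]]].
apply is_lim_seq_spec; intros eps.
destruct (geom_tail_small (2 * M / (1 - t) / (1 - t)) t eps Ht (cond_pos eps))
  as [N HN].
exists N; intros n Hn.
rewrite Rabs_minus_sym; eapply Rle_lt_trans;
  [apply (eval2_truncation a r M t x y n); auto|].
eapply Rle_lt_trans; [|exact HN]; apply Rmult_le_compat_l.
- assert (HM := coef_bound_ge_0 _ _ _ Hr Ha).
  assert (0 < / (1 - t)) by (apply Rinv_0_lt_compat; lra).
  apply Rmult_le_pos; [|lra]; apply Rmult_le_pos; lra.
- replace (S n) with (S N + (n - N))%nat by lia; rewrite pow_add.
  assert (0 <= t ^ S N) by (apply pow_le; lra).
  assert (t ^ (n - N) <= 1)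
    by (rewrite <- (pow1 (n - N)); apply pow_incr; lra).
  nra.
Qed.

Lemma is_lim_seq_sum_f_R0 (u : nat -> nat -> R) (l : nat -> R) n :
  (forall i, is_lim_seq (fun N => u N i) (l i)) ->
  is_lim_seq (fun N => sum_f_R0 (u N) n) (sum_f_R0 l n).
Proof.
intros H; induction n as [|n IH]; simpl; auto.
apply is_lim_seq_plus'; auto.
Qed.

Lemma is_lim_seq_sum2 (u : nat -> nat -> nat -> R) (l : nat -> nat -> R) n :
  (forall i j, is_lim_seq (fun N => u N i j) (l i j)) ->
  is_lim_seq (fun N => sum2 (u N) n) (sum2 l n).
Proof.
intros H; apply is_lim_seq_sum_f_R0; intros i.
apply is_lim_seq_sum_f_R0; auto.
Qed.

Lemma is_lim_seq_coef_bound u (a : nat -> nat -> R) r M :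
  (forall N, coef_bound (u N) r M) ->
  (forall i j, is_lim_seq (fun N => u N i j) (a i j)) -> coef_bound a r M.
Proof.
intros Hu Hl i j.
apply (is_lim_seq_le (fun N => Rabs (u N i j) * r ^ (i + j)) (fun _ => M)
  (Rabs (a i j) * r ^ (i + j)) M).
- intros N; apply Hu.
- apply (is_lim_seq_scal_r (fun N => Rabs (u N i j)) _ (Rabs (a i j))).
  apply (is_lim_seq_abs (fun N => u N i j) (a i j)); auto.
- apply is_lim_seq_const.
Qed.

Lemma is_lim_seq_l1_bound u (a : nat -> nat -> R) r M :
  (forall N, l1_bound (u N) r M) ->
  (forall i j, is_lim_seq (fun N => u N i j) (a i j)) -> l1_bound a r M.
Proof.
intros Hu Hl n.
apply (is_lim_seq_le
  (fun N => sum2 (fun i j => Rabs (u N i j) * r ^ (i + j)) n) (fun _ => M)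
  (sum2 (fun i j => Rabs (a i j) * r ^ (i + j)) n) M).
- intros N; apply Hu.
- apply is_lim_seq_sum2; intros i j.
  apply (is_lim_seq_scal_r (fun N => Rabs (u N i j)) _ (Rabs (a i j))).
  apply (is_lim_seq_abs (fun N => u N i j) (a i j)); auto.
- apply is_lim_seq_const.
Qed.

(** One truncation error covers all the arrays, and truncated sums involve finitely many
    coefficients. *)
Lemma is_lim_seq_eval2 u (a : nat -> nat -> R) r M x y :
  0 < r -> (forall N, coef_bound (u N) r M) ->
  (forall i j, is_lim_seq (fun N => u N i j) (a i j)) -> box r x y ->
  is_lim_seq (fun N => eval2 (u N) x y) (eval2 a x y).
Proof.
intros Hr Hu Hl Hxy; destruct (box_ratio r x y Hr Hxy) as [t [Ht [Hx Hy]]].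
assert (Ha := is_lim_seq_coef_bound _ _ _ _ Hu Hl).
apply is_lim_seq_spec; intros eps.
assert (He : 0 < eps / 3) by (assert (X := cond_pos eps); lra).
destruct (geom_tail_small (2 * M / (1 - t) / (1 - t)) t (eps / 3) Ht He)
  as [n Hn].
assert (L : is_lim_seq (fun N => sum2 (fun i j => u N i j * (x ^ i * y ^ j)) n)
  (sum2 (fun i j => a i j * (x ^ i * y ^ j)) n)).
{ apply is_lim_seq_sum2; intros i j.
  apply (is_lim_seq_scal_r (fun N => u N i j) _ (a i j)); auto. }
apply is_lim_seq_spec in L; destruct (L (mkposreal _ He)) as [N0 HN0].
exists N0; intros N HN; specialize (HN0 N HN); simpl in HN0.
assert (T1 := eval2_truncation (u N) r M t x y n Hr Ht (Hu N) Hx Hy).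
assert (T2 := eval2_truncation a r M t x y n Hr Ht Ha Hx Hy).
revert T1 T2 HN0; split_Rabs; lra.
Qed.

Lemma coef_bound_swap a r M :
  coef_bound a r M -> coef_bound (fun i j => a j i) r M.
Proof. intros H i j; rewrite Nat.add_comm; apply H. Qed.

Lemma sum_f_R0_swap (a : nat -> nat -> R) n m :
  sum_f_R0 (fun i => sum_f_R0 (a i) m) n =
  sum_f_R0 (fun j => sum_f_R0 (fun i => a i j) n) m.
Proof.
induction n as [|n IH]; simpl; auto.
rewrite IH -plus_sum; apply sum_eq; auto.
Qed.

(** The two iterated sums are limits of the same square partial sums. *)
Lemma eval2_swap a r M x y :
  0 < r -> coef_bound a r M -> box r x y ->
  eval2 (fun i j => a j i) y x = eval2 a x y.
Proof.
intros Hr Ha Hxy.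
assert (H1 := eval2_lim a r M x y Hr Ha Hxy).
assert (Hyx : box r y x) by (destruct Hxy; split; auto).
assert (H2 := eval2_lim _ r M y x Hr (coef_bound_swap _ _ _ Ha) Hyx).
apply is_lim_seq_unique in H1.
apply is_lim_seq_ext with (v := sum2 (fun i j => a i j * (x ^ i * y ^ j))) in H2.
- apply is_lim_seq_unique in H2; rewrite H1 in H2; injection H2; auto.
- intros n; unfold sum2; rewrite sum_f_R0_swap.
  apply sum_eq; intros i _; apply sum_eq; intros j _; ring.
Qed.

Lemma continuity_2d_pt_sum (f : nat -> R -> R -> R) n x y :
  (forall i, continuity_2d_pt (f i) x y) ->
  continuity_2d_pt (fun u v => sum_f_R0 (fun i => f i u v) n) x y.
Proof.
intros H; induction n as [|n IH]; simpl; auto.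
apply continuity_2d_pt_plus; auto.
Qed.

Lemma continuity_2d_pt_eval2 a r M x y :
  0 < r -> coef_bound a r M -> box r x y -> continuity_2d_pt (eval2 a) x y.
Proof.
intros Hr Ha Hxy eps; destruct (box_ratio r x y Hr Hxy) as [t [Ht [Hx Hy]]].
(* A ratio strictly between t and 1 leaves room to move the point under a uniform truncation
   error. *)
set (q := (t + 1) / 2).
assert (Hq : 0 <= q < 1 /\ t < q) by (unfold q; lra).
assert (He : 0 < eps / 3) by (assert (X := cond_pos eps); lra).
destruct (geom_tail_small (2 * M / (1 - q) / (1 - q)) q (eps / 3))
  as [n Hn]; [tauto|auto|].
assert (C : continuity_2d_pt
  (fun x y => sum2 (fun i j => a i j * (x ^ i * y ^ j)) n) x y).
{ apply continuity_2d_pt_sum; intros i; apply continuity_2d_pt_sum; intros j.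
  apply continuity_2d_pt_mult; [apply continuity_2d_pt_const|].
  apply continuity_2d_pt_mult.
  - apply continuity_2d_pt_pow, continuity_2d_pt_id1.
  - apply continuity_2d_pt_pow, continuity_2d_pt_id2. }
destruct (C (mkposreal _ He)) as [d Hd]; simpl in Hd.
assert (Hqr : t * r < q * r) by (apply Rmult_lt_compat_r; lra).
destruct (open2_box (q * r) x y) as [d' Hd']; [split; lra|].
assert (Hdd : 0 < Rmin d d') by (apply Rmin_pos; apply cond_pos).
exists (mkposreal _ Hdd); simpl; intros u v Hu Hv.
assert (K1 := Hd u v (Rlt_le_trans _ _ _ Hu (Rmin_l _ _))
  (Rlt_le_trans _ _ _ Hv (Rmin_l _ _))).
destruct (Hd' u v (Rlt_le_trans _ _ _ Hu (Rmin_r _ _))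
  (Rlt_le_trans _ _ _ Hv (Rmin_r _ _))) as [Bu Bv].
assert (T1 := eval2_truncation a r M q u v n Hr (proj1 Hq) Ha
  ltac:(lra) ltac:(lra)).
assert (T2 := eval2_truncation a r M q x y n Hr (proj1 Hq) Ha
  ltac:(lra) ltac:(lra)).
revert T1 T2 K1; split_Rabs; lra.
Qed.

(** Bounds are asked at all radii below [r] and not at [r] itself, so that termwise differentiation,
    which loses a little radius, keeps the same [r]. *)
Definition convergent2 (a : nat -> nat -> R) (r : R) : Prop :=
  forall p, 0 < p < r -> exists M, coef_bound a p M.

Definition analytic_on (r : R) (f : R -> R -> R) : Prop :=
  exists a, convergent2 a r /\ forall x y, box r x y -> f x y = eval2 a x y.

Lemma coef_bound_le a r r' M :
  0 <= r' <= r -> coef_bound a r M -> coef_bound a r' M.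
Proof.
intros Hr H i j; eapply Rle_trans; [|apply (H i j)].
apply Rmult_le_compat_l; [apply Rabs_pos|apply pow_incr; lra].
Qed.

Lemma convergent2_point a r x y :
  convergent2 a r -> box r x y ->
  exists p M, 0 < p < r /\ coef_bound a p M /\ box p x y.
Proof.
intros Ha [Hx Hy]; set (m := Rmax (Rabs x) (Rabs y)).
assert (H : Rabs x <= m /\ Rabs y <= m) by (split; [apply Rmax_l|apply Rmax_r]).
assert (Hm : m < r) by (apply Rmax_lub_lt; auto).
pose proof (Rabs_pos x).
destruct (Ha ((m + r) / 2)) as [M HM]; [lra|].
exists ((m + r) / 2), M; repeat split; auto; lra.
Qed.

Lemma analytic_germ2_on f :
  analytic_germ2 f <-> exists r, 0 < r /\ analytic_on r f.
Proof.
split.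
- intros [a [M [r [Hr [Ha E]]]]]; apply near_box in E.
  destruct E as [d [Hd E]].
  assert (Hm : 0 < Rmin r d) by (apply Rmin_pos; auto).
  exists (Rmin r d); split; auto; exists a; split.
  + intros p Hp; exists M; apply coef_bound_le with r; auto.
    pose proof (Rmin_l r d); lra.
  + intros x y Hxy; apply E; apply box_le with (2 := Hxy), Rmin_r.
- intros [r [Hr [a [Ha E]]]]; destruct (Ha (r / 2)) as [M HM]; [lra|].
  exists a, M, (r / 2); split; [lra|split; [exact HM|]].
  apply near_box; exists r; auto.
Qed.

Lemma analytic_on_le r r' f : r' <= r -> analytic_on r f -> analytic_on r' f.
Proof.
intros Hr [a [Ha E]]; exists a; split.
- intros p Hp; apply Ha; lra.
- intros x y Hxy; apply E, (box_le _ _ _ _ Hr Hxy).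
Qed.

Lemma CV_radius_bound (a : nat -> R) r M x :
  0 < r -> (forall j, Rabs (a j) * r ^ j <= M) -> Rabs x < r ->
  Rbar_lt (Rabs x) (CV_radius a).
Proof.
intros Hr H Hx; apply Rbar_lt_le_trans with (Finite r); [exact Hx|].
apply (proj1 (CV_radius_bounded a)); exists M; intros n.
rewrite Rabs_mult (Rabs_pos_eq (r ^ n)); auto; apply pow_le; lra.
Qed.

Definition coef_dx (a : nat -> nat -> R) (i j : nat) : R :=
  INR (S i) * a (S i) j.

Lemma convergent2_dx a r : convergent2 a r -> convergent2 (coef_dx a) r.
Proof.
intros Ha p Hp; set (q := (p + r) / 2).
assert (Hq : p < q < r) by (unfold q; lra).
destruct (Ha q) as [M HM]; [lra|].
set (t := p / q).
assert (Ht : 0 < t < 1).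
{ unfold t; split; [apply Rdiv_lt_0_compat; lra|].
  apply Rmult_lt_reg_r with q; [lra|]; unfold Rdiv.
  rewrite Rmult_assoc Rinv_l; lra. }
assert (Ept : p = t * q) by (unfold t; field; lra).
assert (Hpow : forall k, 0 <= t ^ k <= 1).
{ intros k; split; [apply pow_le; lra|].
  rewrite <- (pow1 k); apply pow_incr; lra. }
(* Each of 1, t, ..., t^i is at least t^i, so the factor i + 1 created by differentiation is
   absorbed by a geometric sum. *)
assert (Hgeo : forall i, INR (S i) * t ^ i <= / (1 - t)).
{ intros i; eapply Rle_trans; [|apply (geom_sum_le t i); lra].
  rewrite Rmult_comm -sum_cte; apply sum_Rle; intros k Hk.
  replace i with (k + (i - k))%nat by lia; rewrite pow_add.
  specialize (Hpow (i - k)%nat) as X; specialize (Hpow k); nra. }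
exists (/ (1 - t) * 1 * (M * / q)); intros i j; unfold coef_dx.
rewrite Rabs_mult (Rabs_pos_eq (INR (S i))); [|apply pos_INR].
rewrite Ept Rpow_mult_distr pow_add.
replace (INR (S i) * Rabs (a (S i) j) * (t ^ i * t ^ j * q ^ (i + j)))
  with (INR (S i) * t ^ i * t ^ j * (Rabs (a (S i) j) * q ^ (S i + j) * / q))
  by (replace (S i + j)%nat with (S (i + j)) by lia; simpl pow; field; lra).
assert (0 <= INR (S i) * t ^ i)
  by (apply Rmult_le_pos; [apply pos_INR|apply Hpow]).
assert (0 <= / q) by (left; apply Rinv_0_lt_compat; lra).
apply Rmult_le_compat.
- apply Rmult_le_pos; [auto|apply Hpow].
- apply Rmult_le_pos; [apply coef_term_ge_0; lra|auto].
- apply Rmult_le_compat; auto; apply Hpow.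
- apply Rmult_le_compat_r; auto.
Qed.

Lemma is_derive_eval2_x a r x y :
  convergent2 a r -> box r x y ->
  is_derive (fun t => eval2 a t y) x (eval2 (coef_dx a) x y).
Proof.
intros Ha Hxy; destruct (convergent2_point a r x y Ha Hxy)
  as [p [M [Hp [HM Hb]]]].
assert (Hp0 : 0 < p) by lra.
destruct (box_ratio p x y Hp0 Hb) as [t [Ht [Hx Hy]]].
unfold eval2 at 2.
rewrite (PSeries_ext _ (PS_derive (fun i => PSeries (a i) y))).
- apply is_derive_PSeries, CV_radius_bound with p (M / (1 - t)); auto.
  + intros j; apply (eval2_row_bound a p M t y j); auto.
  + apply Hb.
- intros i; unfold PS_derive, coef_dx.
  rewrite <- PSeries_scal; apply PSeries_ext; intros j; reflexivity.
Qed.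

Definition transpose (a : nat -> nat -> R) (i j : nat) : R := a j i.

Lemma convergent2_transpose a r : convergent2 a r -> convergent2 (transpose a) r.
Proof.
intros Ha p Hp; destruct (Ha p Hp) as [M HM]; exists M.
apply coef_bound_swap, HM.
Qed.

Lemma eval2_transpose a r x y :
  convergent2 a r -> box r x y -> eval2 (transpose a) y x = eval2 a x y.
Proof.
intros Ha Hxy; destruct (convergent2_point a r x y Ha Hxy)
  as [p [M [Hp [HM Hb]]]].
apply (eval2_swap a p M); auto; lra.
Qed.

Lemma box_swap r x y : box r x y -> box r y x.
Proof. intros [H1 H2]; split; auto. Qed.

Definition coef_dy (a : nat -> nat -> R) : nat -> nat -> R :=
  transpose (coef_dx (transpose a)).

Lemma convergent2_dy a r : convergent2 a r -> convergent2 (coef_dy a) r.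
Proof.
intros Ha; apply convergent2_transpose, convergent2_dx, convergent2_transpose, Ha.
Qed.

Lemma is_derive_eval2_y a r x y :
  convergent2 a r -> box r x y ->
  is_derive (fun t => eval2 a x t) y (eval2 (coef_dy a) x y).
Proof.
intros Ha Hxy.
apply is_derive_ext_loc with (fun t => eval2 (transpose a) t x).
- apply filter_imp with (2 := open2_slice_y _ _ _ (open2_box r) Hxy).
  intros t Ht; apply eval2_transpose with r; auto.
- unfold coef_dy; rewrite (eval2_transpose _ r); [|apply convergent2_dx|].
  + apply is_derive_eval2_x with r; [|apply box_swap; auto].
    apply convergent2_transpose; auto.
  + apply convergent2_transpose; auto.
  + apply box_swap; auto.
Qed.

Lemma continuity_2d_pt_convergent2 a r x y :
  convergent2 a r -> box r x y -> continuity_2d_pt (eval2 a) x y.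
Proof.
intros Ha Hxy; destruct (convergent2_point a r x y Ha Hxy)
  as [p [M [Hp [HM Hb]]]].
apply continuity_2d_pt_eval2 with p M; auto; lra.
Qed.

Lemma Cn_eval2 n a r : convergent2 a r -> Cn n (box r) (eval2 a).
Proof.
revert a; induction n as [|n IH]; intros a Ha; split; auto;
  try (intros; apply continuity_2d_pt_convergent2 with r; auto).
exists (eval2 (coef_dx a)), (eval2 (coef_dy a)).
split; [|split]; [| |split; apply IH].
- intros; apply is_derive_eval2_x with r; auto.
- intros; apply is_derive_eval2_y with r; auto.
- apply convergent2_dx; auto.
- apply convergent2_dy; auto.
Qed.

Lemma analytic_germ2_smooth f : analytic_germ2 f -> smooth_germ2 f.
Proof.
intros Hf; apply analytic_germ2_on in Hf; destruct Hf as [r [Hr [a [Ha E]]]].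
apply smooth_germ2_Cn; exists r; split; auto; intros n.
apply Cn_ext with (eval2 a); [apply open2_box| |apply Cn_eval2; auto].
intros x y Hxy; symmetry; auto.
Qed.

Lemma analytic_germ2_dx f :
  analytic_germ2 f -> analytic_germ2 (fun x y => Derive (fun t => f t y) x).
Proof.
rewrite !analytic_germ2_on; intros [r [Hr [a [Ha E]]]]; exists r; split; auto.
exists (coef_dx a); split; [apply convergent2_dx; auto|].
intros x y Hxy; apply is_derive_unique.
apply is_derive_ext_loc with (fun t => eval2 a t y).
- apply filter_imp with (2 := open2_slice_x _ _ _ (open2_box r) Hxy).
  intros t Ht; symmetry; auto.
- apply is_derive_eval2_x with r; auto.
Qed.

Lemma primitive_analytic w :
  analytic_germ2 w -> exists q, analytic_germ2 q /\
    near (fun x y => is_derive (fun z => z * q z y) x (w x y)).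
Proof.
intros Hw; apply analytic_germ2_on in Hw; destruct Hw as [r [Hr [a [Ha E]]]].
set (b := fun i j => a i j / INR (S i)).
assert (HS : forall i, 1 <= INR (S i))
  by (intros i; rewrite S_INR; pose proof (pos_INR i); lra).
assert (Hb : convergent2 b r).
{ intros p Hp; destruct (Ha p Hp) as [M HM]; exists M; intros i j.
  eapply Rle_trans; [|apply (HM i j)].
  apply Rmult_le_compat_r; [apply pow_le; lra|].
  unfold b, Rdiv; rewrite Rabs_mult.
  specialize (HS i); rewrite (Rabs_pos_eq (/ INR (S i)));
    [|left; apply Rinv_0_lt_compat; lra].
  rewrite <- (Rmult_1_r (Rabs (a i j))) at 2.
  apply Rmult_le_compat_l; [apply Rabs_pos|].
  rewrite <- Rinv_1; apply Rinv_le_contravar; lra. }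
(* [b] holds the coefficients of q and its shift [c] those of x q; differentiating [c] in x returns
   [a]. *)
set (c := fun i j => match i with O => 0 | S k => b k j end).
assert (Hc : convergent2 c r).
{ intros p Hp; destruct (Hb p Hp) as [M HM].
  assert (HM0 := coef_bound_ge_0 b p M ltac:(lra) HM).
  exists (M * p); intros [|i] j; simpl.
  - rewrite Rabs_R0 Rmult_0_l; nra.
  - assert (X := HM i j).
    replace (Rabs (b i j) * (p * p ^ (i + j)))
      with (Rabs (b i j) * p ^ (i + j) * p) by ring.
    apply Rmult_le_compat_r; lra. }
exists (eval2 b); split.
- apply analytic_germ2_on; exists r; split; auto; exists b; auto.
- apply near_box; exists r; split; auto; intros x y Hxy.
  rewrite E; auto.
  apply is_derive_ext with (fun z => eval2 c z y).
  + intros z; unfold eval2.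
    rewrite <- PSeries_incr_1; apply PSeries_ext; intros [|i]; simpl.
    * unfold PSeries; rewrite (Series_ext _ (fun n => 0 * 0)).
      -- rewrite Series_scal_l; apply Rmult_0_l.
      -- intros n; unfold c; ring.
    * reflexivity.
  + replace (eval2 a x y) with (eval2 (coef_dx c) x y).
    * apply is_derive_eval2_x with r; auto.
    * apply PSeries_ext; intros i; apply PSeries_ext; intros j.
      unfold coef_dx, c, b; specialize (HS i); field; lra.
Qed.

(** * Finite double sums and weighted l1 bounds *)

Lemma sum_f_R0_ge_0 (u : nat -> R) n :
  (forall i, 0 <= u i) -> 0 <= sum_f_R0 u n.
Proof.
intros H; induction n as [|n IH]; simpl; auto; specialize (H (S n)); lra.
Qed.

Lemma sum_f_R0_ge_term (u : nat -> R) k n :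
  (forall i, 0 <= u i) -> (k <= n)%nat -> u k <= sum_f_R0 u n.
Proof.
intros H; induction n as [|n IH]; intros Hk.
- replace k with 0%nat by lia; simpl; lra.
- simpl; destruct (Nat.eq_dec k (S n)) as [->|Hn].
  + pose proof (sum_f_R0_ge_0 u n H); lra.
  + specialize (IH ltac:(lia)); specialize (H (S n)); lra.
Qed.

Lemma sum2_le (a b : nat -> nat -> R) n :
  (forall i j, a i j <= b i j) -> sum2 a n <= sum2 b n.
Proof.
intros H; apply sum_Rle; intros i _; apply sum_Rle; auto.
Qed.

Lemma sum2_eq (a b : nat -> nat -> R) n :
  (forall i j, a i j = b i j) -> sum2 a n = sum2 b n.
Proof.
intros H; apply sum_eq; intros i _; apply sum_eq; auto.
Qed.

Lemma sum2_plus (a b : nat -> nat -> R) n :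
  sum2 (fun i j => a i j + b i j) n = sum2 a n + sum2 b n.
Proof.
unfold sum2; rewrite -plus_sum; apply sum_eq; intros i _; apply plus_sum.
Qed.

Lemma sum2_scal c (a : nat -> nat -> R) n :
  sum2 (fun i j => c * a i j) n = c * sum2 a n.
Proof.
unfold sum2; rewrite scal_sum; apply sum_eq; intros i _.
rewrite Rmult_comm scal_sum; apply sum_eq; intros; ring.
Qed.

Lemma sum2_prod (u v : nat -> R) n :
  sum2 (fun i j => u i * v j) n = sum_f_R0 u n * sum_f_R0 v n.
Proof.
unfold sum2; rewrite Rmult_comm scal_sum; apply sum_eq; intros i _.
rewrite scal_sum; apply sum_eq; intros; ring.
Qed.

Lemma l1_coef_bound a r M : 0 <= r -> l1_bound a r M -> coef_bound a r M.
Proof.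
intros Hr H i j.
assert (H0 : forall i j, 0 <= Rabs (a i j) * r ^ (i + j)).
{ intros; apply coef_term_ge_0, Hr. }
eapply Rle_trans; [|apply (H (i + j)%nat)].
eapply Rle_trans;
  [|apply (sum_f_R0_ge_term _ i (i + j)); [|lia]].
- apply (sum_f_R0_ge_term (fun j => Rabs (a i j) * r ^ (i + j)) j); auto; lia.
- intros k; apply sum_f_R0_ge_0; auto.
Qed.

Lemma sum2_geom_le s t n :
  0 <= s < 1 -> 0 <= t < 1 ->
  sum2 (fun i j => s ^ i * t ^ j) n <= / (1 - s) * / (1 - t).
Proof.
intros Hs Ht; rewrite sum2_prod; apply Rmult_le_compat;
  try apply geom_sum_le; auto; apply sum_f_R0_ge_0; intros; apply pow_le; lra.
Qed.

(** Shrinking the radius by t trades the supremum of the weighted coefficients for their sum, at the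
    price of a double geometric series. *)
Lemma coef_bound_l1 a r M t :
  0 < r -> 0 <= t < 1 -> coef_bound a r M ->
  l1_bound a (t * r) (M * (/ (1 - t) * / (1 - t))).
Proof.
intros Hr Ht Ha n; apply Rle_trans with (sum2 (fun i j => M * (t ^ i * t ^ j)) n).
- apply sum2_le; intros i j; rewrite Rpow_mult_distr -pow_add.
  replace (Rabs (a i j) * (t ^ (i + j) * r ^ (i + j)))
    with (Rabs (a i j) * r ^ (i + j) * t ^ (i + j)) by ring.
  apply Rmult_le_compat_r; [apply pow_le; lra|apply Ha].
- rewrite sum2_scal; apply Rmult_le_compat_l.
  + apply coef_bound_ge_0 with a r; auto.
  + apply sum2_geom_le; auto.
Qed.

(** Without constant term every monomial gains at least one factor t. *)
Lemma l1_shrink a r M t :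
  0 < r -> 0 <= t <= 1 -> a 0%nat 0%nat = 0 -> l1_bound a r M ->
  l1_bound a (t * r) (t * M).
Proof.
intros Hr Ht H0 Ha n.
apply Rle_trans with (t * sum2 (fun i j => Rabs (a i j) * r ^ (i + j)) n).
- rewrite -sum2_scal; apply sum2_le; intros i j.
  destruct (Nat.eq_dec (i + j) 0) as [E|E].
  + replace i with 0%nat by lia; replace j with 0%nat by lia.
    rewrite H0 Rabs_R0; lra.
  + rewrite Rpow_mult_distr; destruct (i + j)%nat as [|k]; [lia|].
    assert (0 <= Rabs (a i j) * r ^ S k) by (apply coef_term_ge_0; lra).
    assert (t ^ k <= 1) by (rewrite <- (pow1 k); apply pow_incr; lra).
    replace (Rabs (a i j) * (t ^ S k * r ^ S k))
      with (t * (Rabs (a i j) * r ^ S k) * t ^ k) by (simpl; ring).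
    rewrite <- (Rmult_1_r (t * (Rabs (a i j) * r ^ S k))) at 2.
    apply Rmult_le_compat_l; auto; apply Rmult_le_pos; lra.
- apply Rmult_le_compat_l; [lra|apply Ha].
Qed.

Lemma l1_ge_0 a r M : 0 <= r -> l1_bound a r M -> 0 <= M.
Proof.
intros Hr H; eapply Rle_trans; [|apply (H 0%nat)]; unfold sum2; simpl.
pose proof (Rabs_pos (a 0%nat 0%nat)); lra.
Qed.

Lemma l1_le a r r' M M' :
  0 <= r' <= r -> M <= M' -> l1_bound a r M -> l1_bound a r' M'.
Proof.
intros Hr HM H n; eapply Rle_trans; [|eapply Rle_trans; [apply (H n)|exact HM]].
apply sum2_le; intros i j; apply Rmult_le_compat_l; [apply Rabs_pos|].
apply pow_incr; auto.
Qed.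

(** * The convolution algebra of double series *)

Definition add2 (a b : nat -> nat -> R) (i j : nat) : R := a i j + b i j.
Definition scal2 (c : R) (a : nat -> nat -> R) (i j : nat) : R := c * a i j.
Definition mul2 (a b : nat -> nat -> R) (i j : nat) : R :=
  sum_f_R0 (fun k => sum_f_R0 (fun l => a k l * b (i - k)%nat (j - l)%nat) j) i.
Definition one2 (i j : nat) : R :=
  match i, j with O, O => 1 | _, _ => 0 end.
Fixpoint pow2d (u : nat -> nat -> R) (n : nat) : nat -> nat -> R :=
  match n with O => one2 | S n => mul2 u (pow2d u n) end.

Lemma l1_add a b r M N :
  0 <= r -> l1_bound a r M -> l1_bound b r N -> l1_bound (add2 a b) r (M + N).
Proof.
intros Hr Ha Hb n; eapply Rle_trans; [|apply Rplus_le_compat; [apply (Ha n)|apply (Hb n)]].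
rewrite -sum2_plus; apply sum2_le; intros i j; unfold add2.
rewrite <- Rmult_plus_distr_r; apply Rmult_le_compat_r; [apply pow_le; auto|].
apply Rabs_triang.
Qed.

Lemma l1_scal c a r M :
  0 <= r -> l1_bound a r M -> l1_bound (scal2 c a) r (Rabs c * M).
Proof.
intros Hr Ha n; apply Rle_trans with
  (Rabs c * sum2 (fun i j => Rabs (a i j) * r ^ (i + j)) n).
- rewrite -sum2_scal; apply sum2_le; intros i j; unfold scal2.
  rewrite Rabs_mult; lra.
- apply Rmult_le_compat_l; [apply Rabs_pos|apply Ha].
Qed.

(** The triangle k + l <= n lies inside the square k, l <= n, and the terms are nonnegative. *)
Lemma cauchy_product_le (u v : nat -> R) n :
  (forall i, 0 <= u i) -> (forall i, 0 <= v i) ->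
  sum_f_R0 (fun i => sum_f_R0 (fun k => u k * v (i - k)%nat) i) n
  <= sum_f_R0 u n * sum_f_R0 v n.
Proof.
intros Hu Hv; destruct n as [|n]; [simpl; lra|].
rewrite (cauchy_finite u v (S n)); [|lia].
assert (0 <= sum_f_R0 (fun k => sum_f_R0 (fun l =>
  u (S (l + k)) * v (S n - l)%nat) (pred (S n - k))) (pred (S n))).
{ apply sum_f_R0_ge_0; intros k; apply sum_f_R0_ge_0; intros l.
  apply Rmult_le_pos; auto. }
lra.
Qed.

Lemma mul2_abs_le a b r i j :
  0 <= r -> Rabs (mul2 a b i j) * r ^ (i + j) <=
  sum_f_R0 (fun k => sum_f_R0 (fun l => (Rabs (a k l) * r ^ (k + l)) *
    (Rabs (b (i - k)%nat (j - l)%nat) * r ^ ((i - k) + (j - l)))) j) i.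
Proof.
intros Hr; apply Rle_trans with (r ^ (i + j) * sum_f_R0 (fun k =>
  sum_f_R0 (fun l => Rabs (a k l) * Rabs (b (i - k)%nat (j - l)%nat)) j) i).
- rewrite Rmult_comm; apply Rmult_le_compat_l; [apply pow_le; auto|].
  unfold mul2; eapply Rle_trans; [apply Rsum_abs|]; apply sum_Rle; intros k _.
  eapply Rle_trans; [apply Rsum_abs|]; apply sum_Rle; intros l _.
  rewrite Rabs_mult; lra.
- rewrite scal_sum; apply sum_Rle; intros k Hk.
  rewrite Rmult_comm scal_sum; apply sum_Rle; intros l Hl.
  replace (i + j)%nat with ((k + l) + ((i - k) + (j - l)))%nat by lia.
  rewrite pow_add; right; ring.
Qed.

(** After passing to absolute values, the Cauchy product inequality is used inside each pair of rows
    and then across the rows. *)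
Lemma l1_mul a b r M N :
  0 <= r -> l1_bound a r M -> l1_bound b r N -> l1_bound (mul2 a b) r (M * N).
Proof.
intros Hr Ha Hb n.
set (A := fun i j => Rabs (a i j) * r ^ (i + j)).
set (B := fun i j => Rabs (b i j) * r ^ (i + j)).
assert (HA : forall i j, 0 <= A i j) by (intros; apply coef_term_ge_0, Hr).
assert (HB : forall i j, 0 <= B i j) by (intros; apply coef_term_ge_0, Hr).
apply Rle_trans with (sum_f_R0 (fun i => sum_f_R0 (fun k =>
  sum_f_R0 (A k) n * sum_f_R0 (B (i - k)%nat) n) i) n).
- apply sum_Rle; intros i _.
  apply Rle_trans with (sum_f_R0 (fun j => sum_f_R0 (fun k => sum_f_R0 (fun l =>
    A k l * B (i - k)%nat (j - l)%nat) j) i) n).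
  + apply sum_Rle; intros j _; apply mul2_abs_le; auto.
  + rewrite sum_f_R0_swap; apply sum_Rle; intros k _.
    apply (cauchy_product_le (A k) (B (i - k)%nat)); auto.
- eapply Rle_trans; [apply (cauchy_product_le (fun k => sum_f_R0 (A k) n)
    (fun k => sum_f_R0 (B k) n))|].
  + intros i; apply sum_f_R0_ge_0; auto.
  + intros i; apply sum_f_R0_ge_0; auto.
  + apply Rmult_le_compat; try apply Ha; try apply Hb;
      apply sum_f_R0_ge_0; intros; apply sum_f_R0_ge_0; auto.
Qed.

Lemma sum_f_R0_head (u : nat -> R) n :
  (forall i, u (S i) = 0) -> sum_f_R0 u n = u 0%nat.
Proof.
intros H; induction n as [|n IH]; simpl; auto; rewrite IH H; ring.
Qed.

Lemma l1_one r : l1_bound one2 r 1.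
Proof.
intros n; unfold sum2; rewrite sum_f_R0_head.
- rewrite sum_f_R0_head; simpl.
  + rewrite Rabs_R1; lra.
  + intros j; simpl; rewrite Rabs_R0; ring.
- intros i; rewrite sum_f_R0_head; simpl; rewrite ?Rabs_R0; try ring.
  intros j; ring.
Qed.

Lemma l1_pow u r p n : 0 <= r -> l1_bound u r p -> l1_bound (pow2d u n) r (p ^ n).
Proof.
intros Hr Hu; induction n as [|n IH]; simpl; [apply l1_one|].
apply l1_mul; auto.
Qed.

Lemma eval2_ex a r M x y :
  0 < r -> coef_bound a r M -> box r x y ->
  (forall i, ex_pseries (a i) y) /\ ex_pseries (fun i => PSeries (a i) y) x.
Proof.
intros Hr Ha Hxy; destruct (box_ratio r x y Hr Hxy) as [t [Ht [Hx Hy]]]; split.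
- intros i; apply (eval2_row_bound a r M t y i); auto.
- apply (eval2_bound a r M t x y); auto.
Qed.

Lemma eval2_add a b r M N x y :
  0 < r -> coef_bound a r M -> coef_bound b r N -> box r x y ->
  eval2 (add2 a b) x y = eval2 a x y + eval2 b x y.
Proof.
intros Hr Ha Hb Hxy.
destruct (eval2_ex a r M x y Hr Ha Hxy) as [Ha1 Ha2].
destruct (eval2_ex b r N x y Hr Hb Hxy) as [Hb1 Hb2].
unfold eval2; rewrite <- PSeries_plus; auto.
apply PSeries_ext; intros i; unfold PS_plus, plus; simpl.
rewrite <- PSeries_plus; auto.
Qed.

Lemma eval2_scal c a x y : eval2 (scal2 c a) x y = c * eval2 a x y.
Proof.
unfold eval2; rewrite <- PSeries_scal; apply PSeries_ext; intros i.
unfold PS_scal, scal; simpl; unfold mult; simpl; rewrite <- PSeries_scal.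
reflexivity.
Qed.

Lemma PSeries_sum_f_R0 (c : nat -> nat -> R) y n :
  (forall k, ex_pseries (c k) y) ->
  ex_pseries (fun j => sum_f_R0 (fun k => c k j) n) y /\
  PSeries (fun j => sum_f_R0 (fun k => c k j) n) y =
  sum_f_R0 (fun k => PSeries (c k) y) n.
Proof.
intros H; induction n as [|n [IH1 IH2]]; simpl; [split; auto|].
split.
- apply: ex_pseries_plus; auto.
- rewrite -IH2 -PSeries_plus; auto.
Qed.

Lemma eval2_mul a b r M N x y :
  0 < r -> coef_bound a r M -> coef_bound b r N -> box r x y ->
  eval2 (mul2 a b) x y = eval2 a x y * eval2 b x y.
Proof.
intros Hr Ha Hb Hxy.
destruct (box_ratio r x y Hr Hxy) as [t [Ht [Hx Hy]]].
assert (CVrow : forall a M i, coef_bound a r M ->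
  Rbar_lt (Rabs y) (CV_radius (a i))).
{ intros c K i Hc; apply CV_radius_bound with r (K * / r ^ i); auto.
  - intros j; apply coef_bound_row; auto.
  - apply Hxy. }
assert (CVcol : forall a M, coef_bound a r M ->
  Rbar_lt (Rabs x) (CV_radius (fun i => PSeries (a i) y))).
{ intros c K Hc; apply CV_radius_bound with r (K / (1 - t)); auto.
  - intros i; apply (eval2_row_bound c r K t y i); auto.
  - apply Hxy. }
unfold eval2 at 2 3.
rewrite <- PSeries_mult; eauto.
apply PSeries_ext; intros i; unfold PS_mult.
transitivity (PSeries (fun j => sum_f_R0
  (fun k => PS_mult (a k) (b (i - k)%nat) j) i) y); [reflexivity|].
rewrite (proj2 (PSeries_sum_f_R0
  (fun k => PS_mult (a k) (b (i - k)%nat)) y i _)).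
- apply sum_eq; intros k _; apply PSeries_mult; eauto.
- intros k; apply ex_pseries_mult; eauto.
Qed.

Lemma PSeries_head (a : nat -> R) x : (forall n, a (S n) = 0) -> PSeries a x = a 0%nat.
Proof.
intros H; unfold PSeries.
rewrite (Series_ext _ (fun n => match n with O => a 0%nat | S _ => 0 end)).
- apply is_series_unique; intros P HP.
  exists 0%nat; intros n _.
  replace (sum_n _ n) with (a 0%nat); [apply locally_singleton; auto|].
  rewrite sum_n_Reals sum_f_R0_head; auto.
- intros [|n]; rewrite ?H; simpl; ring.
Qed.

Lemma eval2_one x y : eval2 one2 x y = 1.
Proof.
unfold eval2; rewrite PSeries_head; [rewrite PSeries_head; auto|].
intros n; rewrite PSeries_head; auto.
Qed.

Lemma eval2_pow u r p n x y :
  0 < r -> l1_bound u r p -> box r x y ->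
  eval2 (pow2d u n) x y = eval2 u x y ^ n.
Proof.
intros Hr Hu Hxy; induction n as [|n IH]; simpl; [apply eval2_one|].
rewrite <- IH; apply eval2_mul with r p (p ^ n); auto.
- apply l1_coef_bound; auto; lra.
- apply l1_coef_bound; [lra|apply l1_pow; auto; lra].
Qed.

Lemma eval2_abs_le a r M x y :
  0 < r -> l1_bound a r M -> box r x y -> Rabs (eval2 a x y) <= M.
Proof.
intros Hr Ha Hxy.
assert (Hc : coef_bound a r M) by (apply l1_coef_bound; auto; lra).
apply (is_lim_seq_le
  (fun n => Rabs (sum2 (fun i j => a i j * (x ^ i * y ^ j)) n)) (fun _ => M)
  (Rabs (eval2 a x y)) M).
- intros n; eapply Rle_trans; [|apply (Ha n)].
  unfold sum2; eapply Rle_trans; [apply Rsum_abs|]; apply sum_Rle; intros i _.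
  eapply Rle_trans; [apply Rsum_abs|]; apply sum_Rle; intros j _.
  rewrite !Rabs_mult; apply Rmult_le_compat_l; [apply Rabs_pos|].
  rewrite pow_add -!RPow_abs; destruct Hxy.
  apply Rmult_le_compat; try apply pow_le; try apply Rabs_pos;
    apply pow_incr; split; try apply Rabs_pos; lra.
- apply (is_lim_seq_abs _ (eval2 a x y)), eval2_lim with r M; auto.
- apply is_lim_seq_const.
Qed.

(** * Substitution of double series into a double series *)

Definition comp2_part (b u v : nat -> nat -> R) (N k l : nat) : R :=
  sum2 (fun i j => b i j * mul2 (pow2d u i) (pow2d v j) k l) N.

(** A coefficient of the composite is itself a double series in (i, j); writing it as a value of
    [eval2] at (1, 1) gives access to the limit lemmas. *)
Definition comp2 (b u v : nat -> nat -> R) (k l : nat) : R :=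
  eval2 (fun i j => b i j * mul2 (pow2d u i) (pow2d v j) k l) 1 1.

Lemma eval2_ext a b x y : (forall i j, a i j = b i j) -> eval2 a x y = eval2 b x y.
Proof. intros H; apply PSeries_ext; intros i; apply PSeries_ext; auto. Qed.

(** The norms of [u] and [v] are at most s < R0, so the summands satisfy a coefficient bound at
    radius R0 / s > 1 and the point (1, 1) lies inside the domain of convergence. *)
Lemma comp2_lim b u v R0 M r p q s k l :
  0 < r -> 0 < s < R0 -> p <= s -> q <= s -> coef_bound b R0 M ->
  l1_bound u r p -> l1_bound v r q ->
  is_lim_seq (fun N => comp2_part b u v N k l) (comp2 b u v k l).
Proof.
intros Hr Hs Hp Hq Hb Hu Hv.
set (e := fun i j => b i j * mul2 (pow2d u i) (pow2d v j) k l).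
assert (Hrk : 0 < r ^ (k + l)) by (apply pow_lt; auto).
assert (Hp0 := l1_ge_0 _ _ _ (Rlt_le _ _ Hr) Hu).
assert (Hq0 := l1_ge_0 _ _ _ (Rlt_le _ _ Hr) Hv).
assert (He : coef_bound e (R0 / s) (M * / r ^ (k + l))).
{ intros i j; unfold e.
  assert (X : Rabs (mul2 (pow2d u i) (pow2d v j) k l) * r ^ (k + l)
    <= s ^ (i + j)).
  { eapply Rle_trans.
    - apply (l1_coef_bound _ r (p ^ i * q ^ j)); [lra|].
      apply l1_mul; try apply l1_pow; auto; lra.
    - rewrite pow_add; apply Rmult_le_compat; try apply pow_le; auto;
        apply pow_incr; auto. }
  rewrite Rabs_mult.
  apply Rmult_le_reg_r with (r ^ (k + l)); auto.
  rewrite (Rmult_assoc M) Rinv_l; [|lra]; rewrite Rmult_1_r.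
  assert (Y := Hb i j).
  replace (R0 / s) with (R0 * / s) by reflexivity.
  rewrite Rpow_mult_distr pow_inv.
  assert (0 < s ^ (i + j)) by (apply pow_lt; lra).
  replace (Rabs (b i j) * Rabs (mul2 (pow2d u i) (pow2d v j) k l) *
     (R0 ^ (i + j) * / s ^ (i + j)) * r ^ (k + l))
   with ((Rabs (b i j) * R0 ^ (i + j)) *
     ((Rabs (mul2 (pow2d u i) (pow2d v j) k l) * r ^ (k + l)) * / s ^ (i + j)))
   by ring.
  rewrite <- (Rmult_1_r M); apply Rmult_le_compat; auto.
  - apply coef_term_ge_0; lra.
  - apply Rmult_le_pos; [|left; apply Rinv_0_lt_compat; auto].
    apply Rmult_le_pos; [apply Rabs_pos|lra].
  - apply Rmult_le_reg_r with (s ^ (i + j)); auto.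
    rewrite Rmult_assoc Rinv_l; lra. }
assert (HR : 1 < R0 / s).
{ apply Rmult_lt_reg_r with s; [lra|]; unfold Rdiv.
  rewrite Rmult_assoc Rinv_l; lra. }
apply is_lim_seq_ext with (sum2 (fun i j => e i j * (1 ^ i * 1 ^ j))).
- intros N; apply sum2_eq; intros i j; rewrite !pow1; unfold e; ring.
- apply eval2_lim with (R0 / s) (M * / r ^ (k + l)); auto; [lra|].
  split; rewrite Rabs_R1; auto.
Qed.

Lemma l1_zero r : l1_bound (fun _ _ => 0) r 0.
Proof.
intros n; rewrite (sum2_eq _ (fun _ _ => 0 * 0)).
- rewrite sum2_scal; lra.
- intros; rewrite Rabs_R0; ring.
Qed.

Lemma l1_sum (A : nat -> nat -> nat -> R) r m n x y :
  0 < r -> (forall i, l1_bound (A i) r (m i)) -> box r x y ->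
  l1_bound (fun k l => sum_f_R0 (fun i => A i k l) n) r (sum_f_R0 m n) /\
  eval2 (fun k l => sum_f_R0 (fun i => A i k l) n) x y =
  sum_f_R0 (fun i => eval2 (A i) x y) n.
Proof.
intros Hr HA Hxy; induction n as [|n [IH1 IH2]]; simpl; [split; auto|].
split.
- apply l1_add; auto; lra.
- rewrite <- IH2; apply eval2_add with r (sum_f_R0 m n) (m (S n)); auto;
    apply l1_coef_bound; auto; lra.
Qed.

Lemma comp2_part_spec b u v r p q N x y :
  0 < r -> l1_bound u r p -> l1_bound v r q -> box r x y ->
  l1_bound (comp2_part b u v N) r (sum2 (fun i j => Rabs (b i j) * (p ^ i * q ^ j)) N) /\
  eval2 (comp2_part b u v N) x y =
  sum2 (fun i j => b i j * (eval2 u x y ^ i * eval2 v x y ^ j)) N.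
Proof.
intros Hr Hu Hv Hxy.
assert (Hr' : 0 <= r) by lra.
set (A := fun i j => scal2 (b i j) (mul2 (pow2d u i) (pow2d v j))).
assert (HA : forall i j, l1_bound (A i j) r (Rabs (b i j) * (p ^ i * q ^ j))).
{ intros i j; apply l1_scal; auto; apply l1_mul; auto; apply l1_pow; auto. }
assert (EA : forall i j, eval2 (A i j) x y =
  b i j * (eval2 u x y ^ i * eval2 v x y ^ j)).
{ intros i j; unfold A; rewrite eval2_scal.
  rewrite (eval2_mul _ _ r (p ^ i) (q ^ j)); auto;
    try (apply l1_coef_bound; auto; apply l1_pow; auto).
  rewrite (eval2_pow u r p) //; rewrite (eval2_pow v r q) //. }
assert (Hin := fun i => l1_sum (A i) r _ N x y Hr (HA i) Hxy).
destruct (l1_sum (fun i k l => sum_f_R0 (fun j => A i j k l) N) r _ N x y Hr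
  (fun i => proj1 (Hin i)) Hxy) as [H1 H2].
split; [exact H1|].
etransitivity; [exact H2|]; apply sum_eq; intros i _.
rewrite (proj2 (Hin i)); apply sum_eq; auto.
Qed.

(** For truncations of [b] the substitution is a finite sum and commutes with evaluation; both sides
    then pass to the limit. The norm bound [B] is a parameter because the fixed point argument needs
    a sharper one than composition does. *)
Lemma comp2_spec b u v R0 M r p q s B :
  0 < r -> 0 < s < R0 -> p <= s -> q <= s -> coef_bound b R0 M ->
  l1_bound u r p -> l1_bound v r q ->
  (forall N, sum2 (fun i j => Rabs (b i j) * (p ^ i * q ^ j)) N <= B) ->
  l1_bound (comp2 b u v) r B /\
  forall x y, box r x y ->
    eval2 (comp2 b u v) x y = eval2 b (eval2 u x y) (eval2 v x y).
Proof.
intros Hr Hs Hp Hq Hb Hu Hv HB.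
assert (Hl := comp2_lim b u v R0 M r p q s).
assert (Hpart : forall N, l1_bound (comp2_part b u v N) r B).
{ intros N; apply l1_le with r (sum2 (fun i j => Rabs (b i j) * (p ^ i * q ^ j)) N);
    auto; [lra|].
  apply (comp2_part_spec b u v r p q N 0 0); auto; apply box_0; auto. }
split; [apply is_lim_seq_l1_bound with (u := comp2_part b u v); auto|].
intros x y Hxy.
assert (L1 : is_lim_seq (fun N => eval2 (comp2_part b u v N) x y)
  (eval2 (comp2 b u v) x y)).
{ apply is_lim_seq_eval2 with r B; auto; intros N; apply l1_coef_bound; auto; lra. }
assert (L2 : is_lim_seq (fun N => eval2 (comp2_part b u v N) x y)
  (eval2 b (eval2 u x y) (eval2 v x y))).
{ apply is_lim_seq_ext with
    (sum2 (fun i j => b i j * (eval2 u x y ^ i * eval2 v x y ^ j))).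
  - intros N; symmetry; apply (comp2_part_spec b u v r p q N x y); auto.
  - apply eval2_lim with R0 M; auto; [lra|]; split.
    + apply Rle_lt_trans with p; [apply eval2_abs_le with r; auto|lra].
    + apply Rle_lt_trans with q; [apply eval2_abs_le with r; auto|lra]. }
apply is_lim_seq_unique in L1; apply is_lim_seq_unique in L2.
rewrite L1 in L2; injection L2; auto.
Qed.

Lemma eval2_0_0 a : eval2 a 0 0 = a 0%nat 0%nat.
Proof. unfold eval2; rewrite !PSeries_0; reflexivity. Qed.

Lemma analytic_small_l1 f e :
  analytic_germ2 f -> f 0 0 = 0 -> 0 < e ->
  exists a r, 0 < r /\ (forall r', 0 < r' <= r -> l1_bound a r' e) /\
    forall x y, box r x y -> f x y = eval2 a x y.
Proof.
intros [a [M [r [Hr [Ha E]]]]] H0 He; apply near_box in E.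
destruct E as [d [Hd E]].
assert (Ha0 : a 0%nat 0%nat = 0).
{ rewrite <- eval2_0_0; transitivity (f 0 0); [|exact H0].
  symmetry; apply (E 0 0), box_0; auto. }
assert (H1 : l1_bound a (/ 2 * r) (M * (/ (1 - / 2) * / (1 - / 2))))
  by (apply coef_bound_l1; auto; lra).
set (K := M * (/ (1 - / 2) * / (1 - / 2))) in *.
assert (HK : 0 <= K) by (apply (l1_ge_0 a (/ 2 * r)); auto; lra).
set (t := Rmin 1 (e / (K + 1))).
assert (Ht : 0 < t) by (apply Rmin_pos; [lra|apply Rdiv_lt_0_compat; lra]).
assert (Ht1 : t <= 1) by apply Rmin_l.
assert (HtK : t * K <= e).
{ apply Rle_trans with (e / (K + 1) * (K + 1)); [|right; field; lra].
  assert (t <= e / (K + 1)) by apply Rmin_r; nra. }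
assert (Hb := l1_shrink a (/ 2 * r) K t ltac:(lra) ltac:(lra) Ha0 H1).
assert (Hq : 0 < Rmin d (t * (/ 2 * r)))
  by (apply Rmin_pos; auto; apply Rmult_lt_0_compat; lra).
exists a, (Rmin d (t * (/ 2 * r))); split; [auto|split].
- intros r' Hr'; apply l1_le with (2 := HtK) (3 := Hb).
  pose proof (Rmin_r d (t * (/ 2 * r))); lra.
- intros x y Hxy; apply E, box_le with (2 := Hxy), Rmin_l.
Qed.

Lemma analytic_germ2_comp f u v :
  analytic_germ2 f -> analytic_germ2 u -> analytic_germ2 v ->
  u 0 0 = 0 -> v 0 0 = 0 -> analytic_germ2 (fun x y => f (u x y) (v x y)).
Proof.
intros [b [M [R0 [HR [Hb Ef]]]]] Hu Hv Hu0 Hv0; apply near_box in Ef.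
destruct Ef as [d [Hd Ef]].
(* The norms of the inner series stay below [R0] for convergence and below [d] so that their values
   lie where [f] equals its series. *)
set (s := Rmin d R0 / 2).
assert (Hm : 0 < Rmin d R0) by (apply Rmin_pos; auto).
assert (Hs : 0 < s < R0 /\ s < d).
{ pose proof (Rmin_l d R0); pose proof (Rmin_r d R0); unfold s; lra. }
destruct (analytic_small_l1 u s) as [a1 [r1 [Hr1 [L1 E1]]]]; auto; [lra|].
destruct (analytic_small_l1 v s) as [a2 [r2 [Hr2 [L2 E2]]]]; auto; [lra|].
set (r := Rmin r1 r2).
assert (Hr : 0 < r) by (apply Rmin_pos; auto).
assert (Hle : r <= r1 /\ r <= r2) by (split; [apply Rmin_l|apply Rmin_r]).
assert (H1 : l1_bound a1 r s) by (apply L1; lra).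
assert (H2 : l1_bound a2 r s) by (apply L2; lra).
set (t := s / R0).
assert (Et : s = t * R0) by (unfold t; field; lra).
assert (Ht : 0 <= t < 1) by nra.
assert (HB : forall N, sum2 (fun i j => Rabs (b i j) * (s ^ i * s ^ j)) N
  <= M * (/ (1 - t) * / (1 - t))).
{ intros N; eapply Rle_trans; [|apply (coef_bound_l1 b R0 M t HR Ht Hb N)].
  apply sum2_le; intros i j; rewrite -pow_add -Et; lra. }
destruct (comp2_spec b a1 a2 R0 M r s s s _ Hr (proj1 Hs) (Rle_refl s)
  (Rle_refl s) Hb H1 H2 HB) as [Hc Ec].
exists (comp2 b a1 a2), (M * (/ (1 - t) * / (1 - t))), r; split; [exact Hr|split].
- apply l1_coef_bound; auto; lra.
- apply near_box; exists r; split; auto; intros x y Hxy.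
  rewrite E1; [|apply box_le with r; auto; tauto].
  rewrite E2; [|apply box_le with r; auto; tauto].
  change (f (eval2 a1 x y) (eval2 a2 x y) = eval2 (comp2 b a1 a2) x y).
  rewrite Ec //.
  apply Ef; split; eapply Rle_lt_trans; try (apply eval2_abs_le with r; eauto);
    lra.
Qed.

(** * Analytic inverse functions with a parameter *)

Definition var_x (i j : nat) : R := match i, j with 1%nat, O => 1 | _, _ => 0 end.
Definition var_y (i j : nat) : R := match i, j with O, 1%nat => 1 | _, _ => 0 end.

Lemma eval2_var_x x y : eval2 var_x x y = x.
Proof.
unfold eval2; rewrite (PSeries_ext _ (PS_incr_1 (fun i => one2 i 0))).
- rewrite PSeries_incr_1 PSeries_head; simpl; auto; ring.
- intros [|[|i]]; rewrite PSeries_head; auto; intros [|j]; auto.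
Qed.

Lemma eval2_var_y x y : eval2 var_y x y = y.
Proof.
unfold eval2; rewrite PSeries_head.
- rewrite (PSeries_ext _ (PS_incr_1 (one2 0))).
  + rewrite PSeries_incr_1 PSeries_head; simpl; auto; ring.
  + intros [|[|j]]; auto.
- intros i; rewrite PSeries_head; auto; intros [|j]; auto.
Qed.

Lemma l1_var_x r : 0 <= r -> l1_bound var_x r r.
Proof.
intros Hr n; rewrite (sum2_eq _
  (fun i j => match i with 1%nat => r | _ => 0 end * match j with O => 1 | _ => 0 end)).
- rewrite sum2_prod (sum_f_R0_head (fun j => match j with O => 1 | _ => 0 end));
    [|auto].
  rewrite Rmult_1_r; destruct n as [|n]; [simpl; lra|].
  rewrite decomp_sum; [|lia]; rewrite sum_f_R0_head; [lra|auto].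
- intros [|[|i]] [|j]; simpl; rewrite ?Rabs_R0 ?Rabs_R1; ring.
Qed.

Lemma l1_var_y r : 0 <= r -> l1_bound var_y r r.
Proof.
intros Hr n; eapply Rle_trans; [|apply (l1_var_x r Hr n)].
unfold sum2; rewrite sum_f_R0_swap; right.
apply sum_eq; intros i _; apply sum_eq; intros j _; rewrite Nat.add_comm.
destruct i as [|[|i]]; destruct j as [|[|j]]; reflexivity.
Qed.

(** Congruence modulo the n-th power of the maximal ideal. *)
Definition agree2 (n : nat) (u v : nat -> nat -> R) : Prop :=
  forall k l, (k + l < n)%nat -> u k l = v k l.

Lemma agree2_refl n u : agree2 n u u.
Proof. intros k l _; reflexivity. Qed.

Lemma agree2_mul n u u' w w' :
  agree2 n u u' -> agree2 n w w' -> agree2 n (mul2 u w) (mul2 u' w').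
Proof.
intros Hu Hw k l Hkl; apply sum_eq; intros i Hi; apply sum_eq; intros j Hj.
rewrite Hu; [|lia]; rewrite Hw; [reflexivity|lia].
Qed.

(** When neither factor has a constant term, a coefficient of degree n of the product involves only
    coefficients of degree below n. *)
Lemma agree2_mul_S n u u' w w' :
  agree2 n u u' -> agree2 n w w' -> u 0%nat 0%nat = 0 -> u' 0%nat 0%nat = 0 ->
  w 0%nat 0%nat = 0 -> w' 0%nat 0%nat = 0 ->
  agree2 (S n) (mul2 u w) (mul2 u' w').
Proof.
intros Hu Hw Hu0 Hu0' Hw0 Hw0' k l Hkl.
apply sum_eq; intros i Hi; apply sum_eq; intros j Hj.
destruct (Nat.eq_dec (i + j) 0) as [E|E].
- replace i with 0%nat by lia; replace j with 0%nat by lia.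
  rewrite Hu0 Hu0'; ring.
- destruct (Nat.eq_dec (k - i + (l - j)) 0) as [E'|E'].
  + replace (k - i)%nat with 0%nat by lia; replace (l - j)%nat with 0%nat by lia.
    rewrite Hw0 Hw0'; ring.
  + rewrite Hu; [|lia]; rewrite Hw; [reflexivity|lia].
Qed.

Lemma mul2_0_0 u v : mul2 u v 0 0 = u 0%nat 0%nat * v 0%nat 0%nat.
Proof. reflexivity. Qed.

Lemma pow2d_S_0_0 u n : u 0%nat 0%nat = 0 -> pow2d u (S n) 0 0 = 0.
Proof. intros H; simpl; rewrite mul2_0_0 H; ring. Qed.

Lemma agree2_pow n u u' i :
  agree2 n u u' -> agree2 n (pow2d u i) (pow2d u' i).
Proof.
intros H; induction i as [|i IH]; simpl; [apply agree2_refl|].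
apply agree2_mul; auto.
Qed.

(* As b(x, y) contains no multiple of x alone, substituting u for x gains one order of
   precision; this makes the fixed point iteration stabilise degreewise. *)
Lemma agree2_comp n b u u' v :
  b 1%nat 0%nat = 0 -> u 0%nat 0%nat = 0 -> u' 0%nat 0%nat = 0 ->
  v 0%nat 0%nat = 0 -> agree2 n u u' ->
  agree2 (S n) (comp2 b u v) (comp2 b u' v).
Proof.
intros Hb Hu Hu' Hv H k l Hkl; apply eval2_ext; intros i j.
destruct i as [|[|i]]; [reflexivity| |].
- destruct j as [|j]; [rewrite Hb; ring|f_equal].
  apply (agree2_mul_S n); auto; try apply pow2d_S_0_0; auto;
    try (apply (pow2d_S_0_0 _ 0); auto).
  + apply (agree2_pow n u u' 1 H).
  + apply agree2_refl.
- f_equal; apply (agree2_mul (S n)); auto; [|apply agree2_refl].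
  apply (agree2_mul_S n u u' (pow2d u (S i)) (pow2d u' (S i))); auto;
    try (apply pow2d_S_0_0; auto).
  apply (agree2_pow n u u' (S i) H).
Qed.

Lemma comp2_0_0 b u v :
  b 0%nat 0%nat = 0 -> u 0%nat 0%nat = 0 -> v 0%nat 0%nat = 0 ->
  comp2 b u v 0 0 = 0.
Proof.
intros Hb Hu Hv; unfold comp2.
rewrite (eval2_ext _ (scal2 0 one2)); [rewrite eval2_scal; ring|].
intros i j; rewrite mul2_0_0; unfold scal2.
destruct i as [|i]; [destruct j as [|j]; [rewrite Hb; ring|]|].
- rewrite (pow2d_S_0_0 v); auto; ring.
- rewrite (pow2d_S_0_0 u); auto; ring.
Qed.

(** Iteration of G -> c t + b(G, s) from 0. Two facts replace a contraction estimate: the iterates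
    stabilise degree by degree, and they share one l1 bound, which suffices for their values to
    converge. *)
Lemma fixed_point_analytic b c R0 M :
  0 < R0 -> coef_bound b R0 M -> b 0%nat 0%nat = 0 -> b 1%nat 0%nat = 0 ->
  exists g r B, 0 < r /\ B < R0 /\ l1_bound g r B /\ r <= R0 /\
    g 0%nat 0%nat = 0 /\
    forall t s, box r t s -> eval2 g t s = c * t + eval2 b (eval2 g t s) s.
Proof.
intros HR Hb Hb0 Hb1.
set (p := / 2 * R0); assert (Hp : 0 < p < R0) by (unfold p; lra).
assert (HC1 := coef_bound_l1 b R0 M (/ 2) HR ltac:(lra) Hb); fold p in HC1.
set (C := M * (/ (1 - / 2) * / (1 - / 2))) in HC1.
assert (HC0 : 0 <= C) by (apply (l1_ge_0 b p); auto; lra).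
(* The iterates will have norm at most de = x p at radius r = y p, which requires |c| r + (x^2 + y)
   C <= de. The choice of [x] gives x^2 C <= x p / 2, that of [y] gives |c| y p + y C <= x p / 2. *)
set (x := Rmin 1 (p / 2 / (C + 1))).
assert (Hx : 0 < x <= 1).
{ split; [apply Rmin_pos; [lra|apply Rdiv_lt_0_compat; lra]|apply Rmin_l]. }
assert (HxC : x * (C + 1) <= p / 2)
  by (apply Rle_div_r; [lra|apply Rmin_r]).
set (K := Rabs c * p + C + 1).
assert (HK : 0 < K) by (pose proof (Rabs_pos c); unfold K; nra).
set (y := Rmin 1 (x * p / 2 / K)).
assert (Hy : 0 < y <= 1).
{ split; [apply Rmin_pos; [lra|apply Rdiv_lt_0_compat; nra]|apply Rmin_l]. }
assert (HyK : y * K <= x * p / 2) by (apply Rle_div_r; [lra|apply Rmin_r]).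
set (r := y * p); set (de := x * p).
assert (Hr : 0 < r) by (unfold r; nra); assert (Hrp : r <= p) by (unfold r; nra).
assert (Hde : 0 < de <= p) by (unfold de; nra).
(* A monomial occurring in [b] has degree at least 2 in the first variable or at least 1 in the
   second, so passing from weights (p, p) to (x p, y p) brings a factor of at most x^2 + y. *)
set (B := (x ^ 2 + y) * C).
assert (HB : forall N, sum2 (fun i j => Rabs (b i j) * (de ^ i * r ^ j)) N <= B).
{ intros N; apply Rle_trans with ((x ^ 2 + y) *
    sum2 (fun i j => Rabs (b i j) * p ^ (i + j)) N).
  - rewrite -sum2_scal; apply sum2_le; intros i j.
    unfold de, r; rewrite (Rpow_mult_distr x) (Rpow_mult_distr y) pow_add.
    replace (Rabs (b i j) * (x ^ i * p ^ i * (y ^ j * p ^ j)))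
      with (x ^ i * y ^ j * (Rabs (b i j) * (p ^ i * p ^ j))) by ring.
    assert (X : 0 <= Rabs (b i j) * (p ^ i * p ^ j))
      by (rewrite -pow_add; apply coef_term_ge_0; lra).
    assert (H1 : forall z k, 0 < z <= 1 -> 0 <= z ^ k <= 1).
    { intros z k Hz; split; [apply pow_le; lra|].
      rewrite <- (pow1 k); apply pow_incr; lra. }
    assert (X1 := H1 x i Hx); assert (Y1 := H1 y j Hy).
    destruct j as [|j]; [destruct i as [|[|i]]|].
    + rewrite Hb0 Rabs_R0; lra.
    + rewrite Hb1 Rabs_R0; lra.
    + apply Rmult_le_compat_r; auto; assert (X2 := H1 x i Hx); simpl; nra.
    + apply Rmult_le_compat_r; auto; assert (Y2 := H1 y j Hy).
      simpl pow; assert (0 <= y * y ^ j <= y) by nra; nra.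
  - apply Rmult_le_compat_l; [nra|apply HC1]. }
assert (HBde : Rabs c * r + B <= de).
{ unfold B, r, de, K in *; pose proof (Rabs_pos c); nra. }
set (T := fun G => add2 (scal2 c var_x) (comp2 b G var_y)).
set (G := fun n => Nat.iter n T (fun _ _ => 0)).
assert (HC : forall u, l1_bound u r de -> l1_bound (comp2 b u var_y) r B /\
  forall x y, box r x y ->
    eval2 (comp2 b u var_y) x y = eval2 b (eval2 u x y) (eval2 var_y x y)).
{ intros u Hu; apply (comp2_spec b u var_y R0 M r de r p); auto; try lra.
  apply l1_var_y; lra. }
assert (HG1 : forall n, l1_bound (G n) r de).
{ induction n as [|n IH]; simpl.
  - apply l1_le with r 0; [lra|lra|apply l1_zero].
  - apply l1_le with r (Rabs c * r + B); [lra|exact HBde|].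
    apply l1_add; [lra|apply l1_scal; [lra|apply l1_var_x; lra]|].
    apply HC, IH. }
assert (HG0 : forall n, G n 0%nat 0%nat = 0).
{ induction n as [|n IH]; simpl; auto.
  unfold T, add2; rewrite comp2_0_0; auto.
  unfold scal2; simpl; ring. }
assert (Hag : forall n, agree2 n (G n) (G (S n))).
{ induction n as [|n IH]; [intros k l Hkl; lia|].
  intros k l Hkl; change (T (G n) k l = T (G (S n)) k l); unfold T, add2; f_equal.
  apply (agree2_comp n); auto. }
(* Coefficients of total degree k + l are final after k + l + 1 iterations. *)
set (g := fun k l => G (S (k + l)) k l).
assert (Hlim : forall k l, is_lim_seq (fun N => G N k l) (g k l)).
{ intros k l; apply is_lim_seq_ext_loc with (fun _ => g k l);
    [|apply is_lim_seq_const].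
  exists (S (k + l)); intros n Hn; unfold g.
  induction Hn as [|n Hn IH]; auto.
  rewrite IH; apply Hag; lia. }
assert (Hg : l1_bound g r de).
{ apply is_lim_seq_l1_bound with (u := G); auto. }
exists g, r, de; split; [auto|split; [lra|split; [auto|split; [lra|split; [apply HG0|]]]]].
intros t s Hts.
assert (HGe : forall n, eval2 (G (S n)) t s = c * t + eval2 b (eval2 (G n) t s) s).
{ intros n; simpl.
  transitivity (eval2 (scal2 c var_x) t s + eval2 (comp2 b (G n) var_y) t s).
  - apply eval2_add with r (Rabs c * r) B; auto.
    + apply l1_coef_bound; [lra|]; apply l1_scal; [lra|apply l1_var_x; lra].
    + apply l1_coef_bound; [lra|].
      apply HC, HG1.
  - rewrite eval2_scal eval2_var_x; f_equal.
    rewrite (proj2 (HC _ (HG1 n))); auto; rewrite eval2_var_y; reflexivity. }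
assert (L1 : is_lim_seq (fun n => eval2 (G n) t s) (eval2 g t s)).
{ apply is_lim_seq_eval2 with r de; auto; intros n; apply l1_coef_bound; auto; lra. }
assert (L2 : is_lim_seq (fun n => eval2 (G (S n)) t s)
  (c * t + eval2 b (eval2 g t s) s)).
{ apply is_lim_seq_ext with (fun n => c * t + eval2 b (eval2 (G n) t s) s).
  - intros n; symmetry; apply HGe.
  - apply is_lim_seq_plus'; [apply is_lim_seq_const|].
    apply (is_lim_seq_continuous (fun z => eval2 b z s)); auto.
    apply continuity_pt_filterlim, continuity_2d_slice_x.
    apply continuity_2d_pt_eval2 with R0 M; auto; split.
    + apply Rle_lt_trans with de; [apply eval2_abs_le with r; auto|lra].
    + destruct Hts; lra. }
apply is_lim_seq_incr_1 in L1.
apply is_lim_seq_unique in L1; apply is_lim_seq_unique in L2.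
rewrite L1 in L2; injection L2; auto.
Qed.

Lemma inverse_param_analytic F :
  analytic_germ2 F -> F 0 0 = 0 -> Derive (fun x => F x 0) 0 <> 0 ->
  exists G, analytic_germ2 G /\ G 0 0 = 0 /\ near (fun t s => F (G t s) s = t).
Proof.
intros HF HF0 Hd0; apply analytic_germ2_on in HF.
destruct HF as [r [Hr [a [Ha E]]]].
assert (Ha0 : a 0%nat 0%nat = 0).
{ rewrite <- eval2_0_0, <- E; auto; apply box_0; auto. }
assert (Ed : Derive (fun x => F x 0) 0 = a 1%nat 0%nat).
{ apply is_derive_unique, is_derive_ext_loc with (fun x => eval2 a x 0).
  - apply filter_imp with
      (2 := open2_slice_x _ _ _ (open2_box r) (box_0 r Hr)).
    intros t Ht; symmetry; apply E, Ht.
  - replace (a 1%nat 0%nat) with (eval2 (coef_dx a) 0 0).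
    + apply is_derive_eval2_x with r; auto; apply box_0; auto.
    + rewrite eval2_0_0; unfold coef_dx; simpl; ring. }
rewrite Ed in Hd0; set (d := a 1%nat 0%nat) in *.
destruct (Ha (r / 2)) as [M HM]; [lra|].
(* F = d x - d b(x, s), so F(x, s) = t reads x = t / d + b(x, s), where [b] has neither a constant
   term nor a term linear in x alone. *)
set (b := fun i j => match i, j with 1%nat, O => 0 | _, _ => - / d * a i j end).
assert (Hb : coef_bound b (r / 2) (Rabs (/ d) * M)).
{ intros i j.
  apply Rle_trans with (Rabs (/ d) * (Rabs (a i j) * (r / 2) ^ (i + j))).
  - rewrite <- Rmult_assoc; apply Rmult_le_compat_r; [apply pow_le; lra|].
    assert (X : Rabs (- / d * a i j) <= Rabs (/ d) * Rabs (a i j))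
      by (rewrite Rabs_mult Rabs_Ropp; lra).
    assert (Y : Rabs 0 <= Rabs (/ d) * Rabs (a i j)).
    { rewrite Rabs_R0; apply Rmult_le_pos; apply Rabs_pos. }
    unfold b; destruct i as [|[|i]]; auto; destruct j; auto.
  - apply Rmult_le_compat_l; [apply Rabs_pos|apply HM]. }
destruct (fixed_point_analytic b (/ d) (r / 2) _ ltac:(lra) Hb)
  as [g [p [B [Hp [HB [Hg [Hpr [Hg0 Eg]]]]]]]].
{ unfold b; rewrite Ha0; ring. }
{ reflexivity. }
assert (Hbox : forall t s, box p t s -> box (r / 2) (eval2 g t s) s).
{ intros t s Hts; split.
  - eapply Rle_lt_trans; [apply eval2_abs_le with p; eauto|exact HB].
  - destruct Hts; lra. }
assert (HFg : forall t s, box p t s -> F (eval2 g t s) s = t).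
{ intros t s Hts; assert (Hb2 := Hbox t s Hts).
  rewrite E; [|apply box_le with (2 := Hb2); lra].
  set (z := eval2 g t s) in *.
  rewrite (eval2_ext a (add2 (scal2 (- d) b) (scal2 d var_x))).
  - rewrite (eval2_add _ _ (r / 2) (Rabs (- d) * (Rabs (/ d) * M)) (Rabs d * (r / 2)));
      auto; [|lra| |].
    + rewrite !eval2_scal eval2_var_x.
      assert (X := Eg t s Hts); fold z in X.
      assert (Y : eval2 b z s = z - / d * t) by lra.
      rewrite Y; field; auto.
    + intros i j; unfold scal2; rewrite Rabs_mult Rmult_assoc.
      apply Rmult_le_compat_l; [apply Rabs_pos|apply Hb].
    + apply l1_coef_bound; [lra|]; apply l1_scal; [lra|apply l1_var_x; lra].
  - intros i j; unfold add2, scal2, b, var_x.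
    destruct i as [|[|i]]; [field; auto| |field; auto].
    destruct j as [|j]; [fold d; ring|field; auto]. }
exists (eval2 g); split; [|split].
- exists g, B, p; split; [auto|split].
  + apply l1_coef_bound; auto; lra.
  + exists (mkposreal 1 Rlt_0_1); auto.
- rewrite eval2_0_0; exact Hg0.
- apply near_box; exists p; auto.
Qed.

(** * Germs in either category *)

Lemma locally_0_Rabs (P : R -> Prop) :
  locally 0 P <-> exists r, 0 < r /\ forall y, Rabs y < r -> P y.
Proof.
split.
- intros [d Hd]; exists d; split; [apply cond_pos|].
  intros y Hy; apply Hd; change (Rabs (y - 0) < d); rewrite Rminus_0_r; auto.
- intros [r [Hr H]]; apply locally_Rabs with r; auto; rewrite Rabs_R0; auto.
Qed.

Lemma near_of_locally_x (P : R -> Prop) : locally 0 P -> near (fun x _ => P x).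
Proof.
rewrite locally_0_Rabs near_box; intros [r [Hr H]]; exists r; split; auto.
intros x y [Hx _]; auto.
Qed.

Lemma near_of_locally_y (P : R -> Prop) : locally 0 P -> near (fun _ y => P y).
Proof. intros H; apply (near_swap (fun x _ => P x)), near_of_locally_x, H. Qed.

Lemma locally_of_near_x (P : R -> R -> Prop) : near P -> locally 0 (fun x => P x 0).
Proof. apply locally_2d_1d_const_y. Qed.

Lemma locally_of_near_y (P : R -> R -> Prop) : near P -> locally 0 (fun y => P 0 y).
Proof. apply locally_2d_1d_const_x. Qed.

Lemma smooth_germ2_of_Cn f : (forall n U, Cn n U f) -> smooth_germ2 f.
Proof. intros H; apply smooth_germ2_Cn; exists 1; split; auto; lra. Qed.

Lemma CV_radius_pos_bound (a : nat -> R) :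
  Rbar_lt 0 (CV_radius a) ->
  exists r M, 0 < r /\ forall n, Rabs (a n) * r ^ n <= M.
Proof.
intros H; apply NNPP; intros Hn.
apply (Rbar_le_not_lt 0 (CV_radius a)); auto.
apply (proj2 (CV_radius_bounded a)); intros r [M HM]; simpl.
destruct (Rle_lt_dec r 0) as [Hr|Hr]; auto.
exfalso; apply Hn; exists r, M; split; auto; intros n.
specialize (HM n); rewrite Rabs_mult (Rabs_pos_eq (r ^ n)) in HM; auto.
apply pow_le; lra.
Qed.

Lemma CV_radius_pos_of_bound (a : nat -> R) r M :
  0 < r -> (forall n, Rabs (a n) * r ^ n <= M) -> Rbar_lt 0 (CV_radius a).
Proof.
intros Hr H; rewrite <- Rabs_R0; apply CV_radius_bound with r M; auto.
rewrite Rabs_R0; auto.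
Qed.

Lemma analytic_germ1_germ2 g :
  analytic_germ1 g <-> analytic_germ2 (fun _ y => g y).
Proof.
split.
- intros [a [Ha E]]; destruct (CV_radius_pos_bound a Ha) as [r [M [Hr HM]]].
  exists (fun i j => match i with O => a j | S _ => 0 end), M, r.
  split; [auto|split].
  + intros [|i] j; [apply HM|]; rewrite Rabs_R0 Rmult_0_l.
    eapply Rle_trans; [|apply (HM 0%nat)].
    apply coef_term_ge_0; lra.
  + apply near_mono with (1 := near_of_locally_y _ E); intros x y ->.
    symmetry; apply (PSeries_head (fun i => PSeries
      (fun j => match i with O => a j | S _ => 0 end) y)).
    intros i; apply PSeries_head; auto.
- intros [a [M [r [Hr [Ha E]]]]]; exists (a 0%nat); split.
  + apply CV_radius_pos_of_bound with r M; auto; intros j; apply (Ha 0%nat j).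
  + apply filter_imp with (2 := locally_of_near_y _ E); intros y Hy.
    rewrite Hy PSeries_0; auto.
Qed.

Lemma smooth_germ1_germ2 g : smooth_germ1 g <-> smooth_germ2 (fun _ y => g y).
Proof.
rewrite smooth_germ1_smooth1 smooth_germ2_Cn; split; intros [r [Hr H]];
  exists r; split; auto.
- intros n; apply Cn_comp with (V := box r) (f := fun x _ => g x)
    (u := fun _ y => y) (v := fun x _ => x); try apply open2_box.
  + intros x y; apply box_swap.
  + apply smooth1_Cn, H.
  + apply Cn_snd.
  + apply Cn_fst.
- apply smooth1_Cn; intros n; apply Cn_comp with (V := box r) (f := fun _ y => g y)
    (u := fun _ y => y) (v := fun x _ => x); try apply open2_box; auto.
  + intros x y; apply box_swap.
  + apply Cn_snd.
  + apply Cn_fst.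
Qed.

(** The coefficients are split by the parity of their index; in the variable u^2 the radius becomes
    r^2. *)
Lemma even_odd_analytic T :
  analytic_germ1 T -> exists A B, analytic_germ1 A /\ analytic_germ1 B /\
    locally 0 (fun u => T u = A (u ^ 2) + u * B (u ^ 2)).
Proof.
intros [a [Ha E]]; destruct (CV_radius_pos_bound a Ha) as [r [M [Hr HM]]].
assert (Hr2 : 0 < r ^ 2) by (apply pow_lt; auto).
set (b := fun n => a (2 * n)%nat); set (c := fun n => a (2 * n + 1)%nat).
assert (Hb : forall n, Rabs (b n) * (r ^ 2) ^ n <= M)
  by (intros n; rewrite -pow_mult; apply HM).
assert (Hc : forall n, Rabs (c n) * (r ^ 2) ^ n <= M / r).
{ intros n; apply Rmult_le_reg_r with r; auto.
  unfold Rdiv; rewrite (Rmult_assoc M) Rinv_l; [|lra]; rewrite Rmult_1_r.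
  eapply Rle_trans; [|apply (HM (2 * n + 1)%nat)].
  right; unfold c; rewrite -pow_mult pow_add; ring. }
exists (PSeries b), (PSeries c); split; [|split].
- exists b; split; [apply CV_radius_pos_of_bound with (r ^ 2) M; auto|].
  apply filter_forall; auto.
- exists c; split; [apply CV_radius_pos_of_bound with (r ^ 2) (M / r); auto|].
  apply filter_forall; auto.
- apply locally_0_Rabs in E; destruct E as [e [He E]].
  apply locally_0_Rabs; exists (Rmin e r); split; [apply Rmin_pos; auto|].
  intros u Hu; destruct (Rlt_Rmin _ _ _ Hu) as [U1 U2].
  assert (Hu2 : Rabs (u ^ 2) < r ^ 2).
  { rewrite -RPow_abs; pose proof (Rabs_pos u); nra. }
  rewrite E; auto; apply PSeries_odd_even; apply CV_radius_inside.
  + apply CV_radius_bound with (r ^ 2) M; auto.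
  + apply CV_radius_bound with (r ^ 2) (M / r); auto.
Qed.

Lemma analytic_germ2_l1 f g :
  analytic_germ2 f -> analytic_germ2 g -> exists a b r M N, 0 < r /\
    l1_bound a r M /\ l1_bound b r N /\
    forall x y, box r x y -> f x y = eval2 a x y /\ g x y = eval2 b x y.
Proof.
rewrite !analytic_germ2_on; intros [p [Hp Hf]] [q [Hq Hg]].
set (r := Rmin p q); assert (Hr : 0 < r) by (apply Rmin_pos; auto).
destruct (analytic_on_le _ r _ (Rmin_l p q) Hf) as [a [Ha Ea]].
destruct (analytic_on_le _ r _ (Rmin_r p q) Hg) as [b [Hb Eb]].
destruct (Ha (r / 2) ltac:(lra)) as [M HM].
destruct (Hb (r / 2) ltac:(lra)) as [N HN].
exists a, b, (/ 2 * (r / 2)), (M * (/ (1 - / 2) * / (1 - / 2))),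
  (N * (/ (1 - / 2) * / (1 - / 2))); split; [lra|split; [|split]].
- apply coef_bound_l1; auto; lra.
- apply coef_bound_l1; auto; lra.
- intros x y Hxy; split; [apply Ea|apply Eb]; apply box_le with (2 := Hxy); lra.
Qed.

Lemma analytic_germ2_of_l1 f a r M :
  0 < r -> l1_bound a r M -> (forall x y, box r x y -> f x y = eval2 a x y) ->
  analytic_germ2 f.
Proof.
intros Hr Ha E; exists a, M, r; split; [auto|split].
- apply l1_coef_bound; auto; lra.
- apply near_box; exists r; auto.
Qed.

Lemma germ2_ext k f g :
  near (fun x y => f x y = g x y) -> germ2 k f -> germ2 k g.
Proof.
destruct k; simpl.
- intros E Hf; apply near_near in E; unfold smooth_germ2 in *.
  apply near_mono with (1 := near_and _ _ E Hf); intros x y [H1 H2] n.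
  apply ex_diff_n_ext_loc with f; auto.
- intros E [a [M [r [Hr [Ha Ea]]]]]; exists a, M, r; split; [auto|split; auto].
  apply near_mono with (1 := near_and _ _ E Ea); intros x y [<- H]; exact H.
Qed.

(** * Operations on germs, uniformly in the category *)

Lemma germ2_const k c : germ2 k (fun _ _ => c).
Proof.
destruct k; simpl.
- apply smooth_germ2_of_Cn; intros; apply Cn_const.
- apply (analytic_germ2_of_l1 _ (scal2 c one2) 1 (Rabs c * 1)); [lra| |].
  + apply l1_scal; [lra|apply l1_one].
  + intros x y _; rewrite eval2_scal eval2_one; ring.
Qed.

Lemma germ2_fst k : germ2 k (fun x _ => x).
Proof.
destruct k; simpl.
- apply smooth_germ2_of_Cn; intros; apply Cn_fst.
- apply (analytic_germ2_of_l1 _ var_x 1 1); [lra|apply l1_var_x; lra|].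
  intros x y _; rewrite eval2_var_x; reflexivity.
Qed.

Lemma germ2_snd k : germ2 k (fun _ y => y).
Proof.
destruct k; simpl.
- apply smooth_germ2_of_Cn; intros; apply Cn_snd.
- apply (analytic_germ2_of_l1 _ var_y 1 1); [lra|apply l1_var_y; lra|].
  intros x y _; rewrite eval2_var_y; reflexivity.
Qed.

Lemma germ2_comp k f u v :
  germ2 k f -> germ2 k u -> germ2 k v -> u 0 0 = 0 -> v 0 0 = 0 ->
  germ2 k (fun x y => f (u x y) (v x y)).
Proof.
destruct k; [apply smooth_germ2_comp|apply analytic_germ2_comp].
Qed.

Lemma germ2_plus k f g :
  germ2 k f -> germ2 k g -> germ2 k (fun x y => f x y + g x y).
Proof.
destruct k; simpl.
- intros Hf Hg; destruct (smooth_germ2_common_box f g Hf Hg) as [r [Hr [Cf Cg]]].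
  apply smooth_germ2_Cn; exists r; split; auto; intros n; apply Cn_plus; auto.
- intros Hf Hg; destruct (analytic_germ2_l1 f g Hf Hg)
    as [a [b [r [M [N [Hr [Ha [Hb E]]]]]]]].
  apply (analytic_germ2_of_l1 _ (add2 a b) r (M + N)); auto.
  + apply l1_add; auto; lra.
  + intros x y Hxy; destruct (E x y Hxy) as [-> ->]; symmetry.
    apply eval2_add with r M N; auto; apply l1_coef_bound; auto; lra.
Qed.

Lemma germ2_mult k f g :
  germ2 k f -> germ2 k g -> germ2 k (fun x y => f x y * g x y).
Proof.
destruct k; simpl.
- intros Hf Hg; destruct (smooth_germ2_common_box f g Hf Hg) as [r [Hr [Cf Cg]]].
  apply smooth_germ2_Cn; exists r; split; auto; intros n; apply Cn_mult; auto.
- intros Hf Hg; destruct (analytic_germ2_l1 f g Hf Hg)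
    as [a [b [r [M [N [Hr [Ha [Hb E]]]]]]]].
  apply (analytic_germ2_of_l1 _ (mul2 a b) r (M * N)); auto.
  + apply l1_mul; auto; lra.
  + intros x y Hxy; destruct (E x y Hxy) as [-> ->]; symmetry.
    apply eval2_mul with r M N; auto; apply l1_coef_bound; auto; lra.
Qed.

Lemma germ2_smooth k f : germ2 k f -> smooth_germ2 f.
Proof. destruct k; simpl; [auto|apply analytic_germ2_smooth]. Qed.

Lemma germ2_dx k f : germ2 k f -> germ2 k (fun x y => Derive (fun t => f t y) x).
Proof.
destruct k; simpl; [|apply analytic_germ2_dx].
intros H; destruct (smooth_germ2_partials f H)
  as [r [fx [fy [Hr [_ [Cx [_ [Hx _]]]]]]]].
apply (germ2_ext Smooth fx); [|apply smooth_germ2_Cn; exists r; auto].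
apply near_box; exists r; split; auto; intros x y Hxy; symmetry.
apply is_derive_unique; auto.
Qed.

Lemma germ2_swap k f : germ2 k f -> germ2 k (fun x y => f y x).
Proof.
intros H; apply (germ2_comp k f (fun _ y => y) (fun x _ => x)); auto;
  [apply germ2_snd|apply germ2_fst].
Qed.

Lemma germ2_dy k f : germ2 k f -> germ2 k (fun x y => Derive (fun t => f x t) y).
Proof.
intros H; apply (germ2_swap k (fun x y => Derive (fun t => f y t) x)).
apply (germ2_dx k (fun x y => f y x)), germ2_swap, H.
Qed.

Lemma germ2_primitive k w :
  germ2 k w -> exists q, germ2 k q /\
    near (fun x y => is_derive (fun z => z * q z y) x (w x y)).
Proof. destruct k; [apply primitive_smooth|apply primitive_analytic]. Qed.

Lemma germ1_germ2 k g : germ1 k g <-> germ2 k (fun _ y => g y).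
Proof. destruct k; [apply smooth_germ1_germ2|apply analytic_germ1_germ2]. Qed.

Lemma germ1_even_odd k T :
  germ1 k T -> exists A B, germ1 k A /\ germ1 k B /\
    locally 0 (fun u => T u = A (u ^ 2) + u * B (u ^ 2)).
Proof. destruct k; [apply even_odd_smooth|apply even_odd_analytic]. Qed.

Lemma germ2_is_derive_x k f : germ2 k f ->
  near (fun x y => is_derive (fun t => f t y) x (Derive (fun t => f t y) x)).
Proof.
intros H; destruct (smooth_germ2_partials f (germ2_smooth k f H))
  as [r [fx [fy [Hr [_ [_ [_ [Hx _]]]]]]]].
apply near_box; exists r; split; auto; intros x y Hxy.
apply Derive_correct; exists (fx x y); auto.
Qed.

Lemma germ2_is_derive_y k f : germ2 k f ->
  near (fun x y => is_derive (fun t => f x t) y (Derive (fun t => f x t) y)).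
Proof.
intros H; apply (near_swap (fun x y => is_derive (fun t => f y t) x
  (Derive (fun t => f y t) x))).
apply (germ2_is_derive_x k (fun x y => f y x)), germ2_swap, H.
Qed.

Lemma germ2_continuity k f : germ2 k f -> near (continuity_2d_pt f).
Proof.
intros H; apply germ2_smooth, smooth_germ2_Cn in H; destruct H as [r [Hr C]].
apply near_box; exists r; split; auto; intros x y Hxy.
apply (Cn_continuity 0 _ _ _ _ (C 0%nat) Hxy).
Qed.

Lemma germ2_continuity_0 k f : germ2 k f -> continuity_2d_pt f 0 0.
Proof. intros H; apply (near_0 _ (germ2_continuity k f H)). Qed.

Lemma germ2_differentiable k f : germ2 k f ->
  near (fun x y => differentiable_pt_lim f x y
    (Derive (fun t => f t y) x) (Derive (fun t => f x t) y)).
Proof.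
intros H; destruct (smooth_germ2_partials f (germ2_smooth k f H))
  as [r [fx [fy [Hr [_ [Cx [_ [Hx Hy]]]]]]]].
apply near_box; exists r; split; auto; intros x y Hxy.
replace (Derive _ x) with (fx x y)
  by (symmetry; apply is_derive_unique; auto).
replace (Derive _ y) with (fy x y)
  by (symmetry; apply is_derive_unique; auto).
apply C1_differentiable with (box r); auto; [apply open2_box|].
apply (Cn_continuity 0 _ _ _ _ (Cx 0%nat) Hxy).
Qed.

Lemma germ2_inverse_param_right k F :
  germ2 k F -> F 0 0 = 0 -> Derive (fun x => F x 0) 0 <> 0 ->
  exists G, germ2 k G /\ G 0 0 = 0 /\ near (fun t s => F (G t s) s = t).
Proof.
destruct k; [apply inverse_param_smooth|apply inverse_param_analytic].
Qed.

(** A right inverse suffices: by the chain rule G has nonzero derivative, so it has a right inverse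
    H in turn; evaluating F after G after H in two ways gives H = F, so G is a left inverse too. *)
Lemma germ2_inverse_param k F :
  germ2 k F -> F 0 0 = 0 -> Derive (fun x => F x 0) 0 <> 0 ->
  exists G, germ2 k G /\ G 0 0 = 0 /\ near (fun t s => F (G t s) s = t) /\
    near (fun x s => G (F x s) s = x).
Proof.
intros HF HF0 Hd.
destruct (germ2_inverse_param_right k F HF HF0 Hd) as [G [HG [HG0 EG]]].
assert (HdG : Derive (fun t => G t 0) 0 <> 0).
{ intros Hz.
  assert (D : is_derive (fun t => F (G t 0) 0) 0
    (scal (Derive (fun t => G t 0) 0) (Derive (fun x => F x 0) (G 0 0)))).
  { apply (is_derive_comp (fun x => F x 0) (fun t => G t 0)).
    - rewrite HG0; apply (near_0 _ (germ2_is_derive_x k F HF)).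
    - apply (near_0 _ (germ2_is_derive_x k G HG)). }
  assert (D' : is_derive (fun t => F (G t 0) 0) 0 1).
  { apply is_derive_ext_loc with (fun t => t); [|apply: is_derive_id].
    apply filter_imp with (2 := locally_of_near_x _ EG); auto. }
  apply is_derive_unique in D; apply is_derive_unique in D'.
  rewrite D' Hz in D; unfold scal in D; simpl in D; unfold mult in D; simpl in D.
  lra. }
destruct (germ2_inverse_param_right k G HG HG0 HdG) as [H [HH [HH0 EH]]].
exists G; split; [|split; [|split]]; auto.
assert (E2 : near (fun x s => F (G (H x s) s) s = H x s)).
{ apply (near_comp (fun t s => F (G t s) s = t) H (fun _ s => s)); auto.
  - apply germ2_continuity_0 with k; auto.
  - apply continuity_2d_pt_id2. }
apply near_mono with (1 := near_and _ _ EH E2).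
intros x s [H1 H2]; rewrite H1 in H2; rewrite H2; exact H1.
Qed.

(** * Chain rule, local diffeomorphisms and the flow box *)

Definition pdx (f : R -> R -> R) (x y : R) : R := Derive (fun t => f t y) x.
Definition pdy (f : R -> R -> R) (x y : R) : R := Derive (fun t => f x t) y.

(** The coefficient of df /\ dg. *)
Definition jacobian (f g : R -> R -> R) (x y : R) : R :=
  pdx f x y * pdy g x y - pdy f x y * pdx g x y.

Lemma pdx_fst x y : pdx (fun x _ => x) x y = 1.
Proof. apply Derive_id. Qed.
Lemma pdx_snd g x y : pdx (fun _ y => g y) x y = 0.
Proof. exact (Derive_const (g y) x). Qed.
Lemma pdy_fst g x y : pdy (fun x _ => g x) x y = 0.
Proof. exact (Derive_const (g x) y). Qed.

Lemma near_pdx_ext f g :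
  near (fun x y => f x y = g x y) -> near (fun x y => pdx f x y = pdx g x y).
Proof.
intros H; apply near_mono with (1 := near_near _ H); intros x y Hxy.
apply Derive_ext_loc, (locally_2d_1d_const_y _ _ _ Hxy).
Qed.

Lemma near_pdy_ext f g :
  near (fun x y => f x y = g x y) -> near (fun x y => pdy f x y = pdy g x y).
Proof.
intros H; apply near_mono with (1 := near_near _ H); intros x y Hxy.
apply Derive_ext_loc, (locally_2d_1d_const_x _ _ _ Hxy).
Qed.

Lemma near_germ2_comp k (P : R -> R -> Prop) u v :
  near P -> germ2 k u -> germ2 k v -> u 0 0 = 0 -> v 0 0 = 0 ->
  near (fun x y => P (u x y) (v x y)).
Proof.
intros HP Hu Hv; apply near_comp; auto; eapply germ2_continuity_0; eauto.
Qed.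

Lemma near_chain_rule k f u v :
  germ2 k f -> germ2 k u -> germ2 k v -> u 0 0 = 0 -> v 0 0 = 0 ->
  near (fun x y =>
    pdx (fun x y => f (u x y) (v x y)) x y =
      pdx f (u x y) (v x y) * pdx u x y + pdy f (u x y) (v x y) * pdx v x y /\
    pdy (fun x y => f (u x y) (v x y)) x y =
      pdx f (u x y) (v x y) * pdy u x y + pdy f (u x y) (v x y) * pdy v x y).
Proof.
intros Hf Hu Hv Hu0 Hv0.
assert (Df := near_germ2_comp k _ u v (germ2_differentiable k f Hf) Hu Hv Hu0 Hv0).
assert (N := near_and _ _ Df (near_and _ _
  (near_and _ _ (germ2_is_derive_x k u Hu) (germ2_is_derive_y k u Hu))
  (near_and _ _ (germ2_is_derive_x k v Hv) (germ2_is_derive_y k v Hv)))).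
apply near_mono with (1 := N); intros x y [D [[Ux Uy] [Vx Vy]]]; split;
  apply is_derive_unique.
- apply (is_derive_comp_2d f (fun t => u t y) (fun t => v t y)); auto.
- apply (is_derive_comp_2d f (fun t => u x t) (fun t => v x t)); auto.
Qed.

Lemma germ2_opp k f : germ2 k f -> germ2 k (fun x y => - f x y).
Proof.
intros Hf; apply germ2_ext with (fun x y => -1 * f x y).
- apply near_box; exists 1; split; [lra|]; intros; ring.
- apply germ2_mult; [apply germ2_const|auto].
Qed.

Lemma germ2_minus k f g :
  germ2 k f -> germ2 k g -> germ2 k (fun x y => f x y - g x y).
Proof. intros Hf Hg; apply germ2_plus; [auto|apply germ2_opp; auto]. Qed.

Lemma germ2_pdx k f : germ2 k f -> germ2 k (pdx f).
Proof. apply germ2_dx. Qed.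
Lemma germ2_pdy k f : germ2 k f -> germ2 k (pdy f).
Proof. apply germ2_dy. Qed.

Lemma germ2_neq_0 k f : germ2 k f -> f 0 0 <> 0 -> near (fun x y => f x y <> 0).
Proof.
intros Hf H0; apply continuity_2d_pt_neq_0; auto.
apply germ2_continuity_0 with k; auto.
Qed.

(* The reciprocal is an implicit function: it solves (c + s) (z + 1/c) = 1. *)
Lemma germ2_inv k w : germ2 k w -> w 0 0 <> 0 -> germ2 k (fun x y => / w x y).
Proof.
intros Hw H0; set (c := w 0 0) in *.
destruct (germ2_inverse_param k (fun z s => (c + s) * (z + / c) + - 1))
  as [G [HG [HG0 [EG _]]]].
- apply germ2_plus; [|apply germ2_const]; apply germ2_mult; apply germ2_plus;
    try apply germ2_const; [apply germ2_snd|apply germ2_fst].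
- field; auto.
- rewrite (is_derive_unique _ 0 c); auto.
  auto_derive; auto; ring.
- apply germ2_ext with (fun x y => G 0 (w x y - c) + / c).
  + assert (N := near_germ2_comp k _ (fun _ _ => 0) (fun x y => w x y - c) EG
      (germ2_const k 0) (germ2_minus k _ _ Hw (germ2_const k c)) eq_refl
      ltac:(unfold c; ring)).
    apply near_mono with (1 := near_and _ _ N (germ2_neq_0 k w Hw H0)).
    intros x y [E Hn]; apply Rmult_eq_reg_l with (w x y); auto.
    rewrite Rinv_r; auto.
    replace (c + (w x y - c)) with (w x y) in E by ring; lra.
  + apply germ2_plus; [|apply germ2_const].
    apply (germ2_comp k G (fun _ _ => 0) (fun x y => w x y - c)); auto.
    * apply germ2_const.
    * apply germ2_minus; [auto|apply germ2_const].
    * unfold c; ring.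
Qed.

Lemma germ2_div k f w :
  germ2 k f -> germ2 k w -> w 0 0 <> 0 -> germ2 k (fun x y => f x y / w x y).
Proof. intros Hf Hw H0; apply germ2_mult; auto; apply germ2_inv; auto. Qed.

Lemma germ2_inverse_param_y k F :
  germ2 k F -> F 0 0 = 0 -> pdy F 0 0 <> 0 ->
  exists Y, germ2 k Y /\ Y 0 0 = 0 /\ near (fun x s => F x (Y x s) = s) /\
    near (fun x y => Y x (F x y) = y).
Proof.
intros HF HF0 Hd.
destruct (germ2_inverse_param k (fun y x => F x y) (germ2_swap k F HF) HF0 Hd)
  as [G [HG [HG0 [E1 E2]]]].
exists (fun x s => G s x); split; [apply germ2_swap; auto|split; [auto|split]].
- apply (near_swap (fun t s => F s (G t s) = t)), E1.
- apply (near_swap (fun x s => G (F s x) s = x)), E2.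
Qed.

(** Two successive inversions in one variable: Q(x, y) = s is solved for y = Y(x, s), then P(x, Y(x,
    s)) = t for x. The second is possible because the x-derivative of P(x, Y(x, s)) is the Jacobian
    divided by Q_y. *)
Lemma diffeo_of_jacobian_y k P Q :
  germ2 k P -> germ2 k Q -> P 0 0 = 0 -> Q 0 0 = 0 ->
  jacobian P Q 0 0 <> 0 -> pdy Q 0 0 <> 0 -> diffeo_germ k (PMap P Q).
Proof.
intros HP HQ HP0 HQ0 HJ Hd; split; [split; [|split]; auto|].
destruct (germ2_inverse_param_y k Q HQ HQ0 Hd) as [Y [HY [HY0 [E1 E2]]]].
set (P1 := fun x s => P x (Y x s)).
assert (HP1 : germ2 k P1).
{ apply (germ2_comp k P (fun x _ => x) Y); auto; apply germ2_fst. }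
assert (HP10 : P1 0 0 = 0) by (unfold P1; rewrite HY0; auto).
assert (Hd1 : pdx P1 0 0 <> 0).
{ intros Hz; apply HJ.
  assert (C1 := near_0 _ (near_chain_rule k P (fun x _ => x) Y HP (germ2_fst k) HY
    eq_refl HY0)).
  assert (C2 := near_0 _ (near_chain_rule k Q (fun x _ => x) Y HQ (germ2_fst k) HY
    eq_refl HY0)).
  destruct C1 as [C1 _]; destruct C2 as [C2 _].
  change (pdx P1 0 0 = pdx P 0 (Y 0 0) * pdx (fun x _ => x) 0 0 +
    pdy P 0 (Y 0 0) * pdx Y 0 0) in C1.
  assert (C3 := near_0 _ (near_pdx_ext _ _ E1)); cbv beta in C3.
  rewrite C2 (pdx_snd (fun s => s)) HY0 pdx_fst in C3.
  rewrite Hz HY0 pdx_fst in C1; unfold jacobian.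
  replace (pdx Q 0 0) with (- (pdy Q 0 0 * pdx Y 0 0)) by lra.
  replace (pdx P 0 0) with (- (pdy P 0 0 * pdx Y 0 0)) by lra.
  ring. }
destruct (germ2_inverse_param k P1 HP1 HP10 Hd1) as [X [HX [HX0 [E3 E4]]]].
assert (N1 := near_germ2_comp k _ (fun x _ => x) Q E4 (germ2_fst k) HQ eq_refl HQ0).
assert (N2 := near_germ2_comp k _ X (fun _ s => s) E1 HX (germ2_snd k) HX0 eq_refl).
assert (HYX : germ2 k (fun t s => Y (X t s) s)).
{ apply (germ2_comp k Y X (fun _ s => s)); auto; apply germ2_snd. }
exists (PMap X (fun t s => Y (X t s) s)); split; [split; [|split; [|split]]; simpl; auto|split].
- rewrite HX0; auto.
- apply near_mono with (1 := near_and _ _ E2 N1); intros x y [H2 H1]; simpl.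
  unfold P1 in H1; rewrite H2 in H1; rewrite H1; split; auto.
- apply near_mono with (1 := near_and _ _ E3 N2); intros t s [H3 H4]; simpl.
  split; auto.
Qed.

(** If Q_y(0) = 0, the Jacobian forces Q_x(0) <> 0, and exchanging the source coordinates leads to
    the previous case. *)
Lemma diffeo_of_jacobian k P Q :
  germ2 k P -> germ2 k Q -> P 0 0 = 0 -> Q 0 0 = 0 ->
  jacobian P Q 0 0 <> 0 -> diffeo_germ k (PMap P Q).
Proof.
intros HP HQ HP0 HQ0 HJ.
destruct (Req_dec (pdy Q 0 0) 0) as [Hd|Hd];
  [|apply diffeo_of_jacobian_y; auto].
destruct (diffeo_of_jacobian_y k (fun x y => P y x) (fun x y => Q y x))
  as [[_ _] [[X Y] [[HX [HY [HX0 HY0]]] [E1 E2]]]];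
  try apply germ2_swap; auto.
- unfold jacobian in *.
  change (pdy P 0 0 * pdx Q 0 0 - pdx P 0 0 * pdy Q 0 0 <> 0); lra.
- change (pdx Q 0 0 <> 0); intros Hz; apply HJ; unfold jacobian.
  rewrite Hd Hz; ring.
- split; [split; [|split]; auto|].
  exists (PMap Y X); split; [split; [|split]; auto|split].
  + apply near_mono with (1 := near_swap _ E1); simpl; intros x y [H1 H2]; auto.
  + apply E2.
Qed.

(* In the coordinates (x, s = f) a function t with dt /\ df = W dx /\ dy is a
   primitive in x of W / f_y. *)
Lemma flow_box_y k W f :
  germ2 k W -> germ2 k f -> f 0 0 = 0 -> pdy f 0 0 <> 0 ->
  exists t, germ2 k t /\ t 0 0 = 0 /\
    near (fun x y => jacobian t f x y = W x y).
Proof.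
intros HW Hf Hf0 Hd.
destruct (germ2_inverse_param_y k f Hf Hf0 Hd) as [Y [HY [HY0 [E1 E2]]]].
set (w := fun x s => W x (Y x s) / pdy f x (Y x s)).
assert (Hw : germ2 k w).
{ apply (germ2_div k (fun x s => W x (Y x s)) (fun x s => pdy f x (Y x s))).
  - apply (germ2_comp k W (fun x _ => x) Y); auto; apply germ2_fst.
  - apply (germ2_comp k (pdy f) (fun x _ => x) Y); auto;
      [apply germ2_pdy; auto|apply germ2_fst].
  - rewrite HY0; auto. }
destruct (germ2_primitive k w Hw) as [q [Hq Eq]].
set (t0 := fun x s => x * q x s).
assert (Ht0 : germ2 k t0) by (apply germ2_mult; auto; apply germ2_fst).
assert (Ht : germ2 k (fun x y => t0 x (f x y))).
{ apply (germ2_comp k t0 (fun x _ => x) f); auto; apply germ2_fst. }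
exists (fun x y => t0 x (f x y)); split; [auto|split].
- unfold t0; ring.
- assert (C := near_chain_rule k t0 (fun x _ => x) f Ht0 (germ2_fst k) Hf
    eq_refl Hf0).
  assert (D := near_germ2_comp k _ (fun x _ => x) f Eq (germ2_fst k) Hf
    eq_refl Hf0).
  assert (Hn := germ2_neq_0 k _ (germ2_pdy k f Hf) Hd).
  apply near_mono with (1 := near_and _ _ C (near_and _ _ D (near_and _ _ E2 Hn))).
  intros x y [[Cx Cy] [Dq [E Hn0]]]; unfold jacobian; rewrite Cx Cy.
  rewrite pdx_fst (pdy_fst (fun x => x)).
  apply is_derive_unique in Dq.
  change (pdx t0 x (f x y) = w x (f x y)) in Dq.
  rewrite Dq; unfold w; rewrite E; field; auto.
Qed.

Lemma flow_box k W f :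
  germ2 k W -> germ2 k f -> f 0 0 = 0 -> pdx f 0 0 <> 0 \/ pdy f 0 0 <> 0 ->
  exists t, germ2 k t /\ t 0 0 = 0 /\
    near (fun x y => jacobian t f x y = W x y).
Proof.
intros HW Hf Hf0 [Hd|Hd]; [|apply flow_box_y; auto].
(* Exchanging x and y reverses the orientation, whence the sign on [W]. *)
destruct (flow_box_y k (fun x y => - W y x) (fun x y => f y x))
  as [t [Ht [Ht0 E]]]; auto.
- apply germ2_opp, (germ2_swap k W HW).
- apply germ2_swap; auto.
- exists (fun x y => t y x); split; [apply germ2_swap; auto|split; auto].
  apply near_mono with (1 := near_swap _ E); intros x y Exy.
  replace (W x y) with (- - W x y) by ring; rewrite <- Exy.
  unfold jacobian.
  change (pdx (fun x y => t y x) x y) with (pdy t y x).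
  change (pdy (fun x y => t y x) x y) with (pdx t y x).
  change (pdx (fun x y => f y x) y x) with (pdy f x y).
  change (pdy (fun x y => f y x) y x) with (pdx f x y).
  ring.
Qed.

(** * Germs of one variable *)

Lemma germ1_Derive k g : germ1 k g -> germ1 k (Derive g).
Proof. rewrite !germ1_germ2; apply germ2_dy. Qed.

Lemma germ1_is_derive k g : germ1 k g -> locally 0 (fun y => is_derive g y (Derive g y)).
Proof.
rewrite germ1_germ2; intros H.
apply (locally_of_near_y _ (germ2_is_derive_y k _ H)).
Qed.

Lemma germ1_is_derive_0 k g : germ1 k g -> is_derive g 0 (Derive g 0).
Proof. intros H; apply (locally_singleton _ _ (germ1_is_derive k g H)). Qed.

Lemma germ1_const k c : germ1 k (fun _ => c).
Proof. apply germ1_germ2, germ2_const. Qed.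

Lemma germ1_id k : germ1 k (fun t => t).
Proof. apply germ1_germ2, germ2_snd. Qed.

Lemma germ1_mult k f g : germ1 k f -> germ1 k g -> germ1 k (fun t => f t * g t).
Proof. rewrite !germ1_germ2; apply germ2_mult. Qed.

Lemma germ1_plus k f g : germ1 k f -> germ1 k g -> germ1 k (fun t => f t + g t).
Proof. rewrite !germ1_germ2; apply germ2_plus. Qed.

Lemma germ1_opp k f : germ1 k f -> germ1 k (fun t => - f t).
Proof. rewrite !germ1_germ2; apply germ2_opp. Qed.

Lemma germ2_of_germ1_comp k g u :
  germ1 k g -> germ2 k u -> u 0 0 = 0 -> germ2 k (fun x y => g (u x y)).
Proof.
rewrite germ1_germ2; intros Hg Hu Hu0.
apply (germ2_comp k (fun _ y => g y) u u); auto.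
Qed.

Lemma germ1_comp k g u :
  germ1 k g -> germ1 k u -> u 0 = 0 -> germ1 k (fun t => g (u t)).
Proof.
intros Hg Hu Hu0; apply germ1_germ2.
apply (germ2_of_germ1_comp k g (fun _ y => u y)); auto; apply germ1_germ2, Hu.
Qed.

Lemma germ1_of_germ2_comp k f a b :
  germ2 k f -> germ1 k a -> germ1 k b -> a 0 = 0 -> b 0 = 0 ->
  germ1 k (fun t => f (a t) (b t)).
Proof.
rewrite !germ1_germ2; intros Hf Ha Hb Ha0 Hb0.
apply (germ2_comp k f (fun _ y => a y) (fun _ y => b y)); auto.
Qed.

Lemma germ2_of_germ1_fst k g : germ1 k g -> germ2 k (fun x _ => g x).
Proof. intros Hg; apply germ2_of_germ1_comp; auto; apply germ2_fst. Qed.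

Lemma germ1_continuity_0 k u : germ1 k u -> continuity_pt u 0.
Proof. intros H; eapply is_derive_continuity_pt, (germ1_is_derive_0 k u H). Qed.

Lemma locally_germ1_comp k (P : R -> Prop) u :
  locally 0 P -> germ1 k u -> u 0 = 0 -> locally 0 (fun t => P (u t)).
Proof.
intros HP Hu H0; assert (C := germ1_continuity_0 k u Hu).
apply continuity_pt_filterlim in C; rewrite H0 in C; apply (C P HP).
Qed.

Lemma near_locally_comp k (P : R -> R -> Prop) a b :
  near P -> germ1 k a -> germ1 k b -> a 0 = 0 -> b 0 = 0 ->
  locally 0 (fun t => P (a t) (b t)).
Proof.
intros HP Ha Hb Ha0 Hb0; rewrite -> germ1_germ2 in Ha, Hb.
apply (locally_of_near_y (fun _ y => P (a y) (b y))).
apply (near_germ2_comp k P (fun _ y => a y) (fun _ y => b y)); auto.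
Qed.

Lemma locally_Derive_ext (f g : R -> R) :
  locally 0 (fun t => f t = g t) -> locally 0 (fun t => Derive f t = Derive g t).
Proof.
intros H; generalize (locally_locally _ _ H); apply filter_imp; intros t Ht.
apply Derive_ext_loc, Ht.
Qed.

Lemma Derive_ext_0 (f g : R -> R) :
  locally 0 (fun t => f t = g t) -> Derive f 0 = Derive g 0.
Proof. intros H; apply (locally_singleton _ _ (locally_Derive_ext f g H)). Qed.

Lemma Derive_left_inverse_neq_0 k u T :
  germ1 k u -> germ1 k T -> u 0 = 0 -> locally 0 (fun t => T (u t) = t) ->
  Derive T 0 <> 0 /\ Derive u 0 <> 0.
Proof.
intros Hu HT Hu0 E.
assert (D : is_derive (fun t => T (u t)) 0 (scal (Derive u 0) (Derive T (u 0)))).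
{ apply (is_derive_comp T u); [|apply germ1_is_derive_0 with k; auto].
  rewrite Hu0; apply germ1_is_derive_0 with k; auto. }
apply is_derive_unique in D; rewrite (Derive_ext_0 _ _ E) Derive_id Hu0 in D.
unfold scal in D; simpl in D; unfold mult in D; simpl in D.
split; intros Hz; rewrite Hz in D; lra.
Qed.

Lemma germ1_inverse k u :
  germ1 k u -> u 0 = 0 -> Derive u 0 <> 0 ->
  exists T, germ1 k T /\ T 0 = 0 /\ locally 0 (fun z => u (T z) = z) /\
    locally 0 (fun t => T (u t) = t).
Proof.
intros Hu Hu0 Hd.
destruct (germ2_inverse_param k (fun x _ => u x) (germ2_of_germ1_fst k u Hu) Hu0 Hd)
  as [G [HG [HG0 [E1 E2]]]].
exists (fun z => G z 0); split; [|split; [auto|split]].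
- apply (germ1_of_germ2_comp k G (fun t => t) (fun _ => 0)); auto;
    [apply germ1_id|apply germ1_const].
- apply (locally_of_near_x _ E1).
- apply (locally_of_near_x _ E2).
Qed.

(** Hadamard's lemma, read off from primitives: t q and f have the same derivative and both vanish
    at 0. *)
Lemma germ1_factor_id k f :
  germ1 k f -> f 0 = 0 ->
  exists q, germ1 k q /\ locally 0 (fun t => f t = t * q t).
Proof.
intros Hf Hf0.
destruct (germ2_primitive k (fun x _ => Derive f x)) as [q [Hq E]].
{ apply germ2_of_germ1_fst, germ1_Derive, Hf. }
exists (fun t => q t 0); split.
- apply (germ1_of_germ2_comp k q (fun t => t) (fun _ => 0)); auto;
    [apply germ1_id|apply germ1_const].
- generalize (filter_and _ _ (locally_of_near_x _ E) (germ1_is_derive k f Hf)).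
  rewrite !locally_0_Rabs; intros [r [Hr H]]; exists r; split; auto; intros t Ht.
  apply (eq_of_is_derive f (fun t => t * q t 0) (Derive f) r); auto.
  + intros x Hx; apply H; auto.
  + intros x Hx; apply (H x Hx).
  + rewrite Hf0; ring.
Qed.

(** The root is 1 + z, where z solves (1 + z)^2 = 1 + s implicitly at s = psi - 1; this works in
    both categories at once. *)
Lemma germ1_sqrt k psi :
  germ1 k psi -> psi 0 = 1 ->
  exists rho, germ1 k rho /\ rho 0 = 1 /\ locally 0 (fun t => rho t ^ 2 = psi t).
Proof.
intros Hp H0.
destruct (germ2_inverse_param k (fun z s => (1 + z) * (1 + z) + - (1 + s)))
  as [G [HG [HG0 [EG _]]]].
- apply germ2_plus; [apply germ2_mult|apply germ2_opp]; apply germ2_plus;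
    try apply germ2_const; try apply germ2_fst; apply germ2_snd.
- ring.
- rewrite (is_derive_unique _ 0 2); [lra|auto_derive; auto; ring].
- assert (Hs : germ1 k (fun t => psi t + -1))
    by (apply germ1_plus; [auto|apply germ1_const]).
  exists (fun t => 1 + G 0 (psi t + -1)); split; [|split].
  + apply germ1_plus; [apply germ1_const|].
    apply (germ1_of_germ2_comp k G (fun _ => 0) (fun t => psi t + -1)); auto;
      [apply germ1_const|cbv beta; rewrite H0; ring].
  + cbv beta; rewrite H0; replace (1 + -1) with 0 by ring; rewrite HG0; ring.
  + assert (N := near_locally_comp k _ (fun _ => 0) (fun t => psi t + -1) EG
      (germ1_const k 0) Hs eq_refl ltac:(cbv beta; rewrite H0; ring)).
    generalize N; apply filter_imp; intros t Et; lra.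
Qed.

(** Dividing twice by t gives phi = t^2 p. With c = p(0), the quotient p / c is 1 at 0 and has a
    square root rho, and u = t rho. The constant [c] carries the sign, so no case distinction
    arises. *)
Lemma morse k phi :
  germ1 k phi -> phi 0 = 0 -> Derive phi 0 = 0 -> Derive (Derive phi) 0 <> 0 ->
  exists c u, c <> 0 /\ germ1 k u /\ u 0 = 0 /\ Derive u 0 <> 0 /\
    locally 0 (fun t => phi t = c * u t ^ 2).
Proof.
intros Hp H0 H1 H2.
destruct (germ1_factor_id k phi Hp H0) as [q [Hq Eq]].
assert (Hq0 : q 0 = 0).
{ transitivity (Derive phi 0); [|auto].
  rewrite (Derive_ext_0 _ _ Eq); symmetry; apply is_derive_unique.
  replace (q 0) with (1 * q 0 + 0 * Derive q 0) by ring.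
  apply: is_derive_mult; [apply: is_derive_id| |intros; apply Rmult_comm].
  apply germ1_is_derive_0 with k; auto. }
destruct (germ1_factor_id k q Hq Hq0) as [p [Hp2 Ep]].
set (c := p 0).
(* Differentiating t^2 p twice at 0 leaves 2 p(0). *)
assert (Hc : c <> 0).
{ intros Hc; apply H2.
  assert (E : locally 0 (fun t => phi t = t ^ 2 * p t)).
  { generalize (filter_and _ _ Eq Ep); apply filter_imp; intros t [-> ->]; ring. }
  assert (E' : locally 0 (fun t => Derive phi t = 2 * t * p t + t ^ 2 * Derive p t)).
  { generalize (filter_and _ _ (locally_Derive_ext _ _ E) (germ1_is_derive k p Hp2)).
    apply filter_imp; intros t [-> D]; apply is_derive_unique.
    apply: is_derive_mult; auto; [auto_derive; auto; ring|].
    intros; apply Rmult_comm. }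
  rewrite (Derive_ext_0 _ _ E').
  assert (D1 := germ1_is_derive_0 k p Hp2).
  assert (D2 := germ1_is_derive_0 k _ (germ1_Derive k p Hp2)).
  assert (D : is_derive (fun t => 2 * t * p t + t ^ 2 * Derive p t) 0
    (((2 * p 0) + (2 * 0) * Derive p 0) +
     ((2 * 0) * Derive p 0 + 0 ^ 2 * Derive (Derive p) 0))).
  { apply: is_derive_plus; apply: is_derive_mult; auto;
      try (intros; apply Rmult_comm); auto_derive; auto; ring. }
  rewrite (is_derive_unique _ _ _ D); fold c; rewrite Hc; ring. }
destruct (germ1_sqrt k (fun t => / c * p t)) as [rho [Hr [Hr0 Er]]].
- apply germ1_mult; [apply germ1_const|auto].
- fold c; field; auto.
- exists c, (fun t => t * rho t); split; [auto|split; [|split; [|split]]].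
  + apply germ1_mult; [apply germ1_id|auto].
  + ring.
  + rewrite (is_derive_unique _ 0 (1 * rho 0 + 0 * Derive rho 0)).
    * rewrite Hr0; lra.
    * apply: is_derive_mult; [apply: is_derive_id| |intros; apply Rmult_comm].
      apply germ1_is_derive_0 with k; auto.
  + generalize (filter_and _ _ (filter_and _ _ Eq Ep) Er); apply filter_imp.
    intros t [[-> ->] E]; rewrite Rpow_mult_distr E; field; auto.
Qed.

(* With phi = c u^2 and t = A(u^2) + u B(u^2) inverting u, the curve s = phi(t)
   satisfies (t - A(s/c))^2 = u^2 B(u^2)^2 = - kap(s), where u^2 = s/c. *)
Lemma fold_normalization k phi :
  germ1 k phi -> phi 0 = 0 -> Derive phi 0 = 0 -> Derive (Derive phi) 0 <> 0 ->
  exists a kap, germ1 k a /\ germ1 k kap /\ a 0 = 0 /\ kap 0 = 0 /\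
    Derive kap 0 <> 0 /\
    near (fun t s => s = phi t <-> kap s + (t - a s) ^ 2 = 0).
Proof.
intros Hp H0 H1 H2.
destruct (morse k phi Hp H0 H1 H2) as [c [u [Hc [Hu [Hu0 [Hdu Eu]]]]]].
destruct (germ1_inverse k u Hu Hu0 Hdu) as [T [HT [HT0 [E1 E2]]]].
destruct (germ1_even_odd k T HT) as [A [B [HA [HB ET]]]].
assert (HA0 : A 0 = 0).
{ assert (X := locally_singleton _ _ ET); cbv beta in X; rewrite HT0 in X.
  replace (0 ^ 2) with 0 in X by ring; lra. }
(* B(0) is the derivative at 0 of the inverse function [T]. *)
assert (HB0 : B 0 <> 0).
{ intros Hz; destruct (Derive_left_inverse_neq_0 k u T Hu HT Hu0 E2) as [HdT _].
  apply HdT; rewrite (Derive_ext_0 _ _ ET).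
  assert (Dsq : forall f, germ1 k f ->
    is_derive (fun z => f (z ^ 2)) 0 (scal 0 (Derive f (0 ^ 2)))).
  { intros f Hf; apply (is_derive_comp f (fun z => z ^ 2)).
    - replace (0 ^ 2) with 0 by ring; apply germ1_is_derive_0 with k; auto.
    - auto_derive; auto; ring. }
  assert (D : is_derive (fun z => A (z ^ 2) + z * B (z ^ 2)) 0
    (scal 0 (Derive A (0 ^ 2)) +
     (1 * B (0 ^ 2) + 0 * scal 0 (Derive B (0 ^ 2))))).
  { apply: is_derive_plus; auto.
    apply: is_derive_mult; auto; [apply: is_derive_id|intros; apply Rmult_comm]. }
  rewrite (is_derive_unique _ _ _ D).
  replace (0 ^ 2) with 0 by ring; rewrite Hz.
  unfold scal; simpl; unfold mult; simpl; ring. }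
assert (Hsc : germ1 k (fun s => / c * s))
  by (apply germ1_mult; [apply germ1_const|apply germ1_id]).
assert (Hsc0 : / c * 0 = 0) by ring.
set (a := fun s => A (/ c * s)); set (b := fun s => B (/ c * s)).
assert (Ha : germ1 k a) by (apply (germ1_comp k A (fun s => / c * s)); auto).
assert (Hb : germ1 k b) by (apply (germ1_comp k B (fun s => / c * s)); auto).
set (kap := fun s => - (/ c * s * (b s * b s))).
assert (Hk : germ1 k kap)
  by (apply germ1_opp, germ1_mult; [auto|apply germ1_mult; auto]).
assert (Ha0 : a 0 = 0) by (unfold a; rewrite Hsc0; auto).
assert (Hb0 : b 0 <> 0) by (unfold b; rewrite Hsc0; auto).
exists a, kap; split; [auto|split; [auto|split; [auto|split; [|split]]]].
- unfold kap; ring.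
(* The derivative of [kap] at 0 is - B(0)^2 / c. *)
- assert (Db := germ1_is_derive_0 k b Hb).
  assert (D : is_derive (fun s => - / c * s * (b s * b s)) 0
    (- / c * (b 0 * b 0) + (- / c * 0) * (Derive b 0 * b 0 + b 0 * Derive b 0))).
  { apply: is_derive_mult; [auto_derive; auto; ring| |intros; apply Rmult_comm].
    apply: is_derive_mult; auto; intros; apply Rmult_comm. }
  rewrite (Derive_ext kap (fun s => - / c * s * (b s * b s)));
    [|intros s; unfold kap; ring].
  rewrite (is_derive_unique _ _ _ D).
  replace (_ + _) with (- (/ c * (b 0 * b 0))) by ring.
  apply Ropp_neq_0_compat, Rmult_integral_contrapositive_currified;
    [apply Rinv_neq_0_compat; auto|].
  apply Rmult_integral_contrapositive_currified; auto.
(* [v] recovers u from a point of the normalised curve: there v^2 = s / c, so T(v) = A(s / c) + v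
   B(s / c) = t, hence u(t) = v and phi(t) = c v^2 = s. *)
- set (v := fun t s => (t - a s) / b s).
  assert (Ga : germ2 k (fun _ s => a s)) by (apply germ1_germ2; auto).
  assert (Gb : germ2 k (fun _ s => b s)) by (apply germ1_germ2; auto).
  assert (Gv : germ2 k v).
  { apply (germ2_div k (fun t s => t - a s) (fun _ s => b s)); auto.
    apply germ2_minus; [apply germ2_fst|auto]. }
  assert (Gv0 : v 0 0 = 0) by (unfold v; rewrite Ha0; field; auto).
  assert (NT : near (fun t s => T (v t s) = A (v t s ^ 2) + v t s * B (v t s ^ 2))).
  { apply (near_germ2_comp k (fun z _ => T z = A (z ^ 2) + z * B (z ^ 2)) v v); auto.
    apply (near_of_locally_x _ ET). }
  assert (Nu : near (fun t s => u (T (v t s)) = v t s)).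
  { apply (near_germ2_comp k (fun z _ => u (T z) = z) v v); auto.
    apply (near_of_locally_x _ E1). }
  assert (ETu : locally 0 (fun t => T (u t) = A (u t ^ 2) + u t * B (u t ^ 2)))
    by (apply (locally_germ1_comp k _ u ET); auto).
  assert (N := near_and _ _ (near_and _ _ NT Nu) (near_and _ _
    (near_and _ _ (near_of_locally_x _ (filter_and _ _ ETu E2))
      (near_of_locally_x _ Eu)) (germ2_neq_0 k _ Gb Hb0))).
  apply near_mono with (1 := N).
  intros t s [[HTv Huv] [[[HTu HTu'] Hphi] Hbs]]; split; intros Hs.
  + assert (Hus : / c * s = u t ^ 2) by (rewrite Hs Hphi; field; auto).
    unfold kap, a, b; rewrite Hus.
    replace (t - A (u t ^ 2)) with (u t * B (u t ^ 2)) by lra; ring.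
  + assert (Hv2 : v t s ^ 2 = / c * s).
    { unfold v, Rdiv; rewrite Rpow_mult_distr.
      replace ((t - a s) ^ 2) with (/ c * s * (b s * b s))
        by (unfold kap in Hs; lra).
      field; auto. }
    assert (HTt : T (v t s) = t).
    { rewrite HTv Hv2; fold (a s) (b s); unfold v; field; auto. }
    rewrite HTt in Huv; rewrite Hphi Huv Hv2; field; auto.
Qed.

(** * Reduction to the normal form *)

Lemma poissonE w f h x y :
  poisson w f h x y = jacobian h f x y / dxdy_coef w x y.
Proof.
unfold poisson, lie, jacobian, pdx, pdy; simpl; unfold Rdiv; ring.
Qed.

Lemma near_poisson_ext w f h h' :
  near (fun x y => h x y = h' x y) ->
  near (fun x y => poisson w f h x y = poisson w f h' x y).
Proof.
intros H; assert (N := near_and _ _ (near_pdx_ext _ _ H) (near_pdy_ext _ _ H)).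
apply near_mono with (1 := N); intros x y [E1 E2].
rewrite !poissonE; unfold jacobian; rewrite E1 E2; reflexivity.
Qed.

(** The chain rule for F(t, f), with {f, f} = 0 and {f, t} = 1. *)
Lemma near_poisson_flow_box k w f t F :
  symplectic k w -> germ2 k f -> f 0 0 = 0 -> germ2 k t -> t 0 0 = 0 ->
  germ2 k F -> near (fun x y => jacobian t f x y = dxdy_coef w x y) ->
  near (fun x y => poisson w f (fun x y => F (t x y) (f x y)) x y =
                   pdx F (t x y) (f x y)).
Proof.
intros [HW HW0] Hf Hf0 Ht Ht0 HF HJ.
assert (N := near_and _ _ (near_chain_rule k F t f HF Ht Hf Ht0 Hf0)
  (near_and _ _ HJ (germ2_neq_0 k _ HW HW0))).
apply near_mono with (1 := N); intros x y [[Cx Cy] [J W0]].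
rewrite poissonE; unfold jacobian in *; rewrite Cx Cy.
apply Rmult_eq_reg_r with (dxdy_coef w x y); auto.
unfold Rdiv; rewrite Rmult_assoc Rinv_l; auto; rewrite -J; ring.
Qed.

Lemma is_derive_germ2_graph k F phi :
  germ2 k F -> germ1 k phi -> phi 0 = 0 ->
  locally 0 (fun t => is_derive (fun t => F t (phi t)) t
    (pdx F t (phi t) + pdy F t (phi t) * Derive phi t)).
Proof.
intros HF Hp H0.
generalize (filter_and _ _ (germ1_is_derive k phi Hp)
  (near_locally_comp k _ (fun t => t) phi (germ2_differentiable k F HF)
    (germ1_id k) Hp eq_refl H0)).
apply filter_imp; intros t [D1 D2].
rewrite -(Rmult_1_r (pdx F t (phi t))).
apply (is_derive_comp_2d F (fun t => t) phi); auto; apply: is_derive_id.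
Qed.

Lemma near_chain_rule_1 k g u :
  germ1 k g -> germ2 k u -> u 0 0 = 0 ->
  near (fun x y => pdx (fun x y => g (u x y)) x y = Derive g (u x y) * pdx u x y /\
                   pdy (fun x y => g (u x y)) x y = Derive g (u x y) * pdy u x y).
Proof.
intros Hg Hu Hu0; assert (Hg' := proj1 (germ1_germ2 k g) Hg).
apply near_mono with
  (1 := near_chain_rule k (fun _ y => g y) u u Hg' Hu Hu Hu0 Hu0).
intros x y [E1 E2]; rewrite E1 E2 (pdx_snd g).
change (pdy (fun _ y => g y) (u x y) (u x y)) with (Derive g (u x y)).
split; ring.
Qed.

(** Differentiating hh(t, phi(t)) = 0 twice at 0 gives hh_s phi' = - hh_t = 0 and hh_s phi'' = -
    hh_tt <> 0; the mixed terms drop out because phi'(0) = 0. *)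
Lemma tangency_graph k hh :
  germ2 k hh -> hh 0 0 = 0 -> pdx hh 0 0 = 0 -> pdx (pdx hh) 0 0 <> 0 ->
  pdy hh 0 0 <> 0 ->
  exists phi, germ1 k phi /\ phi 0 = 0 /\ Derive phi 0 = 0 /\
    Derive (Derive phi) 0 <> 0 /\ near (fun t s => hh t s = 0 <-> s = phi t).
Proof.
intros Hh H0 H1 H2 Hy.
destruct (germ2_inverse_param_y k hh Hh H0 Hy) as [Y [HY [HY0 [E1 E2]]]].
set (phi := fun t => Y t 0).
assert (Hp : germ1 k phi).
{ apply (germ1_of_germ2_comp k Y (fun t => t) (fun _ => 0)); auto;
    [apply germ1_id|apply germ1_const]. }
assert (Hp0 : phi 0 = 0) by exact HY0.
assert (E : locally 0 (fun t => hh t (phi t) = 0)) by apply (locally_of_near_x _ E1).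
assert (D : locally 0 (fun t => pdx hh t (phi t) + pdy hh t (phi t) * Derive phi t = 0)).
{ generalize (filter_and _ _ (is_derive_germ2_graph k hh phi Hh Hp Hp0)
    (locally_Derive_ext _ _ E)).
  apply filter_imp; intros t [D1 D2]; rewrite Derive_const in D2.
  rewrite <- D2; symmetry; apply is_derive_unique, D1. }
assert (Hp1 : Derive phi 0 = 0).
{ assert (X := locally_singleton _ _ D); cbv beta in X; rewrite Hp0 H1 in X.
  destruct (Rmult_integral (pdy hh 0 0) (Derive phi 0)); [lra|contradiction|auto]. }
exists phi; split; [auto|split; [auto|split; [auto|split]]].
- intros Hpp; apply H2.
  assert (D1 := locally_singleton _ _
    (is_derive_germ2_graph k (pdx hh) phi (germ2_pdx k hh Hh) Hp Hp0)).
  assert (D2 := locally_singleton _ _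
    (is_derive_germ2_graph k (pdy hh) phi (germ2_pdy k hh Hh) Hp Hp0)).
  assert (D3 := germ1_is_derive_0 k _ (germ1_Derive k phi Hp)).
  cbv beta in D1, D2; rewrite Hp0 Hp1 in D1; rewrite Hp0 Hp1 in D2.
  assert (D4 : is_derive (fun t => pdx hh t (phi t) + pdy hh t (phi t) * Derive phi t) 0
    ((pdx (pdx hh) 0 0 + pdy (pdx hh) 0 0 * 0) +
     ((pdx (pdy hh) 0 0 + pdy (pdy hh) 0 0 * 0) * Derive phi 0 +
      pdy hh 0 (phi 0) * Derive (Derive phi) 0))).
  { apply: is_derive_plus; auto.
    apply: is_derive_mult; auto; intros; apply Rmult_comm. }
  apply is_derive_unique in D4.
  rewrite (Derive_ext_0 _ _ D) Derive_const Hp1 Hpp in D4; lra.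
- assert (N := near_and _ _ E2 (near_of_locally_x _ E)).
  apply near_mono with (1 := N); intros t s [Es Et]; split; intros Hs.
  + unfold phi; rewrite <- Hs, Es; reflexivity.
  + rewrite Hs; exact Et.
Qed.

Lemma normal_form_exists k T :
  is_triple k T -> S1 k T ->
  exists g, admissible k g /\ equivalent k T (normal_form g).
Proof.
destruct T as [w H f]; intros [[HW HW0] [_ [Hf Hf0]]] [h [Hh [Hp1 Hp2]]].
simpl in *; destruct Hh as [Hh [Hh0 [Hdh Hhyp]]].
(* If df(0) = 0, every bracket with f vanishes at 0, against the second S1 condition. *)
assert (Hdf : pdx f 0 0 <> 0 \/ pdy f 0 0 <> 0).
{ destruct (Req_dec (pdx f 0 0) 0) as [E1|E1]; auto.
  destruct (Req_dec (pdy f 0 0) 0) as [E2|E2]; auto.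
  exfalso; apply Hp2; rewrite poissonE; unfold jacobian; rewrite E1 E2.
  unfold Rdiv; ring. }
destruct (flow_box k (dxdy_coef w) f HW Hf Hf0 Hdf) as [t [Ht [Ht0 HJ]]].
assert (HJ0 : jacobian t f 0 0 <> 0) by (rewrite (near_0 _ HJ); auto).
destruct (diffeo_of_jacobian k t f Ht Hf Ht0 Hf0 HJ0)
  as [_ [[xi eta] [[Hxi [Heta [Hxi0 Heta0]]] [I1 _]]]]; simpl in *.
set (hh := fun t s => h (xi t s) (eta t s)).
assert (Hhh : germ2 k hh) by (apply (germ2_comp k h xi eta); auto).
assert (Ehh : near (fun x y => h x y = hh (t x y) (f x y))).
{ apply near_mono with (1 := I1); simpl; intros x y [E1 E2]; unfold hh.
  rewrite E1 E2; reflexivity. }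
assert (Hhh0 : hh 0 0 = 0) by (unfold hh; rewrite Hxi0 Heta0; auto).
assert (Hw : symplectic k w) by (split; auto).
assert (Q1 : near (fun x y => poisson w f h x y = pdx hh (t x y) (f x y))).
{ apply near_mono with (1 := near_and _ _ (near_poisson_ext w f _ _ Ehh)
    (near_poisson_flow_box k w f t hh Hw Hf Hf0 Ht Ht0 Hhh HJ)).
  intros x y [-> E]; exact E. }
assert (Q2 : near (fun x y => poisson w f (poisson w f h) x y =
  pdx (pdx hh) (t x y) (f x y))).
{ apply near_mono with (1 := near_and _ _ (near_poisson_ext w f _ _ Q1)
    (near_poisson_flow_box k w f t (pdx hh) Hw Hf Hf0 Ht Ht0 (germ2_pdx k hh Hhh) HJ)).
  intros x y [-> E]; exact E. }
assert (Hx : pdx hh 0 0 = 0).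
{ assert (X := near_0 _ Q1); cbv beta in X; rewrite Ht0 Hf0 in X; congruence. }
assert (Hxx : pdx (pdx hh) 0 0 <> 0).
{ assert (X := near_0 _ Q2); cbv beta in X; rewrite Ht0 Hf0 in X; congruence. }
(* Since hh_t(0) = 0 by tangency, hh_s(0) = 0 would make dh(0) = 0. *)
assert (Hy : pdy hh 0 0 <> 0).
{ intros Hz.
  assert (C := near_0 _ (near_chain_rule k hh t f Hhh Ht Hf Ht0 Hf0)).
  assert (X := near_0 _ (near_pdx_ext _ _ Ehh)).
  assert (Y := near_0 _ (near_pdy_ext _ _ Ehh)).
  cbv beta in C, X, Y; rewrite Ht0 Hf0 Hx Hz in C; destruct C as [C1 C2].
  rewrite C1 in X; rewrite C2 in Y.
  destruct Hdh as [Hdh|Hdh]; apply Hdh.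
  - change (pdx h 0 0 = 0); rewrite X; ring.
  - change (pdy h 0 0 = 0); rewrite Y; ring. }
destruct (tangency_graph k hh Hhh Hhh0 Hx Hxx Hy)
  as [phi [Hp [Hphi0 [Hphi1 [Hphi2 Eph]]]]].
destruct (fold_normalization k phi Hp Hphi0 Hphi1 Hphi2)
  as [a [kap [Ha [Hk [Ha0 [Hk0 [Hk1 Ek]]]]]]].
destruct (germ1_inverse k kap Hk Hk0 Hk1) as [g [Hg [Hg0 [_ Eg]]]].
assert (Hg1 : Derive g 0 <> 0).
{ apply (Derive_left_inverse_neq_0 k kap g); auto. }
exists g; split; [split; auto|].
assert (Hk' := germ1_is_derive k kap Hk); assert (Hg' := germ1_is_derive k g Hg).
assert (Haf : germ2 k (fun x y => a (f x y))) by (apply germ2_of_germ1_comp; auto).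
set (P := fun x y => t x y - a (f x y)); set (Q := fun x y => kap (f x y)).
assert (HP : germ2 k P) by (apply germ2_minus; auto).
assert (HQ : germ2 k Q) by (apply germ2_of_germ1_comp; auto).
assert (HP0 : P 0 0 = 0) by (unfold P; rewrite Ht0 Hf0 Ha0; ring).
assert (HQ0 : Q 0 0 = 0) by (unfold Q; rewrite Hf0; auto).
(* Both d(a(f)) and d(kap(f)) are multiples of df, so dP /\ dQ = kap'(f) dt /\ df. *)
assert (JPQ : near (fun x y => jacobian P Q x y = Derive kap (f x y) * dxdy_coef w x y)).
{ assert (N := near_and _ _ (near_and _ _ (near_chain_rule_1 k a f Ha Hf Hf0)
    (near_chain_rule_1 k kap f Hk Hf Hf0)) (near_and _ _ HJ
    (near_and _ _ (near_and _ _ (germ2_is_derive_x k t Ht) (germ2_is_derive_y k t Ht))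
    (near_and _ _ (germ2_is_derive_x k _ Haf) (germ2_is_derive_y k _ Haf))))).
  apply near_mono with (1 := N).
  intros x y [[[A1 A2] [K1 K2]] [J [[Tx Ty] [Ax Ay]]]].
  assert (Px : pdx P x y = pdx t x y - pdx (fun x y => a (f x y)) x y)
    by (apply is_derive_unique; apply: is_derive_minus; auto).
  assert (Py : pdy P x y = pdy t x y - pdy (fun x y => a (f x y)) x y)
    by (apply is_derive_unique; apply: is_derive_minus; auto).
  unfold jacobian in *; rewrite Px Py A1 A2 K1 K2 -J; ring. }
exists (PMap P Q); split; [|split; [|split]]; simpl.
- apply diffeo_of_jacobian; auto.
  rewrite (near_0 _ JPQ) Hf0; apply Rmult_integral_contrapositive_currified; auto.
(* As g inverts kap, the density g'(Q) of the normal form cancels the factor kap'(f). *)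
- assert (Ng : near (fun x y => Derive g (Q x y) * Derive kap (f x y) = 1)).
  { apply (near_germ2_comp k (fun _ s => Derive g (kap s) * Derive kap s = 1) f f);
      auto.
    apply near_of_locally_y.
    generalize (filter_and _ _ (filter_and _ _ Hk' (locally_Derive_ext _ _ Eg))
      (locally_germ1_comp k _ kap Hg' Hk Hk0)).
    apply filter_imp; intros s [[D1 D2] D3].
    rewrite Derive_id in D2; rewrite -[RHS]D2; symmetry; apply is_derive_unique.
    rewrite Rmult_comm; apply (is_derive_comp g kap); auto. }
  apply near_mono with (1 := near_and _ _ Ng JPQ); intros x y [E1 E2].
  rewrite Derive_id !Derive_const.
  change (Derive (fun t => g t) (Q x y)) with (Derive g (Q x y)).
  change ((1 * Derive g (Q x y) - 0 * 0) * jacobian P Q x y = dxdy_coef w x y).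
  rewrite E2; transitivity (Derive g (Q x y) * Derive kap (f x y) * dxdy_coef w x y);
    [ring|rewrite E1; ring].
- assert (N1 := near_germ2_comp k _ t f Eph Ht Hf Ht0 Hf0).
  assert (N2 := near_germ2_comp k _ t f Ek Ht Hf Ht0 Hf0).
  apply near_mono with (1 := near_and _ _ (near_and _ _ Hhyp Ehh) (near_and _ _ N1 N2)).
  intros x y [[X1 X2] [X3 X4]]; rewrite X1 X2 X3; exact X4.
- apply (near_germ2_comp k (fun _ s => g (kap s) = s) f f); auto.
  apply (near_of_locally_y _ Eg).
Qed.

(** * Uniqueness of the normal form *)

Lemma PSeries_left_zero_coef0 (d : nat -> R) e :
  0 < e -> Rbar_lt 0 (CV_radius d) ->
  (forall y, - e < y < 0 -> PSeries d y = 0) -> d 0%nat = 0.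
Proof.
intros He Hd H; apply NNPP; intros Hn.
assert (C : continuity_pt (PSeries d) 0)
  by (apply PSeries_continuity; rewrite Rabs_R0; auto).
rewrite -> continuity_pt_locally in C.
destruct (C (mkposreal _ (Rabs_pos_lt _ Hn))) as [r Hr]; simpl in Hr.
set (y := - (Rmin e r / 2)).
assert (Hm : 0 < Rmin e r) by (apply Rmin_pos; auto; apply cond_pos).
assert (Hm1 : Rmin e r <= e) by apply Rmin_l.
assert (Hm2 : Rmin e r <= r) by apply Rmin_r.
assert (X : Rabs (PSeries d y - PSeries d 0) < Rabs (d 0%nat)).
{ apply Hr; change (Rabs (y - 0) < r); unfold y; split_Rabs; lra. }
rewrite PSeries_0 H in X; [|unfold y; lra].
rewrite Rminus_0_l Rabs_Ropp in X; lra.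
Qed.

(** Continuity at 0 kills the constant coefficient; dividing by y < 0 then shifts the series, which
    still vanishes for small negative y. *)
Lemma PSeries_left_zero (n : nat) (d : nat -> R) e :
  0 < e -> Rbar_lt 0 (CV_radius d) ->
  (forall y, - e < y < 0 -> PSeries d y = 0) -> d n = 0.
Proof.
intros He; revert d e He; induction n as [|n IH]; intros d e He Hd H.
- apply PSeries_left_zero_coef0 with e; auto.
- assert (Hd0 := PSeries_left_zero_coef0 d e He Hd H).
  destruct (CV_radius_pos_bound d Hd) as [r [M [Hr HM]]].
  apply (IH (PS_decr_1 d) (Rmin e r)).
  + apply Rmin_pos; auto.
  + rewrite CV_radius_decr_1; auto.
  + intros y Hy.
    assert (Hy1 := Rmin_l e r); assert (Hy2 := Rmin_r e r).
    assert (X := H y ltac:(lra)); rewrite PSeries_decr_1 in X.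
    * rewrite Hd0 in X; assert (Y : y * PSeries (PS_decr_1 d) y = 0) by lra.
      apply Rmult_integral in Y; lra.
    * apply CV_radius_inside, CV_radius_bound with r M; auto; split_Rabs; lra.
Qed.

Lemma analytic_germ1_identity f g :
  analytic_germ1 f -> analytic_germ1 g ->
  locally 0 (fun y => y <= 0 -> f y = g y) -> locally 0 (fun y => f y = g y).
Proof.
intros [a [Ha Ea]] [b [Hb Eb]] E.
destruct (CV_radius_pos_bound a Ha) as [r [M [Hr HM]]].
destruct (CV_radius_pos_bound b Hb) as [s [N [Hs HN]]].
set (p := Rmin r s); assert (Hp : 0 < p) by (apply Rmin_pos; auto).
assert (Hle : forall t n, p <= t -> p ^ n <= t ^ n)
  by (intros t n Ht; apply pow_incr; lra).
set (d := PS_minus a b).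
assert (Hd : forall n, Rabs (d n) * p ^ n <= M + N).
{ intros n; apply Rle_trans with (Rabs (a n) * p ^ n + Rabs (b n) * p ^ n).
  - rewrite <- Rmult_plus_distr_r; apply Rmult_le_compat_r; [apply pow_le; lra|].
    unfold d, PS_minus, PS_plus, PS_opp, plus, opp; simpl.
    eapply Rle_trans; [apply Rabs_triang|]; rewrite Rabs_Ropp; lra.
  - assert (X1 := Hle r n (Rmin_l _ _)); assert (X2 := Hle s n (Rmin_r _ _)).
    pose proof (Rabs_pos (a n)); pose proof (Rabs_pos (b n)).
    specialize (HM n); specialize (HN n); nra. }
generalize (filter_and _ _ E (filter_and _ _ Ea Eb)); rewrite locally_0_Rabs.
intros [e [He H]].
assert (Hz : forall n, d n = 0).
{ intros n; apply PSeries_left_zero with (Rmin e p).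
  - apply Rmin_pos; auto.
  - apply CV_radius_pos_of_bound with p (M + N); auto.
  - intros y Hy; assert (H1 := Rmin_l e p); assert (H2 := Rmin_r e p).
    assert (Hpr : p <= r) by apply Rmin_l; assert (Hps : p <= s) by apply Rmin_r.
    destruct (H y ltac:(split_Rabs; lra)) as [X [Y1 Y2]].
    unfold d; rewrite PSeries_minus.
    + rewrite -Y1 -Y2 X; lra.
    + apply CV_radius_inside, CV_radius_bound with r M; auto; split_Rabs; lra.
    + apply CV_radius_inside, CV_radius_bound with s N; auto; split_Rabs; lra. }
generalize (filter_and _ _ Ea Eb); apply filter_imp; intros y [-> ->].
apply PSeries_ext; intros n; specialize (Hz n).
unfold d, PS_minus, PS_plus, PS_opp, plus, opp in Hz; simpl in Hz; lra.
Qed.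

(** Agreement on y <= 0 determines the germ in the analytic category, so one argument on the
    half-line serves both. *)
Lemma same_invariant_left k g1 g2 :
  germ1 k g1 -> germ1 k g2 ->
  (same_invariant k g1 g2 <-> locally 0 (fun y => y <= 0 -> g1 y = g2 y)).
Proof.
intros H1 H2; destruct k; simpl; [tauto|]; split.
- apply filter_imp; auto.
- apply analytic_germ1_identity; auto.
Qed.

Lemma normal_form_dxdy g x y :
  dxdy_coef (form (normal_form g)) x y = Derive g y.
Proof.
simpl; rewrite Derive_id !Derive_const.
change (Derive (fun t => g t) y) with (Derive g y); ring.
Qed.

(** Here [g'] is the second germ, not a derivative. An equivalence must carry g(y) to g'(y), which
    leaves no choice for the new ordinate but phi = S(g(y)) with [S] a local inverse of [g']. The
    last clause is the chain rule. *)
Lemma transition_map k g g' :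
  admissible k g -> admissible k g' ->
  exists phi S, germ1 k phi /\ phi 0 = 0 /\ Derive phi 0 <> 0 /\ germ1 k S /\
    S 0 = 0 /\ locally 0 (fun y => g' (phi y) = g y) /\
    locally 0 (fun z => S (g' z) = z) /\ (forall y, phi y = S (g y)) /\
    locally 0 (fun y => Derive g' (phi y) * Derive phi y = Derive g y).
Proof.
intros [Hg [Hg0 Hg1]] [Hg' [Hg0' Hg1']].
destruct (germ1_inverse k g' Hg' Hg0' Hg1') as [S [HS [HS0 [E1 E2]]]].
set (phi := fun y => S (g y)).
assert (Hp : germ1 k phi) by (apply (germ1_comp k S g); auto).
assert (Hp0 : phi 0 = 0) by (unfold phi; rewrite Hg0; auto).
assert (E3 : locally 0 (fun y => g' (phi y) = g y))
  by (apply (locally_germ1_comp k (fun z => g' (S z) = z) g); auto).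
assert (D : locally 0 (fun y => Derive g' (phi y) * Derive phi y = Derive g y)).
{ generalize (filter_and _ _ (filter_and _ _ (germ1_is_derive k phi Hp)
    (locally_Derive_ext _ _ E3))
    (locally_germ1_comp k _ phi (germ1_is_derive k g' Hg') Hp Hp0)).
  apply filter_imp; intros y [[D1 D2] D3]; rewrite <- D2; symmetry.
  apply is_derive_unique; rewrite Rmult_comm.
  apply (is_derive_comp g' phi); auto. }
exists phi, S; repeat (split; auto).
intros Hz; apply Hg1; assert (X := locally_singleton _ _ D); cbv beta in X.
rewrite <- X, Hz; ring.
Qed.

Lemma germ1_neq_0 k g : germ1 k g -> g 0 <> 0 -> locally 0 (fun y => g y <> 0).
Proof.
rewrite germ1_germ2; intros Hg H0.
apply (locally_of_near_y _ (germ2_neq_0 k _ Hg H0)).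
Qed.

(* The second component of an equivalence is a function phi of y alone; preserving
   the forms then gives P = x + c(y), and the reflection x -> -x of the parabola
   forces c = 0 and phi = id on y <= 0. *)
Lemma equivalent_normal_form_left k g g' :
  admissible k g -> admissible k g' ->
  equivalent k (normal_form g) (normal_form g') ->
  locally 0 (fun y => y <= 0 -> g' y = g y).
Proof.
intros Ag Ag' [[P Q] [[[HP [HQ [HP0 HQ0]]] _] [EW [EH EF]]]].
destruct (transition_map k g g' Ag Ag')
  as [phi [S [Hp [Hp0 [Hp1 [HS [HS0 [E1 [E2 [Ephi E3]]]]]]]]]].
destruct Ag as [Hg [Hg0 Hg1]]; destruct Ag' as [Hg' [Hg0' Hg1']].
cbn [fst_comp snd_comp fn hyp normal_form] in *.
(* Preservation of the function says g'(Q) = g(y); applying [S] yields Q. *)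
assert (EQ : near (fun x y => Q x y = phi y)).
{ assert (N := near_germ2_comp k (fun _ z => S (g' z) = z) Q Q
    (near_of_locally_y _ E2) HQ HQ HQ0 HQ0).
  apply near_mono with (1 := near_and _ _ N EF); intros x y [X1 X2].
  rewrite Ephi -X2; auto. }
(* As Q does not depend on x, the condition on the forms reduces to (Derive g')(phi) phi' P_x =
   Derive g, and the chain rule identity for phi leaves P_x = 1. *)
assert (EP : near (fun x y => is_derive (fun t => P t y) x 1)).
{ assert (N := near_and _ _ (near_and _ _ EW (near_and _ _ (near_pdx_ext _ _ EQ)
    (near_pdy_ext _ _ EQ))) (near_and _ _ (near_and _ _ EQ
    (near_of_locally_y _ (filter_and _ _ E3
      (germ1_neq_0 k _ (germ1_Derive k g Hg) Hg1))))
    (germ2_is_derive_x k P HP))).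
  apply near_mono with (1 := N).
  intros x y [[W [Qx Qy]] [[EQxy [D Hn]] DP]].
  replace 1 with (pdx P x y); [exact DP|].
  change (dxdy_coef (form (normal_form g')) (P x y) (Q x y) * jacobian P Q x y =
    dxdy_coef (form (normal_form g)) x y) in W.
  rewrite !normal_form_dxdy in W; unfold jacobian in W; rewrite Qx Qy in W.
  rewrite (pdx_snd phi) EQxy in W.
  change (pdy (fun _ y => phi y) x y) with (Derive phi y) in W.
  apply Rmult_eq_reg_r with (Derive g y); auto.
  rewrite Rmult_1_l -{2}W -{1}D; ring. }
assert (N := near_and _ _ EP (near_and _ _ EH EQ)); apply near_box in N.
destruct N as [r [Hr N]].
assert (Br : forall x y, Rabs x < r -> Rabs y < r -> P x y = x + P 0 y).
{ intros x y Hx Hy.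
  apply (eq_of_is_derive (fun t => P t y) (fun t => t + P 0 y) (fun _ => 1) r);
    auto; [| |ring].
  - intros t Ht; apply (N t y); split; auto.
  - intros t _; auto_derive; auto. }
(* The points (x, - x^2) and (- x, - x^2) of the parabola share the same shift c: phi + (x + c)^2 =
   0 and phi + (- x + c)^2 = 0 give x c = 0. *)
assert (Key : forall x, Rabs x < Rmin 1 r -> phi (- x ^ 2) = - x ^ 2).
{ intros x Hx.
  destruct (Rlt_Rmin _ _ _ Hx) as [Hx1 Hx2].
  destruct (Req_dec x 0) as [->|Hx0].
  { replace (- 0 ^ 2) with 0 by ring; auto. }
  assert (Hy : Rabs (- x ^ 2) < r).
  { rewrite Rabs_Ropp -RPow_abs; pose proof (Rabs_pos x); simpl; nra. }
  assert (Hx' : Rabs (- x) < r) by (rewrite Rabs_Ropp; auto).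
  destruct (N x (- x ^ 2) (conj Hx2 Hy)) as [_ [H1 Q1]].
  destruct (N (- x) (- x ^ 2) (conj Hx' Hy)) as [_ [H2 Q2]].
  assert (K1 := proj1 H1 ltac:(ring)); assert (K2 := proj1 H2 ltac:(ring)).
  rewrite Q1 (Br x _ Hx2 Hy) in K1; rewrite Q2 (Br (- x) _ Hx' Hy) in K2.
  set (c := P 0 (- x ^ 2)) in *.
  assert (Hc : x * c = 0) by lra.
  apply Rmult_integral in Hc; destruct Hc as [Hc|Hc]; [lra|].
  rewrite Hc in K1; lra. }
set (e := Rmin 1 r); assert (He : 0 < e) by (apply Rmin_pos; lra).
apply locally_0_Rabs in E1; destruct E1 as [r1 [Hr1 E1]].
assert (He2 : 0 < e ^ 2) by (apply pow_lt; auto).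
apply locally_0_Rabs; exists (Rmin r1 (e ^ 2)); split; [apply Rmin_pos; auto|].
intros y Hy Hneg.
destruct (Rlt_Rmin _ _ _ Hy) as [Hy1 Hy2].
assert (Hs : - sqrt (- y) ^ 2 = y) by (rewrite pow2_sqrt; lra).
assert (Hphi : phi y = y).
{ rewrite -Hs; apply Key; fold e.
  rewrite Rabs_pos_eq; [|apply sqrt_pos].
  rewrite <- (sqrt_pow2 e); [|lra]; apply sqrt_lt_1; try lra.
  revert Hy2; split_Rabs; lra. }
rewrite -(E1 y Hy1) Hphi; reflexivity.
Qed.

Lemma normal_form_equivalent_left k g g' :
  admissible k g -> admissible k g' ->
  locally 0 (fun y => y <= 0 -> g' y = g y) ->
  equivalent k (normal_form g) (normal_form g').
Proof.
intros Ag Ag' E.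
destruct (transition_map k g g' Ag Ag')
  as [phi [S [Hp [Hp0 [Hp1 [HS [HS0 [E1 [E2 [Ephi E3]]]]]]]]]].
destruct Ag as [Hg [Hg0 Hg1]].
destruct (germ1_inverse k g Hg Hg0 Hg1) as [G [_ [_ [_ EG]]]].
assert (Gphi : germ2 k (fun _ y => phi y)) by (apply germ1_germ2; auto).
exists (PMap (fun x _ => x) (fun _ y => phi y)); split; [|split; [|split]].
- apply diffeo_of_jacobian; auto; [apply germ2_fst|].
  unfold jacobian; rewrite pdx_fst (pdy_fst (fun x => x)).
  change (1 * Derive phi 0 - 0 * pdx (fun _ y => phi y) 0 0 <> 0); lra.
- apply near_mono with (1 := near_of_locally_y _ E3); intros x y D.
  change (dxdy_coef (form (normal_form g')) x (phi y) *
    jacobian (fun x _ => x) (fun _ y => phi y) x y =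
    dxdy_coef (form (normal_form g)) x y).
  rewrite !normal_form_dxdy; unfold jacobian.
  rewrite pdx_fst (pdy_fst (fun x => x)) -D.
  change (pdy (fun _ y => phi y) x y) with (Derive phi y); ring.
(* The second alternative serves the converse inclusion: a point whose image lies on the parabola
   has phi(y) <= 0, where g and g' agree, so injectivity of g gives phi(y) = y. *)
- assert (N : locally 0 (fun y => (y <= 0 \/ phi y <= 0) -> phi y = y)).
  { generalize (filter_and _ _ (filter_and _ _ E E1)
      (filter_and _ _ (filter_and _ _ E2 EG)
        (locally_germ1_comp k _ phi (filter_and _ _ E EG) Hp Hp0))).
    apply filter_imp; intros y [[X1 X2] [[X3 X4] [X5 X6]]] [Hy|Hy].
    - rewrite Ephi -X1; auto.
    - rewrite -{2}X4 -X2 X5; auto. }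
  apply near_mono with (1 := near_of_locally_y _ N); simpl; intros x y Hy.
  split; intros H.
  + rewrite Hy; auto; left; pose proof (pow2_ge_0 x); simpl in *; lra.
  + rewrite -Hy; auto; right; pose proof (pow2_ge_0 x); simpl in *; lra.
- apply near_mono with (1 := near_of_locally_y _ E1); auto.
Qed.

Theorem theorem1p2 (k : category) :
  (forall T : triple, is_triple k T -> S1 k T ->
     exists g : R -> R, admissible k g /\ equivalent k T (normal_form g)) /\
  (forall g g' : R -> R, admissible k g -> admissible k g' ->
     (equivalent k (normal_form g) (normal_form g') <->
      same_invariant k g' g)).
Proof.
split; [apply normal_form_exists|].
intros g g' Ag Ag'.
rewrite same_invariant_left; [|apply Ag'|apply Ag]; split.
- apply equivalent_normal_form_left; auto.
- apply normal_form_equivalent_left; auto.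
Qed.
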